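(* Let $W$ be a c.e. theory that is $\tau$-$\mathsf{R}_{0\mathsf{p}}$-sourced for some translation $\tau$. Let $S$ and $T$ be c.e. theories in the signature of $W$ such that $W\subseteq S\subseteq T$ and $S\not\rhd_{\sf loc}T$. Then there is a c.e. theory $U$ such that $S\subseteq U\subseteq T$, $S\not\rhd_{\sf loc}U$ and $U\not\rhd_{\sf loc}T$.
   Context: For theories $X,Y$ in the same signature, $X\subseteq Y$ means every theorem of $X$ is a theorem of $Y$. Translations: domain formula and formulas for each relation symbol (identity included; function symbols via graphs), extended by commuting with connectives and relativizing quantifiers; possibly multidimensional with parameters. $V\rhd U$ iff some translation $\tau$ has $V\vdash\varphi^\tau$ for all theorems $\varphi$ of $U$; $V\rhd_{\sf loc}U$ iff $V\rhd U_0$ for all finitely axiomatized subtheories $U_0$ of $U$. $\mathbb{L}_{\sf a}=\{0,\mathsf{S},+,\times,\leq\}$ with $\leq$ primitive; $\mathbb{L}_{\sf ap}$ is $\mathbb{L}_{\sf a}$ plus a unary predicate $\mathsf{P}$; $\mathfrak{id}_{\sf ap}$ its identity axioms. $\mathsf{R}_0$ has axioms, for all $m,n\in\omega$: $\overline{m}+\overline{n}=\overline{m+n}$; $\overline{m}\times\overline{n}=\overline{m\times n}$; $\overline{m}\neq\overline{n}$ if $m\neq n$; $\forall x(x\leq\overline{n}\to\bigvee_{i\leq n}x=\overline{i})$; $\overline{m}\leq\overline{n}$ if $m\leq n$ ($\overline{n}$ numerals). $\mathsf{R}_{0\mathsf{p}}$ is $\mathsf{R}_0$ plus $\mathsf{P}(\overline{n})$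 for all $n$. $W$ is $\tau$-$\mathsf{R}_{0\mathsf{p}}$-sourced iff $W$ is deductively equivalent to $(\mathsf{R}_{0\mathsf{p}}+\mathfrak{id}_{\sf ap})^\tau$. *)

(* Defs.v *)
From Stdlib Require List.
From HB Require Import structures.
From mathcomp Require Import all_boot.

Set Implicit Arguments.
Unset Strict Implicit.
Unset Printing Implicit Defensive.

(* Twice this number is (a + b)(a + b + 1) + 2 b. *)
Definition cpair (a b : nat) : nat := 'C((a + b).+1, 2) + b.

(* Kleene's partial recursive functions, presented as unary functions through
   the pairing [cpair]; the identity is [RPair RLeft RRight]. *)
Inductive recfun : Type :=
| RZero | RSucc | RLeft | RRight
| RPair of recfun & recfun
| RComp of recfun & recfun
| RPrec of recfun & recfun
| RMin of recfun.

(* [reval c n y]: the function with program [c] is defined at [n], with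
   value [y]. *)
Fixpoint reval (c : recfun) (n y : nat) {struct c} : Prop :=
  match c with
  | RZero => y = 0
  | RSucc => y = n.+1
  | RLeft => exists b, n = cpair y b
  | RRight => exists a, n = cpair a y
  | RPair f g =>
      exists a b, [/\ reval f n a, reval g n b & y = cpair a b]
  | RComp f g => exists2 z, reval g n z & reval f z y
  | RPrec f g =>
      exists a k, n = cpair a k /\
        (fix iter (k y : nat) {struct k} : Prop :=
           if k is k'.+1 then
             exists2 z, iter k' z & reval g (cpair a (cpair k' z)) y
           else reval f a y) k y
  | RMin f =>
      reval f (cpair n y) 0 /\
      forall z, z < y -> exists k, reval f (cpair n z) k.+1
  end.

Definition ce (A : nat -> Prop) : Prop :=
  exists c : recfun, forall n, A n <-> exists y, reval c n y.

(* The enumeration of the symbols carried by [countType] is only used for the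
   Goedel numbering.  Finite signatures are a special case. *)
Record signature : Type := Signature {
  fsym : countType;
  far : fsym -> nat;
  rsym : countType;
  rar : rsym -> nat
}.

(* Variables are de Bruijn indices. *)
Inductive term (L : signature) : Type :=
| Var of nat
| Fun (f : fsym L) of {ffun 'I_(far f) -> term L}.

Inductive form (L : signature) : Type :=
| Bot
| Eq of term L & term L
| Rel (r : rsym L) of {ffun 'I_(rar r) -> term L}
| Imp of form L & form L
| All of form L.

Arguments Var {L}.
Arguments Bot {L}.

Section Syntax.
Variable L : signature.
Implicit Types (s : nat -> term L) (t u : term L) (p q : form L).

Fixpoint tsubst s t {struct t} : term L :=
  match t with
  | Var x => s x
  | Fun f a => Fun [ffun i => tsubst s (a i)]
  end.

Definition up s (x : nat) : term L :=
  if x is y.+1 then tsubst (fun z => Var z.+1) (s y) else Var 0.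

Fixpoint subst s p {struct p} : form L :=
  match p with
  | Bot => Bot
  | Eq t u => Eq (tsubst s t) (tsubst s u)
  | Rel r a => Rel [ffun i => tsubst s (a i)]
  | Imp p q => Imp (subst s p) (subst s q)
  | All p => All (subst (up s) p)
  end.

Definition ren (f : nat -> nat) p : form L := subst (fun x => Var (f x)) p.

Definition inst p t : form L := subst (fun x => if x is y.+1 then Var y else t) p.

(* All free variables are below [n]. *)
Fixpoint tbounded (n : nat) t {struct t} : bool :=
  match t with
  | Var x => x < n
  | Fun f a => all id (codom (fun i => tbounded n (a i)))
  end.

Fixpoint bounded (n : nat) p {struct p} : bool :=
  match p with
  | Bot => true
  | Eq t u => tbounded n t && tbounded n u
  | Rel r a => all id (codom (fun i => tbounded n (a i)))
  | Imp p q => bounded n p && bounded n q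
  | All p => bounded n.+1 p
  end.

Definition sentence p : bool := bounded 0 p.

Definition Neg p : form L := Imp p Bot.
Definition And p q : form L := Neg (Imp p (Neg q)).
Definition Or p q : form L := Imp (Neg p) q.
Definition Ex p : form L := Neg (All (Neg p)).
Definition Alls (n : nat) p : form L := iter n (@All L) p.
Definition Exs (n : nat) p : form L := iter n Ex p.
Definition Imps (ps : seq (form L)) p : form L := foldr (@Imp L) p ps.
Definition Ands (ps : seq (form L)) p : form L := foldr And p ps.
Definition Ors (ps : seq (form L)) : form L := foldr Or Bot ps.

Inductive prf : seq (form L) -> form L -> Prop :=
| PAx G p : List.In p G -> prf G p
| PImpI G p q : prf (p :: G) q -> prf G (Imp p q)
| PImpE G p q : prf G (Imp p q) -> prf G p -> prf G q
| PAllI G p : prf (map (ren succn) G) p -> prf G (All p)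
| PAllE G p t : prf G (All p) -> prf G (inst p t)
| PRaa G p : prf (Neg p :: G) Bot -> prf G p
| PRefl G t : prf G (Eq t t)
| PLeibniz G p t u : prf G (Eq t u) -> prf G (inst p t) -> prf G (inst p u).

Definition proves (X : form L -> Prop) p : Prop :=
  exists2 G, forall q, List.In q G -> X q & prf G p.

Definition code_seq (ns : seq nat) : nat :=
  foldr (fun n m => (cpair n m).+1) 0 ns.

Fixpoint code_term t {struct t} : nat :=
  match t with
  | Var x => cpair 0 x
  | Fun f a => cpair 1 (cpair (pickle f) (code_seq (codom (fun i => code_term (a i)))))
  end.

Fixpoint code p {struct p} : nat :=
  match p with
  | Bot => cpair 0 0
  | Eq t u => cpair 1 (cpair (code_term t) (code_term u))
  | Rel r a => cpair 2 (cpair (pickle r) (code_seq (codom (fun i => code_term (a i)))))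
  | Imp p q => cpair 3 (cpair (code p) (code q))
  | All p => cpair 4 (code p)
  end.

End Syntax.

Record theory (L : signature) : Type := Theory {
  axiom : form L -> Prop;
  axiom_sentence : forall p, axiom p -> sentence p
}.

Definition is_theorem (L : signature) (X : theory L) (p : form L) : Prop :=
  sentence p /\ proves (axiom X) p.

Definition subtheory (L : signature) (X Y : theory L) : Prop :=
  forall p, is_theorem X p -> is_theorem Y p.

Definition ded_equiv (L : signature) (X Y : theory L) : Prop :=
  subtheory X Y /\ subtheory Y X.

(* Being c.e. is a property of the set of theorems, not of a chosen set of
   axioms. *)
Definition ce_theory (L : signature) (X : theory L) : Prop :=
  ce (fun n => exists2 p, is_theorem X p & code p = n).

Definition finitely_axiomatized (L : signature) (X : theory L) : Prop :=
  exists ps : seq (form L), forall p, axiom X p <-> List.In p ps.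

(* A translation from [L] to [M] represents an object of [L] by a block of
   [tdim] objects of [M], relative to [tpar] parameters satisfying [tparam].
   In a formula about [n] objects, variable [i * tdim + j] with [i < n] and
   [j < tdim] is component [j] of object [i], and variable [n * tdim + k] is
   parameter [k].  In the graph [tfun f], object [far f] is the value. *)
Record translation (L M : signature) : Type := Translation {
  tdim : nat;
  tpar : nat;
  tparam : form M;
  tdom : form M;
  teq : form M;
  trel : rsym L -> form M;
  tfun : fsym L -> form M;
  tdim_gt0 : 0 < tdim;
  tparamP : bounded tpar tparam;
  tdomP : bounded (tdim + tpar) tdom;
  teqP : bounded (2 * tdim + tpar) teq;
  trelP : forall r, bounded (rar r * tdim + tpar) (trel r);
  tfunP : forall f, bounded ((far f).+1 * tdim + tpar) (tfun f)
}.

Definition is_var (L : signature) (t : term L) : bool :=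
  if t is Var _ then true else false.

Section Translate.
Variables (L M : signature) (tau : translation L M).
Local Notation d := (tdim tau).

(* A block maps [j < tdim] to the target variable holding component [j]; an
   environment assigns a block to each source variable. *)
Local Notation block := (nat -> nat).
Local Notation env := (nat -> block).

Definition bshift (k : nat) (y : block) : block := fun j => k + y j.
Definition eshift (k : nat) (e : env) : env := fun x => bshift k (e x).
Definition bnth (i : nat) : block := fun j => i * d + j.
Definition econs (e : env) : env :=
  fun x => if x is x'.+1 then bshift d (e x') else bnth 0.

(* The target formula [p] about [n] objects, applied to the first [n] blocks
   of [b] and the parameters [w]. *)
Definition tapply (n : nat) (p : form M) (b : env) (w : block) : form M :=
  ren (fun v => if v < n * d then b (v %/ d) (v %% d) else w (v - n * d)) p.

(* [p] applied to the values of [a 0], ..., [a n.-1], followed by the block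
   [y] when [m = n.+1].  The arguments that are not variables are named by
   relativized existential quantifiers; [den i e w z] says that the value of
   [a i] is [z]. *)
Definition unnest (n m : nat) (a : 'I_n -> term L)
    (den : 'I_n -> env -> block -> block -> form M)
    (p : form M) (e : env) (w y : block) : form M :=
  let nv := [seq i <- enum 'I_n | ~~ is_var (a i)] in
  let k := size nv * d in
  let z i := bnth (index i nv) in
  let e' := eshift k e in
  let w' := bshift k w in
  let b x := if insub x is Some i then
               if a i is Var v then e' v else z i
             else bshift k y in
  Exs k (Ands [seq And (tapply 1 (tdom tau) (fun=> z i) w') (den i e' w' (z i))
              | i <- nv]
           (tapply m p b w')).

(* The value of [t] is [y]. *)
Fixpoint tden (t : term L) (e : env) (w y : block) {struct t} : form M :=
  match t with
  | Var x => tapply 2 (teq tau) (fun i => if i is 0 then e x else y) w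
  | Fun f a => unnest (far f).+1 a (fun i => tden (a i)) (tfun tau f) e w y
  end.

Definition pair_args (t u : term L) (i : 'I_2) : term L :=
  if i == ord0 then t else u.

Fixpoint tform (p : form L) (e : env) (w : block) {struct p} : form M :=
  match p with
  | Bot => Bot
  | Eq t u => unnest 2 (pair_args t u) (fun i => tden (pair_args t u i))
                (teq tau) e w id
  | Rel r a => unnest (rar r) a (fun i => tden (a i)) (trel tau r) e w id
  | Imp p q => Imp (tform p e w) (tform q e w)
  | All p =>
      Alls d (Imp (tapply 1 (tdom tau) (fun=> bnth 0) (bshift d w))
                  (tform p (econs e) (bshift d w)))
  end.

(* With parameters: the parameter domain is inhabited, and the translation
   holds for all parameters in it.  On sentences the environment is
   irrelevant. *)
Definition translate (p : form L) : form M :=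
  And (Exs (tpar tau) (tparam tau))
      (Alls (tpar tau) (Imp (tparam tau) (tform p (fun=> id) id))).

End Translate.

Section Bounded.
Variable L : signature.
Implicit Types (t : term L) (p : form L).

Fixpoint term_ind' (P : term L -> Prop) (HV : forall x, P (Var x))
    (HF : forall f (a : {ffun 'I_(far f) -> term L}), (forall i, P (a i)) -> P (Fun a))
    t : P t :=
  match t with
  | Var x => HV x
  | Fun f a => HF f a (fun i => term_ind' HV HF (a i))
  end.

Lemma all_codomP (n : nat) (b : 'I_n -> bool) :
  reflect (forall i, b i) (all id (codom b)).
Proof.
apply: (iffP allP) => [H i | H x]; first exact/H/codom_f.
by case/codomP => i ->; apply: H.
Qed.

Lemma tbounded_subst n m (s : nat -> term L) t :
  (forall x, x < n -> tbounded m (s x)) -> tbounded n t -> tbounded m (tsubst s t).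
Proof.
move=> Hs; elim/term_ind': t => [x | f a IH] /=; first exact: Hs.
move/all_codomP => H; apply/all_codomP => i.
by rewrite ffunE; apply/IH/H.
Qed.

Lemma bounded_subst n m (s : nat -> term L) p :
  (forall x, x < n -> tbounded m (s x)) -> bounded n p -> bounded m (subst s p).
Proof.
elim: p n m s => [|t u|r a|p IHp q IHq|p IHp] n m s Hs //=.
- by case/andP => Ht Hu; rewrite !(tbounded_subst Hs).
- move/all_codomP => H; apply/all_codomP => i.
  by rewrite ffunE (tbounded_subst Hs).
- by case/andP => Hp Hq; rewrite (IHp n) // (IHq n).
- apply: IHp => -[|x] //= Hx.
  exact: (@tbounded_subst m) (Hs _ Hx).
Qed.

Lemma bounded_ren n m (f : nat -> nat) p :
  (forall x, x < n -> f x < m) -> bounded n p -> bounded m (ren f p).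
Proof. by move=> Hf; apply: bounded_subst. Qed.

Lemma bounded_Alls n k p : bounded n (Alls k p) = bounded (k + n) p.
Proof. by elim: k n => //= k IH n; rewrite IH addnS. Qed.

Lemma bounded_Ex n p : bounded n (Ex p) = bounded n.+1 p.
Proof. by rewrite /= !andbT. Qed.

Lemma bounded_Exs n k p : bounded n (Exs k p) = bounded (k + n) p.
Proof. by elim: k n => // k IH n; rewrite [Exs _ _]/(Ex _) bounded_Ex IH addnS. Qed.

Lemma bounded_And n p q : bounded n (And p q) = bounded n p && bounded n q.
Proof. by rewrite /= !andbT. Qed.

Lemma bounded_Ands n ps p :
  bounded n (Ands ps p) = all (bounded n) ps && bounded n p.
Proof. by elim: ps => // q ps IH; rewrite [Ands _ _]/(And _ _) bounded_And IH /= andbA. Qed.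

Lemma bounded_All_Imp n p q :
  bounded n (All (Imp p q)) = bounded n.+1 p && bounded n.+1 q.
Proof. by []. Qed.

Lemma bounded_Imps n ps p :
  bounded n (Imps ps p) = all (bounded n) ps && bounded n p.
Proof. by elim: ps => //= q ps ->; rewrite andbA. Qed.

Lemma bounded_Ors n (ps : seq (form L)) : bounded n (Ors ps) = all (bounded n) ps.
Proof. by elim: ps => //= q ps ->; rewrite andbT. Qed.

End Bounded.

Section TranslateBounded.
Variables (L M : signature) (tau : translation L M).
Local Notation d := (tdim tau).
Local Notation P := (tpar tau).

Lemma bounded_tapply n m p b w :
  bounded (n * d + P) p ->
  (forall i j, i < n -> j < d -> b i j < m) -> (forall k, k < P -> w k < m) ->
  bounded m (tapply tau n p b w).
Proof.
move=> Hp Hb Hw; apply: bounded_ren Hp => v Hv.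
case: (ltnP v (n * d)) => H; last by apply: Hw; rewrite ltn_subLR.
by apply: Hb; rewrite ?ltn_mod ?tdim_gt0 // ltn_divLR ?tdim_gt0.
Qed.

Lemma bounded_unnest n0 m n l (a : 'I_n -> term L) den p e w y :
  (forall i m' e' w' y',
     (forall x j, x < n0 -> j < d -> e' x j < m') ->
     (forall k, k < P -> w' k < m') -> (forall j, j < d -> y' j < m') ->
     bounded m' (den i e' w' y')) ->
  (forall i, tbounded n0 (a i)) ->
  bounded (l * d + P) p ->
  (forall x j, x < n0 -> j < d -> e x j < m) ->
  (forall k, k < P -> w k < m) ->
  (n < l -> forall j, j < d -> y j < m) ->
  bounded m (unnest tau l a den p e w y).
Proof.
move=> Hden Ha Hp He Hw Hy; rewrite /unnest bounded_Exs bounded_Ands.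
set nv := [seq i <- _ | _]; set k := size nv * d.
have Hz i j : i \in nv -> j < d -> bnth tau (index i nv) j < k + m.
  move=> Hi Hj; apply: leq_trans (leq_addr _ _).
  rewrite /bnth /k; apply: (@leq_trans ((index i nv).+1 * d)).
    by rewrite mulSn addnC ltn_add2r.
  by rewrite leq_mul2r index_mem Hi orbT.
have Hw' j : j < P -> bshift k w j < k + m by move=> Hj; rewrite ltn_add2l Hw.
have He' x j : x < n0 -> j < d -> eshift k e x j < k + m.
  by move=> Hx Hj; rewrite ltn_add2l He.
apply/andP; split.
  rewrite all_map; apply/allP => i Hi; rewrite inE bounded_And.
  apply/andP; split; last by apply: Hden => // j; apply: Hz.
  apply: bounded_tapply => //; first by rewrite mul1n tdomP.
  by move=> _ j _; apply: Hz.
apply: bounded_tapply => // x j Hx Hj.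
case: insubP => [i _ Hi | Hnx].
  case Eai: (a i) => [v|f b].
    by apply: He' => //; have := Ha i; rewrite Eai.
  by apply: Hz => //; rewrite mem_filter mem_enum Eai.
rewrite ltn_add2l; apply: Hy Hj.
by apply: leq_ltn_trans Hx; rewrite leqNgt.
Qed.

Lemma bounded_tden n t m e w y :
  tbounded n t -> (forall x j, x < n -> j < d -> e x j < m) ->
  (forall k, k < P -> w k < m) -> (forall j, j < d -> y j < m) ->
  bounded m (tden tau t e w y).
Proof.
elim/term_ind': t m e w y => [x | f a IH] m e w y /= Ht He Hw Hy.
  apply: bounded_tapply => //; first exact: teqP.
  by move=> [|i] j _ Hj; [apply: He | apply: Hy].
move/all_codomP in Ht.
by apply: (bounded_unnest (n0 := n)) => //; [move=> i *; apply: IH | apply: tfunP].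
Qed.

Lemma bounded_tform n p m e w :
  bounded n p -> (forall x j, x < n -> j < d -> e x j < m) ->
  (forall k, k < P -> w k < m) -> bounded m (tform tau p e w).
Proof.
elim: p n m e w => [|t u|r a|p IHp q IHq|p IHp] n m e w //= Hp He Hw.
- have H i : tbounded n (pair_args t u i).
    by case/andP: Hp => Ht Hu; rewrite /pair_args; case: ifP.
  apply: (bounded_unnest (n0 := n)) => //; last exact: teqP.
  by move=> i *; apply: bounded_tden.
- move/all_codomP in Hp.
  apply: (bounded_unnest (n0 := n)) => //; last by rewrite ltnn.
    by move=> i *; apply: bounded_tden.
  exact: trelP.
- by case/andP: Hp => Hp Hq; rewrite (IHp n) // (IHq n).
- have Hw' k : k < P -> bshift d w k < d + m by move=> Hk; rewrite ltn_add2l Hw.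
  have Hb j : j < d -> bnth tau 0 j < d + m.
    by move=> Hj; apply: leq_trans Hj (leq_addr _ _).
  rewrite bounded_Alls /=; apply/andP; split.
    apply: bounded_tapply => //; first by rewrite mul1n tdomP.
    by move=> _ j _; apply: Hb.
  apply: (IHp n.+1) => // -[|x] j Hx Hj; first exact: Hb.
  by rewrite ltn_add2l He.
Qed.

Lemma sentence_translate p : sentence p -> sentence (translate tau p).
Proof.
move=> Hp; rewrite /sentence /translate bounded_And bounded_Exs bounded_Alls /= addn0.
rewrite tparamP; apply: bounded_tform Hp _ _ => // k.
Qed.

End TranslateBounded.

Definition trans_theory (L M : signature) (tau : translation L M) (X : theory L) :
  theory M.
Proof.
refine (@Theory M (fun q => exists2 p, axiom X p & q = translate tau p) _).
abstract (by move=> q [p Hp ->]; apply/sentence_translate/(axiom_sentence Hp)).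
Defined.

Definition theory_union (L : signature) (X Y : theory L) : theory L.
Proof.
refine (@Theory L (fun p => axiom X p \/ axiom Y p) _).
abstract (by move=> p [] /axiom_sentence).
Defined.

Definition interprets (M L : signature) (V : theory M) (U : theory L) : Prop :=
  exists tau : translation L M,
    forall p, is_theorem U p -> is_theorem V (translate tau p).

Definition loc_interprets (M L : signature) (V : theory M) (U : theory L) : Prop :=
  forall U0 : theory L,
    finitely_axiomatized U0 -> subtheory U0 U -> interprets V U0.

(* All of these are provable in the logic above; it is their translations that
   carry content.  A translation treats a function symbol as a graph, so that
   its identity axioms also say that the graph is that of a function. *)
Section Identity.
Variable L : signature.

Definition vars (n k : nat) : {ffun 'I_n -> term L} := [ffun i : 'I_n => Var (k + i)].

Definition eqs (n : nat) : seq (form L) :=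
  [seq Eq (Var i) (Var (n + i)) | i <- iota 0 n].

Inductive id_axiom : form L -> Prop :=
| IdRefl : id_axiom (All (Eq (Var 0) (Var 0)))
| IdEq : id_axiom (Alls 4 (Imps (eqs 2)
    (Imp (Eq (Var 0) (Var 1)) (Eq (Var 2) (Var 3)))))
| IdRel (r : rsym L) : id_axiom (Alls (rar r + rar r) (Imps (eqs (rar r))
    (Imp (Rel (vars (rar r) 0)) (Rel (vars (rar r) (rar r))))))
| IdFun (f : fsym L) : id_axiom (Alls (far f + far f) (Imps (eqs (far f))
    (Eq (Fun (vars (far f) 0)) (Fun (vars (far f) (far f))))))
| IdTotal (f : fsym L) :
    id_axiom (Alls (far f) (Ex (Eq (Fun (vars (far f) 1)) (Var 0))))
| IdUnique (f : fsym L) : id_axiom (Alls (far f).+2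
    (Imp (Eq (Fun (vars (far f) 2)) (Var 0))
    (Imp (Eq (Fun (vars (far f) 2)) (Var 1)) (Eq (Var 0) (Var 1))))).

Lemma bounded_vars n k m :
  k + n <= m -> all id (codom (fun i => tbounded m (vars n k i))).
Proof.
move=> H; apply/all_codomP => i; rewrite ffunE /=.
by apply: leq_trans H; rewrite ltn_add2l.
Qed.

Lemma bounded_eqs n : all (@bounded L (n + n)) (eqs n).
Proof.
rewrite all_map; apply/allP => i; rewrite mem_iota add0n => /= Hi.
by rewrite ltn_add2l Hi (leq_trans Hi) // leq_addr.
Qed.

Lemma sentence_id_axiom p : id_axiom p -> sentence p.
Proof.
case=> [||r|f|f|f]; rewrite /sentence ?bounded_Alls //.
- by rewrite bounded_Imps addn0 bounded_eqs /= !bounded_vars // leq_addr.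
- by rewrite bounded_Imps addn0 bounded_eqs /= !bounded_vars // leq_addr.
- by rewrite bounded_Ex addn0 /= bounded_vars.
- by rewrite addn0 /= !bounded_vars.
Qed.

Definition id_theory : theory L := Theory sentence_id_axiom.

End Identity.

Variant ap_fun : Type := FZero | FSucc | FAdd | FMul.
Variant ap_rel : Type := RLe | RP.

Definition ap_fun_nat (f : ap_fun) : nat :=
  match f with FZero => 0 | FSucc => 1 | FAdd => 2 | FMul => 3 end.
Definition nat_ap_fun (n : nat) : ap_fun :=
  match n with 0 => FZero | 1 => FSucc | 2 => FAdd | _ => FMul end.
Lemma ap_fun_natK : cancel ap_fun_nat nat_ap_fun. Proof. by case. Qed.
HB.instance Definition _ := Countable.copy ap_fun (can_type ap_fun_natK).

Definition ap_rel_bool (r : ap_rel) : bool := if r is RLe then true else false.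
Definition bool_ap_rel (b : bool) : ap_rel := if b then RLe else RP.
Lemma ap_rel_boolK : cancel ap_rel_bool bool_ap_rel. Proof. by case. Qed.
HB.instance Definition _ := Countable.copy ap_rel (can_type ap_rel_boolK).

Definition ap_far (f : ap_fun) : nat :=
  match f with FZero => 0 | FSucc => 1 | FAdd | FMul => 2 end.
Definition ap_rar (r : ap_rel) : nat := if r is RLe then 2 else 1.

Definition L_ap : signature := @Signature ap_fun ap_far ap_rel ap_rar.

Section R0p.
Local Notation tm := (term L_ap).
Local Notation fm := (form L_ap).

Definition zero_ap : tm := @Fun L_ap FZero [ffun _ => Var 0].
Definition succ_ap (t : tm) : tm := @Fun L_ap FSucc [ffun _ => t].
Definition add_ap (t u : tm) : tm :=
  @Fun L_ap FAdd [ffun i => if val i == 0 then t else u].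
Definition mul_ap (t u : tm) : tm :=
  @Fun L_ap FMul [ffun i => if val i == 0 then t else u].
Definition le_ap (t u : tm) : fm :=
  @Rel L_ap RLe [ffun i => if val i == 0 then t else u].
Definition P_ap (t : tm) : fm := @Rel L_ap RP [ffun _ => t].

Definition num (n : nat) : tm := iter n succ_ap zero_ap.

Inductive R0_axiom : fm -> Prop :=
| R0Add m n : R0_axiom (Eq (add_ap (num m) (num n)) (num (m + n)))
| R0Mul m n : R0_axiom (Eq (mul_ap (num m) (num n)) (num (m * n)))
| R0Neq m n : m <> n -> R0_axiom (Neg (Eq (num m) (num n)))
| R0Bound n : R0_axiom (All (Imp (le_ap (Var 0) (num n))
    (Ors [seq Eq (Var 0) (num i) | i <- iota 0 n.+1])))
| R0Le m n : m <= n -> R0_axiom (le_ap (num m) (num n)).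

Inductive R0p_axiom : fm -> Prop :=
| R0pR0 p : R0_axiom p -> R0p_axiom p
| R0pP n : R0p_axiom (P_ap (num n)).

Lemma tbounded_num k n : tbounded k (num n).
Proof.
elim: n => [|n IH]; first by apply/all_codomP => -[].
by apply/all_codomP => i; rewrite ffunE.
Qed.

Lemma sentence_R0p_axiom p : R0p_axiom p -> sentence p.
Proof.
have H2 k t u n : tbounded k t -> tbounded k u ->
    all id (codom (fun i : 'I_n => tbounded k
      ([ffun i : 'I_n => if val i == 0 then t else u] i))).
  by move=> Ht Hu; apply/all_codomP => i; rewrite ffunE; case: ifP.
case=> [q|n]; last by apply/all_codomP => i; rewrite ffunE tbounded_num.
case=> [m n|m n|m n _|n|m n _]; rewrite /sentence.
- by apply/andP; split; [apply: H2|]; apply: tbounded_num.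
- by apply/andP; split; [apply: H2|]; apply: tbounded_num.
- by rewrite /= !tbounded_num.
- rewrite bounded_All_Imp; apply/andP; split; first by apply: H2; rewrite ?tbounded_num.
  by rewrite bounded_Ors all_map; apply/allP => i _; rewrite inE /= tbounded_num.
- by apply: H2; apply: tbounded_num.
Qed.

Definition R0p : theory L_ap := Theory sentence_R0p_axiom.

End R0p.

Definition R0p_sourced (M : signature) (tau : translation L_ap M) (W : theory M) : Prop :=
  ded_equiv W (trans_theory tau (theory_union R0p (id_theory L_ap))).

(* Main.v *)
From Stdlib Require Import Classical ClassicalEpsilon FunctionalExtensionality.
From mathcomp Require Import all_boot.
From mathcomp Require Import zify.
Require Import Defs.

Set Implicit Arguments.
Unset Strict Implicit.
Unset Printing Implicit Defensive.

Local Notation funext := functional_extensionality.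

(* Let [A] be the conjunction of a finite subtheory of [T] that [S] does not
   interpret.  The theory [U] is [S] plus [A \/ s], for a sentence [s] such that
   neither [S] plus [s] interprets [A], nor [S] interprets [A \/ s].

   The sentence is found among sentences [sigma n] attached to two recursively
   inseparable sets: if [n] is in the first set then [W] proves [sigma n], and if
   [n] is in the second set then [sigma n] is refutable in pure logic.  The latter
   is possible because [sigma n] asserts the existence of a witness [x] together
   with a certificate that the segment below [x] looks like a finite initial
   segment of the natural numbers, so that no axiom of [W] is needed to compare
   [x] with a standard witness.  In the first case [S] plus [sigma n] cannot
   interpret [A], since [S] does not; in the second case [S] cannot interpret
   [A \/ sigma n], since this is equivalent to [A] in every model.  Both events
   "[S] plus [sigma n] interprets [A]" and "[S] interprets [A \/ sigma n]" are
   c.e., so if one of them occurred for every [n], waiting for the first to occur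
   would separate the two sets. *)

(** Refutability in pure logic is forced: when [S] interprets [A \/ sigma n], the disjunction is
    evaluated in an inner model about which nothing else is known, not even that it satisfies [W].
    Hence [sigma n] itself carries the parameters of the translation [tau], the identity laws of the
    arithmetical symbols and a certificate at each numeral up to [n]. The inseparable sets consist
    of the codes of programs with value 0, respectively 1, on their own code; a program separating
    them is contradicted at its own code. To be c.e., the two events must quantify over all
    translations, although a translation assigns a formula to each of possibly infinitely many
    symbols. Only finitely many symbols occur in [A] and in all the [sigma n], so a translation is
    coded by its values there. Conjoining the identity axioms of these symbols to the interpreted
    sentence ensures that every such finite piece extends to a genuine interpretation. Completeness
    allows provability to be checked in models throughout. *)

Arguments iota : simpl never.

(** * The pairing function *)

(** The successor in Cantor's enumeration: one step along an antidiagonal, or from its end to the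
    start of the next one. Iterating it inverts [cpair] without square roots. *)
Definition cnext (p : nat * nat) : nat * nat :=
  if p.1 is a.+1 then (a, p.2.+1) else (p.2.+1, 0).

Definition cunpair (n : nat) : nat * nat := iter n cnext (0, 0).

Lemma cpair2 a b : (cpair a b).*2 = (a + b) * (a + b).+1 + b.*2.
Proof. by rewrite /cpair doubleD bin2 /= mulnC -(odd_double_half ((a + b) * _)) oddM /= andbN add0n doubleK. Qed.

Lemma cpair_next p : cpair (cnext p).1 (cnext p).2 = (cpair p.1 p.2).+1.
Proof.
apply: double_inj; case: p => -[|a] b; rewrite /cnext /=; rewrite doubleS !cpair2; nia.
Qed.

Lemma cunpairK n : cpair (cunpair n).1 (cunpair n).2 = n.
Proof. by elim: n => //= n IH; rewrite cpair_next IH. Qed.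

Lemma cpairK a b : cunpair (cpair a b) = (a, b).
Proof.
move En : (cpair a b) => n.
elim: n a b En => [|n IH] a b En.
  suff [-> ->] : a = 0 /\ b = 0 by [].
  have := cpair2 a b; rewrite En; nia.
case: b En => [|b] En; last first.
  have := cpair_next (a.+1, b); rewrite /= En => -[E].
  by rewrite /= (IH _ _ (esym E)).
case: a En => [|a] En; first by [].
have := cpair_next (0, a); rewrite /= En => -[E].
by rewrite /= (IH _ _ (esym E)).
Qed.

Opaque cpair.

Definition cfst n := (cunpair n).1.
Definition csnd n := (cunpair n).2.

Lemma cfstK a b : cfst (cpair a b) = a. Proof. by rewrite /cfst cpairK. Qed.
Lemma csndK a b : csnd (cpair a b) = b. Proof. by rewrite /csnd cpairK. Qed.
Definition cpE := (cfstK, csndK).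

Lemma cpair_inj a b a' b' : cpair a b = cpair a' b' -> a = a' /\ b = b'.
Proof. by move=> E; have := cpairK a b; rewrite E cpairK => -[-> ->]. Qed.

Lemma cpair_eta n : cpair (cfst n) (csnd n) = n.
Proof. exact: cunpairK. Qed.

(** * Total computable functions *)

Definition comp (f : nat -> nat) : Prop := exists c, forall n, reval c n (f n).

Lemma comp_ext f g : f =1 g -> comp f -> comp g.
Proof. by move=> E [c Hc]; exists c => n; rewrite -E. Qed.

Lemma comp_fst f : comp f -> comp (fun n => cfst (f n)).
Proof.
by case=> c Hc; exists (RComp RLeft c) => n; exists (f n) => //=; exists (csnd (f n)); rewrite cpair_eta.
Qed.

Lemma comp_snd f : comp f -> comp (fun n => csnd (f n)).
Proof.
by case=> c Hc; exists (RComp RRight c) => n; exists (f n) => //=; exists (cfst (f n)); rewrite cpair_eta.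
Qed.

Lemma comp_pair f g : comp f -> comp g -> comp (fun n => cpair (f n) (g n)).
Proof. by move=> [c Hc] [c' Hc']; exists (RPair c c') => n; exists (f n), (g n). Qed.

Lemma comp_id : comp id.
Proof.
exists (RPair RLeft RRight) => n; exists (cfst n), (csnd n).
split; [exists (csnd n)|exists (cfst n)|]; by rewrite cpair_eta.
Qed.

Lemma comp_app g f : comp g -> comp f -> comp (fun n => g (f n)).
Proof. by move=> [c Hc] [c' Hc']; exists (RComp c c') => n; exists (f n). Qed.

Lemma comp_succ f : comp f -> comp (fun n => (f n).+1).
Proof. by apply: (@comp_app succn); exists RSucc. Qed.

Lemma comp_const k : comp (fun=> k).
Proof. by elim: k => [|k IH]; [exists RZero | apply: comp_succ]. Qed.

(** [RPrec] recurses on the second component of its argument, so the recursion is performed by [h]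
    with the number of steps as a separate component, and [k n] is supplied afterwards. *)
Lemma comp_rec b s k : comp b -> comp s -> comp k ->
  comp (fun n => nat_rect (fun=> nat) (b n) (fun i acc => s (cpair n (cpair i acc))) (k n)).
Proof.
move=> [cb Hb] [cs Hs] Hk.
set h := fun z => nat_rect (fun=> nat) (b (cfst z)) (fun i acc => s (cpair (cfst z) (cpair i acc))) (csnd z).
suff Hh : comp h.
  by apply: comp_ext (comp_app Hh (comp_pair comp_id Hk)) => n; rewrite /h !cpE.
exists (RPrec cb cs) => z /=; exists (cfst z), (csnd z); rewrite cpair_eta; split=> //.
rewrite /h; elim: (csnd z) => [|m IH] /=; first exact: Hb.
by eexists; [exact: IH | exact: Hs].
Qed.

Lemma comp_add f g : comp f -> comp g -> comp (fun n => f n + g n).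
Proof.
move=> Hf Hg.
have Hs : comp (fun z => (csnd (csnd z)).+1) by do ![apply: comp_succ|apply: comp_snd|apply: comp_id].
apply: comp_ext (comp_rec Hf Hs Hg) => n /=.
by elim: (g n) => [|m IH] /=; rewrite ?addn0 // !cpE IH addnS.
Qed.

Lemma comp_mul f g : comp f -> comp g -> comp (fun n => f n * g n).
Proof.
move=> Hf Hg.
have Hs : comp (fun z => csnd (csnd z) + f (cfst z)).
  by apply: comp_add; [do 2!apply: comp_snd; apply: comp_id | apply: comp_app Hf (comp_fst comp_id)].
apply: comp_ext (comp_rec (comp_const 0) Hs Hg) => n /=.
by elim: (g n) => [|m IH] /=; rewrite ?muln0 // !cpE IH mulnS addnC.
Qed.

Lemma comp_pred f : comp f -> comp (fun n => (f n).-1).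
Proof.
move=> Hf.
have Hs : comp (fun z => cfst (csnd z)) by do ![apply: comp_fst|apply: comp_snd|apply: comp_id].
apply: comp_ext (comp_rec (comp_const 0) Hs Hf) => n /=.
by case: (f n) => [|m] //=; rewrite !cpE.
Qed.

Lemma comp_sub f g : comp f -> comp g -> comp (fun n => f n - g n).
Proof.
move=> Hf Hg.
have Hs : comp (fun z => (csnd (csnd z)).-1) by do ![apply: comp_pred|apply: comp_snd|apply: comp_id].
apply: comp_ext (comp_rec Hf Hs Hg) => n /=.
by elim: (g n) => [|m IH] /=; rewrite ?subn0 // !cpE IH subnS.
Qed.

(* A computable test is a computable function whose zeros are the solutions. *)
Definition dec (A : nat -> bool) : Prop := comp (fun n => ~~ A n : nat).

Lemma dec_ext A B : A =1 B -> dec A -> dec B.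
Proof. by move=> E; apply: comp_ext => n; rewrite E. Qed.

Lemma dec_eq f g : comp f -> comp g -> dec (fun n => f n == g n).
Proof.
move=> Hf Hg.
apply: comp_ext (comp_sub (comp_const 1) (comp_sub (comp_const 1) (comp_add (comp_sub Hf Hg) (comp_sub Hg Hf)))) => n.
rewrite /=; case: eqP; lia.
Qed.

Lemma dec_and A B : dec A -> dec B -> dec (fun n => A n && B n).
Proof.
move=> HA HB; apply: comp_ext (comp_sub (comp_add HA HB) (comp_mul HA HB)) => n.
by case: (A n); case: (B n).
Qed.

Lemma dec_or A B : dec A -> dec B -> dec (fun n => A n || B n).
Proof.
move=> HA HB; apply: comp_ext (comp_mul HA HB) => n.
by case: (A n); case: (B n).
Qed.

Lemma dec_app A f : dec A -> comp f -> dec (fun n => A (f n)).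
Proof. exact: comp_app. Qed.

Lemma dec_not A : dec A -> dec (fun n => ~~ A n).
Proof.
move=> HA; apply: comp_ext (comp_sub (comp_const 1) HA) => n.
by case: (A n).
Qed.

(** Zero stands for truth, so the product of the test values over the range vanishes as soon as one
    of them does. *)
Lemma dec_has A k : dec A -> comp k ->
  dec (fun n => has (fun i => A (cpair i n)) (iota 0 (k n).+1)).
Proof.
move=> HA Hk.
have Hs : comp (fun z => csnd (csnd z) * ~~ A (cpair (cfst (csnd z)) (cfst z))).
  apply: comp_mul; first by do 2!apply: comp_snd; apply: comp_id.
  apply: (dec_app HA); apply: comp_pair; last exact: comp_fst comp_id.
  by apply: comp_fst; apply: comp_snd; apply: comp_id.
apply: comp_ext (comp_rec (comp_const 1) Hs (comp_succ Hk)) => n /=.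
have E m : nat_rect (fun=> nat) 1 (fun i acc => csnd (csnd (cpair n (cpair i acc)))
    * ~~ A (cpair (cfst (csnd (cpair n (cpair i acc)))) (cfst (cpair n (cpair i acc))))) m
    = ~~ has (fun i => A (cpair i n)) (iota 0 m).
  elim: m => // m IH.
  have -> : iota 0 m.+1 = iota 0 m ++ [:: m] by rewrite -addn1 iotaD.
  rewrite has_cat has_seq1 /= !cpE IH.
  by case: has; case: (A _).
exact: (E (k n).+1).
Qed.

Lemma dec_all A k : dec A -> comp k ->
  dec (fun n => all (fun i => A (cpair i n)) (iota 0 (k n).+1)).
Proof.
move=> HA Hk; apply: dec_ext (dec_not (dec_has (dec_not HA) Hk)) => n.
by rewrite -all_predC; apply: eq_all => i /=; rewrite negbK.
Qed.

(** * Sigma formulas of arithmetic *)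

Definition scons (T : Type) (x : T) (e : nat -> T) (i : nat) : T :=
  if i is j.+1 then e j else x.
Notation "x .: e" := (scons x e) (at level 55, right associativity).

Lemma scons_comp (T U : Type) (f : T -> U) x e : (fun i => f ((x .: e) i)) = f x .: (fun i => f (e i)).
Proof. by apply: funext => -[]. Qed.

(** Without negation, truth is monotone in a bound on the existential witnesses. Atoms apply to
    variables only, so in a segment of a model no value of a compound term has to be located. *)
Inductive sform : Type :=
| SZero of nat
| SSucc of nat & nat
| SEq of nat & nat
| SAdd of nat & nat & nat
| SMul of nat & nat & nat
| SAnd of sform & sform
| SOr of sform & sform
| SEx of sform
| SBall of nat & sform.

Fixpoint ssat (p : sform) (e : nat -> nat) : Prop :=
  match p with
  | SZero i => e i = 0
  | SSucc i j => (e i).+1 = e j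
  | SEq i j => e i = e j
  | SAdd i j k => e i + e j = e k
  | SMul i j k => e i * e j = e k
  | SAnd p q => ssat p e /\ ssat q e
  | SOr p q => ssat p e \/ ssat q e
  | SEx p => exists x, ssat p (x .: e)
  | SBall i p => forall x, x <= e i -> ssat p (x .: e)
  end.

(** Only the existential quantifiers are cut off at [k]. For values up to [k] this is truth in the
    segment of the natural numbers ending at [k], which is what a certified segment of a model can
    reproduce. *)
Fixpoint bsat (k : nat) (p : sform) (e : nat -> nat) : bool :=
  match p with
  | SZero i => e i == 0
  | SSucc i j => (e i).+1 == e j
  | SEq i j => e i == e j
  | SAdd i j l => e i + e j == e l
  | SMul i j l => e i * e j == e l
  | SAnd p q => bsat k p e && bsat k q e
  | SOr p q => bsat k p e || bsat k q e
  | SEx p => has (fun x => bsat k p (x .: e)) (iota 0 k.+1)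
  | SBall i p => all (fun x => bsat k p (x .: e)) (iota 0 (e i).+1)
  end.

Lemma has_iota0 (A : pred nat) k : has A (iota 0 k.+1) <-> exists2 x, x <= k & A x.
Proof.
split=> [/hasP [x] | [x Hx HA]]; first by rewrite mem_iota => Hx HA; exists x.
by apply/hasP; exists x; rewrite ?mem_iota.
Qed.

Lemma all_iota0 (A : pred nat) k : all A (iota 0 k.+1) <-> forall x, x <= k -> A x.
Proof.
split=> [/allP H x Hx | H]; first by apply: H; rewrite mem_iota.
by apply/allP => x; rewrite mem_iota => /H.
Qed.

Lemma bsat_mono k l p e : k <= l -> bsat k p e -> bsat l p e.
Proof.
move=> Hkl; elim: p e => //= [p IHp q IHq|p IHp q IHq|p IHp|i p IHp] e.
- by case/andP => /IHp-> /IHq->.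
- by case/orP => [/IHp->|/IHq->]; rewrite ?orbT.
- by move/has_iota0 => [x Hx /IHp H]; apply/has_iota0; exists x => //; apply: leq_trans Hkl.
- by move/all_iota0 => H; apply/all_iota0 => x /H/IHp.
Qed.

Lemma bsat_ssat p e : ssat p e <-> exists k, bsat k p e.
Proof.
elim: p e => /= [i|i j|i j|i j l|i j l|p IHp q IHq|p IHp q IHq|p IHp|i p IHp] e;
  try by split=> [/eqP H|[_ /eqP]//]; exists 0.
- split=> [[/IHp [k Hk] /IHq [l Hl]] | [k /andP [Hp Hq]]]; last by split; [apply/IHp|apply/IHq]; exists k.
  by exists (k + l); rewrite (bsat_mono _ Hk) ?(bsat_mono _ Hl) ?leq_addl ?leq_addr.
- split=> [[/IHp|/IHq] [k Hk] | [k /orP [Hk|Hk]]]; try by exists k; rewrite Hk ?orbT.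
    by left; apply/IHp; exists k.
  by right; apply/IHq; exists k.
- split=> [[x /IHp [k Hk]] | [k /has_iota0 [x _ Hx]]]; last by exists x; apply/IHp; exists k.
  by exists (x + k); apply/has_iota0; exists x; rewrite ?leq_addr // (bsat_mono _ Hk) ?leq_addl.
- split=> [H | [k /all_iota0 H] x /H Hx]; last by apply/IHp; exists k.
  (* Collection: the finitely many instances have a common bound, by induction on the value of the
     bounding variable. *)
  suff [k Hk] : exists k, forall x, x <= e i -> bsat k p (x .: e) by exists k; apply/all_iota0.
  elim: (e i) H => [|n IH] H.
    by have /IHp [k Hk] := H 0 (leqnn _); exists k => -[].
  case: IH => [x Hx|k Hk]; first by apply: H; apply: leqW.
  have /IHp [l Hl] := H n.+1 (leqnn _).
  exists (k + l) => x; rewrite leq_eqVlt => /orP [/eqP-> | Hx].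
    by apply: bsat_mono Hl; rewrite leq_addl.
  by apply: bsat_mono (Hk _ Hx); rewrite leq_addr.
Qed.

(** A number read as a stream of nested pairs, so that binding a variable is an application of
    [cpair]. *)
Definition edec (z i : nat) : nat := cfst (iter i csnd z).

Lemma edec_cons x z : edec (cpair x z) = x .: edec z.
Proof.
apply: funext => -[|i]; rewrite /edec ?cpE //=.
by rewrite -iterS iterSr cpE.
Qed.

Lemma comp_edec i f : comp f -> comp (fun n => edec (f n) i).
Proof. by move=> Hf; apply: comp_fst; elim: i => //= i; apply: comp_snd. Qed.

Lemma dec_bsat p : dec (fun n => bsat (cfst n) p (edec (csnd n))).
Proof.
have He i : comp (fun n => edec (csnd n) i) by apply/comp_edec/comp_snd/comp_id.
have Hf : comp cfst by apply/comp_fst/comp_id.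
have Hx p' : dec (fun n => bsat (cfst n) p' (edec (csnd n))) ->
    dec (fun z => bsat (cfst (csnd z)) p' (cfst z .: edec (csnd (csnd z)))).
  move=> H; apply: dec_ext (dec_app H (_ : comp (fun z => cpair (cfst (csnd z)) (cpair (cfst z) (csnd (csnd z)))))).
    by move=> z; rewrite !cpE edec_cons.
  do ![exact: comp_id | apply: comp_pair | apply: comp_fst | apply: comp_snd].
elim: p => /= [i|i j|i j|i j l|i j l|p IHp q IHq|p IHp q IHq|p IHp|i p IHp].
- by apply: dec_eq => //; apply: comp_const.
- by apply: dec_eq => //; apply: comp_succ.
- exact: dec_eq.
- by apply: dec_eq => //; apply: comp_add.
- by apply: dec_eq => //; apply: comp_mul.
- exact: dec_and.
- exact: dec_or.
- apply: dec_ext (dec_has (Hx _ IHp) Hf) => n.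
  by apply: eq_has => x; rewrite !cpE.
- apply: dec_ext (dec_all (Hx _ IHp) (He i)) => n.
  by apply: eq_all => x; rewrite !cpE.
Qed.

(** Definability is a property of predicates on environments, so formulas need not be written down;
    the closure lemmas read off the bound variable at position 0. *)
Definition sdef (A : (nat -> nat) -> Prop) : Prop := exists p, forall e, ssat p e <-> A e.

Lemma sdef_ext A B : (forall e, A e <-> B e) -> sdef A -> sdef B.
Proof. by move=> E [p Hp]; exists p => e; rewrite Hp. Qed.

Lemma sdef_and A B : sdef A -> sdef B -> sdef (fun e => A e /\ B e).
Proof. by move=> [p Hp] [q Hq]; exists (SAnd p q) => e /=; rewrite Hp Hq. Qed.

Lemma sdef_or A B : sdef A -> sdef B -> sdef (fun e => A e \/ B e).
Proof. by move=> [p Hp] [q Hq]; exists (SOr p q) => e /=; rewrite Hp Hq. Qed.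

Lemma sdef_ex (A : nat -> (nat -> nat) -> Prop) :
  sdef (fun e => A (e 0) (fun i => e i.+1)) -> sdef (fun e => exists x, A x e).
Proof.
case=> p Hp; exists (SEx p) => e /=.
by split=> -[x Hx]; exists x; apply/(Hp (x .: e)).
Qed.

Lemma sdef_ball i (A : nat -> (nat -> nat) -> Prop) :
  sdef (fun e => A (e 0) (fun i => e i.+1)) -> sdef (fun e => forall x, x <= e i -> A x e).
Proof.
case=> p Hp; exists (SBall i p) => e /=.
by split=> H x Hx; apply/(Hp (x .: e))/H.
Qed.

Fixpoint sren (f : nat -> nat) (p : sform) : sform :=
  let g i := if i is j.+1 then (f j).+1 else 0 in
  match p with
  | SZero i => SZero (f i)
  | SSucc i j => SSucc (f i) (f j)
  | SEq i j => SEq (f i) (f j)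
  | SAdd i j l => SAdd (f i) (f j) (f l)
  | SMul i j l => SMul (f i) (f j) (f l)
  | SAnd p q => SAnd (sren f p) (sren f q)
  | SOr p q => SOr (sren f p) (sren f q)
  | SEx p => SEx (sren g p)
  | SBall i p => SBall (f i) (sren g p)
  end.

Lemma ssat_ren p f e : ssat (sren f p) e <-> ssat p (fun i => e (f i)).
Proof.
have E x f' e' : (fun i => (x .: e') (if i is j.+1 then (f' j).+1 else 0)) = x .: (fun i => e' (f' i)).
  by apply: funext => -[].
elim: p f e => //= [p IHp q IHq|p IHp q IHq|p IHp|i p IHp] f e.
- by rewrite IHp IHq.
- by rewrite IHp IHq.
- by split=> -[x]; [rewrite IHp E => H; exists x | move=> H; exists x; rewrite IHp E].
- by split=> H x /H; rewrite IHp E.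
Qed.

Lemma sdef_ren f A : sdef A -> sdef (fun e => A (fun i => e (f i))).
Proof. by case=> p Hp; exists (sren f p) => e; rewrite ssat_ren Hp. Qed.

Definition dfn (f : (nat -> nat) -> nat) : Prop := sdef (fun e => e 0 = f (fun i => e i.+1)).

Lemma dfn_var i : dfn (fun e => e i).
Proof. by exists (SEq 0 i.+1). Qed.

Lemma sdef_eq f g : dfn f -> dfn g -> sdef (fun e => f e = g e).
Proof.
move=> Hf Hg; apply: sdef_ext (sdef_ex (A := fun x e => x = f e /\ x = g e) (sdef_and Hf Hg)) => e.
by split=> [[x [<- //]] | E]; exists (f e).
Qed.

Lemma dfn_succ f : dfn f -> dfn (fun e => (f e).+1).
Proof.
move=> Hf.
have H : sdef (fun e => e 0 = f (fun i => e i.+2) /\ (e 0).+1 = e 1).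
  apply: sdef_and; last by exists (SSucc 0 1).
  exact: (sdef_ren (fun i => if i is j.+1 then j.+2 else 0) Hf).
apply: sdef_ext (sdef_ex (A := fun x e => x = f (fun i => e i.+1) /\ x.+1 = e 0) H) => e.
by split=> [[x [-> ->]] // | ->]; eexists.
Qed.

Lemma dfn_const k : dfn (fun=> k).
Proof. by elim: k => [|k IH]; [exists (SZero 0) | apply: dfn_succ]. Qed.

Lemma dfn_op2 (op : nat -> nat -> nat) f g : sdef (fun e => op (e 0) (e 1) = e 2) ->
  dfn f -> dfn g -> dfn (fun e => op (f e) (g e)).
Proof.
move=> Hop Hf Hg.
have H : sdef (fun e => [/\ e 1 = f (fun i => e i.+3), e 0 = g (fun i => e i.+3) & op (e 1) (e 0) = e 2]).
  have H1 := sdef_ren (fun i => if i is j.+1 then j.+3 else 1) Hf.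
  have H2 := sdef_ren (fun i => if i is j.+1 then j.+3 else 0) Hg.
  have H3 := sdef_ren (fun i => match i with 0 => 1 | 1 => 0 | _ => i end) Hop.
  by apply: sdef_ext (sdef_and H1 (sdef_and H2 H3)) => e; split=> [[? []] | []].
apply: sdef_ext (sdef_ex (A := fun x e => exists y, [/\ x = f (fun i => e i.+1), y = g (fun i => e i.+1) & op x y = e 0]) _) => [e|].
  by split=> [[x [y [-> -> ->]]] // | ->]; do 2!eexists.
exact: (sdef_ex (A := fun y e => [/\ e 0 = f (fun i => e i.+2), y = g (fun i => e i.+2) & op (e 0) y = e 1])).
Qed.

Lemma dfn_add f g : dfn f -> dfn g -> dfn (fun e => f e + g e).
Proof. by apply: dfn_op2; exists (SAdd 0 1 2). Qed.

Lemma dfn_mul f g : dfn f -> dfn g -> dfn (fun e => f e * g e).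
Proof. by apply: dfn_op2; exists (SMul 0 1 2). Qed.

Lemma dfn_cpair f g : dfn f -> dfn g -> dfn (fun e => cpair (f e) (g e)).
Proof.
apply: dfn_op2.
apply: sdef_ext (sdef_eq (f := fun e => (e 0 + e 1) * (e 0 + e 1).+1 + (e 1 + e 1)) (g := fun e => e 2 + e 2) _ _).
- move=> e; rewrite !addnn -cpair2; split=> [/double_inj // | -> //].
- by do ![apply: dfn_add | apply: dfn_mul | apply: dfn_succ | apply: dfn_var].
- by apply: dfn_add; apply: dfn_var.
Qed.

Lemma sdef_le f g : dfn f -> dfn g -> sdef (fun e => f e <= g e).
Proof.
move=> Hf Hg.
apply: sdef_ext (sdef_ex (A := fun x e => f e + x = g e) _) => [e|].
  by split=> [[x <-] | H]; rewrite ?leq_addr //; exists (g e - f e); rewrite subnKC.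
apply: (@sdef_eq (fun e => f (fun i => e i.+1) + e 0) (fun e => g (fun i => e i.+1))).
  apply: dfn_add (dfn_var 0).
  exact: (sdef_ren (fun i => if i is j.+1 then j.+2 else 0) Hf).
exact: (sdef_ren (fun i => if i is j.+1 then j.+2 else 0) Hg).
Qed.

Lemma sdef_fball f (A : nat -> (nat -> nat) -> Prop) : dfn f ->
  sdef (fun e => A (e 0) (fun i => e i.+1)) -> sdef (fun e => forall x, x <= f e -> A x e).
Proof.
move=> Hf HA.
apply: sdef_ext (sdef_ex (A := fun y e => y = f e /\ forall x, x <= y -> A x e) _) => [e|].
  by split=> [[_ [-> ]] // | H]; exists (f e).
apply: sdef_and Hf _.
apply: (sdef_ball 0 (A := fun x e => A x (fun i => e i.+1))).
exact: (sdef_ren (fun i => if i is j.+1 then j.+2 else 0) HA).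
Qed.

(** * Goedel's beta function *)

Definition beta (a b i : nat) : nat := a %% (i.+1 * b).+1.

Lemma crt k (m f : nat -> nat) : (forall i j, i < k -> j < i -> coprime (m i) (m j)) ->
  exists a, forall i, i < k -> a = f i %[mod m i].
Proof.
elim: k => [|k IH] Hm; first by exists 0.
case: IH => [i j Hi Hj|a Ha]; first by apply: Hm => //; apply: ltnW.
set M := \prod_(i < k) m i.
have HM : coprime M (m k).
  rewrite /M; elim/big_ind: _ => [|u v Hu Hv|i _]; first exact: coprime1n.
    by rewrite coprimeMl Hu.
  by rewrite coprime_sym; apply: Hm.
exists (chinese M (m k) a (f k)) => i; rewrite ltnS leq_eqVlt => /orP [/eqP-> | Hi].
  exact: chinese_modr.
rewrite -(Ha i Hi) -(modn_dvdm _ (_ : m i %| M)) ?chinese_modl ?modn_dvdm //;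
  by rewrite /M (bigD1 (Ordinal Hi)) //= dvdn_mulr.
Qed.

(** With [b] the factorial of a number [N] not below [k.+1] nor any of the values, each value is
    smaller than its modulus. The moduli are pairwise coprime: a common prime divides [(i - j) * b]
    but not [b], hence divides [i - j], which is at most [N] and so divides [b], a contradiction. *)
Lemma betaP (f : nat -> nat) k : exists a b, forall i, i <= k -> beta a b i = f i.
Proof.
set N := maxn k.+1 (\max_(i < k.+1) f i).
set b := N`!.
have Hf i : i <= k -> f i < (i.+1 * b).+1.
  move=> Hi; rewrite ltnS; apply: (@leq_trans b); last by rewrite leq_pmull.
  apply: leq_trans (fact_geq _); rewrite leq_max; apply/orP; right.
  by rewrite -ltnS in Hi; apply: (leq_bigmax (Ordinal Hi)).
have Hc i j : i < k.+1 -> j < i -> coprime (i.+1 * b).+1 (j.+1 * b).+1.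
  move=> Hi Hj; rewrite /coprime; set g := gcdn _ _.
  apply: contraT => Hg.
  have Hp : prime (pdiv g) by apply: pdiv_prime; rewrite ltn_neqAle eq_sym Hg /g gcdn_gt0.
  have H1 : pdiv g %| (i.+1 * b).+1 by apply: dvdn_trans (pdiv_dvd g) (dvdn_gcdl _ _).
  have H2 : pdiv g %| (j.+1 * b).+1 by apply: dvdn_trans (pdiv_dvd g) (dvdn_gcdr _ _).
  have Hnb : ~~ (pdiv g %| b).
    apply/negP => Hb; have := H1; rewrite -addn1 dvdn_addr ?dvdn_mull // dvdn1 => /eqP E.
    by rewrite E in Hp.
  have : pdiv g %| (i - j) * b.
    have -> : (i - j) * b = (i.+1 * b).+1 - (j.+1 * b).+1 by rewrite subSS -mulnBl subSS.
    exact: dvdn_sub.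
  rewrite Euclid_dvdM // (negbTE Hnb) orbF => Hd.
  case/negP: Hnb; apply: dvdn_trans Hd _.
  apply: dvdn_fact; rewrite subn_gt0 Hj /=.
  apply: leq_trans (leq_subr _ _) _; apply: (@leq_trans k.+1); [exact: ltnW | exact: leq_maxl].
have [a Ha] := crt f Hc.
by exists a, b => i Hi; rewrite /beta Ha ?modn_small // Hf.
Qed.

Lemma dfn_beta f g h : dfn f -> dfn g -> dfn h -> dfn (fun e => beta (f e) (g e) (h e)).
Proof.
move=> Hf Hg Hh.
have Hs u : dfn u -> dfn (fun e => u (fun i => e i.+2)).
  exact: (sdef_ren (fun i => if i is j.+1 then j.+3 else 0)).
apply: sdef_ext (sdef_ex (A := fun q e => f (fun i => e i.+1) = q * ((h (fun i => e i.+1)).+1 * g (fun i => e i.+1)).+1 + e 0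
   /\ (e 0).+1 <= ((h (fun i => e i.+1)).+1 * g (fun i => e i.+1)).+1) _) => [e|].
  rewrite /beta; set m := (_ * _).+1; set a := f _; split=> [[q [E H]] | ->].
    by rewrite E modnMDl modn_small.
  by exists (a %/ m); rewrite -divn_eq ltn_mod.
apply: sdef_and.
  apply: sdef_eq; first exact: Hs.
  by do ![apply: dfn_add | apply: dfn_mul | apply: dfn_succ | exact: dfn_var]; apply: Hs.
by apply: sdef_le; do ![apply: dfn_add | apply: dfn_mul | apply: dfn_succ | exact: dfn_var]; apply: Hs.
Qed.

Lemma dfn_shift f : dfn f -> dfn (fun e => f (fun i => e i.+1)).
Proof. exact: (sdef_ren (fun i => if i is j.+1 then j.+2 else 0)). Qed.

(** The strict bound becomes an inclusive one with the last value exempted, which also covers the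
    bound 0. *)
Lemma sdef_ltball f (A : nat -> (nat -> nat) -> Prop) : dfn f ->
  sdef (fun e => A (e 0) (fun i => e i.+1)) -> sdef (fun e => forall x, x < f e -> A x e).
Proof.
move=> Hf HA.
apply: sdef_ext (sdef_fball (A := fun x e => x = f e \/ A x e) Hf _) => [e|].
  split=> H x Hx; first by case: (H x (ltnW Hx)) => // E; rewrite E ltnn in Hx.
  by move: Hx; rewrite leq_eqVlt => /orP [/eqP | /H]; [left | right].
by apply: sdef_or HA; apply: sdef_eq (dfn_var 0) (dfn_shift Hf).
Qed.

Ltac dfn_tac := do ![exact: dfn_var | exact: dfn_const | apply: dfn_cpair | apply: dfn_succ | apply: dfn_add
  | apply: dfn_mul | apply: dfn_beta].

(** * Computably enumerable sets *)

(** A named copy of the local recursion in the [RPrec] case of [reval], to which it is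
    convertible. *)
Definition riter (f g : recfun) (a : nat) := fix iter (k y : nat) {struct k} : Prop :=
  if k is k'.+1 then exists2 z, iter k' z & reval g (cpair a (cpair k' z)) y
  else reval f a y.

Lemma riterP f g a k y : riter f g a k y <-> exists s : nat -> nat,
  [/\ reval f a (s 0), forall i, i < k -> reval g (cpair a (cpair i (s i))) (s i.+1) & s k = y].
Proof.
elim: k y => [|k IH] y /=.
  by split=> [H|[s [H _ <-]] //]; exists (fun=> y).
split=> [[z /IH [s [H0 Hs E]] Hg] | [s [H0 Hs <-]]]; last first.
  by exists (s k); [apply/IH; exists s; split=> // i Hi; apply/Hs/ltnW | apply: Hs].
exists (fun i => if i <= k then s i else y); split=> //=; last by rewrite ltnn.
move=> i; rewrite ltnS => Hi; rewrite Hi.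
move: Hi; rewrite leq_eqVlt => /orP [/eqP-> | Hi]; first by rewrite ltnn E.
by rewrite Hi; apply: Hs.
Qed.

Lemma sdef_reval c i j : sdef (fun e => reval c (e i) (e j)).
Proof.
elim: c i j => [|||| f IHf g IHg|f IHf g IHg|f IHf g IHg|f IHf] i j /=.
- by exists (SZero j).
- by exists (SSucc i j) => e /=; split.
- apply: (@sdef_ex (fun b e => e i = cpair (e j) b)); apply: sdef_eq; dfn_tac.
- apply: (@sdef_ex (fun a e => e i = cpair a (e j))); apply: sdef_eq; dfn_tac.
- apply: (@sdef_ex (fun a e => exists b, [/\ reval f (e i) a, reval g (e i) b & e j = cpair a b])).
  apply: (@sdef_ex (fun b e => [/\ reval f (e i.+1) (e 0), reval g (e i.+1) b & e j.+1 = cpair (e 0) b])).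
  have H : sdef (fun e => e j.+2 = cpair (e 1) (e 0)) by apply: sdef_eq; dfn_tac.
  by apply: sdef_ext (sdef_and (IHf i.+2 1) (sdef_and (IHg i.+2 0) H)) => e; split=> [[? []] | []].
- apply: sdef_ext (sdef_ex (A := fun z e => reval g (e i) z /\ reval f z (e j)) (sdef_and (IHg _ _) (IHf _ _))) => e.
  by split=> [[z []] | [z]]; exists z.
(* Primitive recursion: the intermediate values are coded by [u] and [v] through [beta]. Compound
   arguments of [reval] are named by extra variables, since the induction hypotheses speak of
   variables only. *)
- apply: (@sdef_ext (fun e => exists a k u v, [/\ e i = cpair a k,
      exists2 y0, y0 = beta u v 0 & reval f a y0,
      forall x, x < k -> exists z y n, [/\ z = beta u v x, y = beta u v x.+1,
         n = cpair a (cpair x z) & reval g n y] & e j = beta u v k])).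
    move=> e; split=> [[a [k [u [v [-> [y0 -> Hf] Hg ->]]]]] | [a [k [-> /riterP [s [Hf Hg E]]]]]].
      exists a, k; split=> //; apply/riterP; exists (beta u v); split=> // x Hx.
      by case: (Hg _ Hx) => z [y [n [-> -> ->]]].
    have [u [v Huv]] := betaP s k; exists a, k, u, v; split=> //; last by rewrite Huv.
      by exists (s 0) => //; rewrite Huv.
    move=> x Hx; exists (s x), (s x.+1); eexists; split=> //; last exact: Hg.
      by rewrite Huv // ltnW.
    by rewrite Huv.
  apply: (@sdef_ex (fun a e => exists k u v, _)).
  apply: (@sdef_ex (fun k e => exists u v, _)).
  apply: (@sdef_ex (fun u e => exists v, _)).
  apply: (@sdef_ex (fun v e => _)).
  have H1 : sdef (fun e => e i.+4 = cpair (e 3) (e 2)) by apply: sdef_eq; dfn_tac.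
  have H2 : sdef (fun e => exists2 y0, y0 = beta (e 1) (e 0) 0 & reval f (e 3) y0).
    apply: sdef_ext (sdef_ex (A := fun y e => y = beta (e 1) (e 0) 0 /\ reval f (e 3) y) _) => [e|].
      by split=> [[y []] | [y]]; exists y.
    apply: sdef_and; last exact: (IHf 4 0).
    by apply: sdef_eq; dfn_tac.
  have H3 : sdef (fun e => forall x, x < e 2 -> exists z y n, [/\ z = beta (e 1) (e 0) x, y = beta (e 1) (e 0) x.+1,
         n = cpair (e 3) (cpair x z) & reval g n y]).
    apply: (@sdef_ltball (fun e => e 2) (fun x e => exists z y n, [/\ z = beta (e 1) (e 0) x, y = beta (e 1) (e 0) x.+1,
         n = cpair (e 3) (cpair x z) & reval g n y])); first exact: dfn_var.
    apply: (@sdef_ex (fun z e => exists y n, _)).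
    apply: (@sdef_ex (fun y e => exists n, _)).
    apply: (@sdef_ex (fun n e => _)).
    apply: (@sdef_ext (fun e => e 2 = beta (e 5) (e 4) (e 3) /\ e 1 = beta (e 5) (e 4) (e 3).+1 /\
         e 0 = cpair (e 7) (cpair (e 3) (e 2)) /\ reval g (e 0) (e 1))); first by move=> e; split=> [[? [? []]] | []].
    by do 3!(apply: sdef_and; first by apply: sdef_eq; dfn_tac).
  have H4 : sdef (fun e => e j.+4 = beta (e 1) (e 0) (e 2)) by apply: sdef_eq; dfn_tac.
  by apply: sdef_ext (sdef_and H1 (sdef_and H2 (sdef_and H3 H4))) => e; split=> [[? [? []]] | []].
- apply: sdef_and.
    apply: (@sdef_ext (fun e => exists n, n = cpair (e i) (e j) /\ exists z, z = 0 /\ reval f n z)).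
      by move=> e; split=> [[_ [-> [_ [->]]]] | H] //; exists (cpair (e i) (e j)); split=> //; exists 0.
    apply: (@sdef_ex (fun n e => n = cpair (e i) (e j) /\ exists z, z = 0 /\ reval f n z)).
    apply: sdef_and; first by apply: sdef_eq; dfn_tac.
    apply: (@sdef_ex (fun z e => z = 0 /\ reval f (e 0) z)).
    by apply: sdef_and => //; apply: sdef_eq; dfn_tac.
  apply: (@sdef_ltball (fun e => e j) (fun z e => exists k, reval f (cpair (e i) z) k.+1)); first exact: dfn_var.
  apply: (@sdef_ext (fun e => exists k n y, [/\ n = cpair (e i.+1) (e 0), y = k.+1 & reval f n y])).
    by move=> e; split=> [[k [_ [_ [-> ->]]]] | [k H]]; exists k => //; exists (cpair (e i.+1) (e 0)), k.+1.
  apply: (@sdef_ex (fun k e => exists n y, [/\ n = cpair (e i.+1) (e 0), y = k.+1 & reval f n y])).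
  apply: (@sdef_ex (fun n e => exists y, [/\ n = cpair (e i.+2) (e 1), y = (e 0).+1 & reval f n y])).
  apply: (@sdef_ex (fun y e => [/\ e 0 = cpair (e i.+3) (e 2), y = (e 1).+1 & reval f (e 0) y])).
  apply: (@sdef_ext (fun e => e 1 = cpair (e i.+4) (e 3) /\ e 0 = (e 2).+1 /\ reval f (e 1) (e 0))).
    by move=> e; split=> [[? []] | []].
  by do 2!(apply: sdef_and; first by apply: sdef_eq; dfn_tac).
Qed.

Lemma sdef_ce A i : ce A -> sdef (fun e => A (e i)).
Proof.
case=> c Hc; apply: (@sdef_ext (fun e => exists y, reval c (e i) y)); first by move=> e; rewrite Hc.
exact: (@sdef_ex (fun y e => reval c (e i) y) (sdef_reval c i.+1 0)).
Qed.

Lemma reval_inj c : forall n y y', reval c n y -> reval c n y' -> y = y'.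
Proof.
elim: c => [|||| f IHf g IHg|f IHf g IHg|f IHf g IHg|f IHf] n y y' /=; try by move=> -> ->.
- by move=> [b ->] [b' /cpair_inj []].
- by move=> [b ->] [b' /cpair_inj []].
- move=> [a [b [Ha Hb ->]]] [a' [b' [Ha' Hb' ->]]].
  by rewrite (IHf _ _ _ Ha Ha') (IHg _ _ _ Hb Hb').
- by move=> [z Hz H] [z' Hz' H']; rewrite (IHg _ _ _ Hz Hz') in H; apply: IHf H H'.
- move=> [a [k [-> H]]] [a' [k' [/cpair_inj [<- <-] H']]].
  elim: k y y' H H' => [|k IH] y y'; first exact: IHf.
  by move=> [z Hz H] [z' Hz' H']; rewrite (IH _ _ Hz Hz') in H; apply: IHg H H'.
- move=> [H Hlt] [H' Hlt']; case: (ltngtP y y') => // Hy.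
    by case: (Hlt' _ Hy) => k Hk; have := IHf _ _ _ H Hk.
  by case: (Hlt _ Hy) => k Hk; have := IHf _ _ _ H' Hk.
Qed.

Lemma ce_search A : (exists B, dec B /\ forall n, A n <-> exists k, B (cpair n k)) -> ce A.
Proof.
case=> B [[c Hc] HA]; exists (RMin c) => n; rewrite HA; split=> [H | [k [Hk _]]]; last first.
  exists k; have /= := reval_inj Hk (Hc _).
  by case: (B _).
case: (ex_minnP H) => k Hk Hmin; exists k; split=> [|z Hz].
  by have := Hc (cpair n k); rewrite Hk.
exists 0; have := Hc (cpair n z); case E: (B _) => //.
by have := Hmin _ E; rewrite leqNgt Hz.
Qed.

(** A stage is a bound on the existential witnesses of the defining formula. *)
Lemma sdef_stages A : sdef (fun e => A (e 0)) ->
  exists B, [/\ dec B, forall n, A n <-> exists k, B (cpair n k)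
     & forall n k, B (cpair n k) -> A n].
Proof.
case=> p Hp; exists (fun z => bsat (csnd z) p (edec (cpair (cfst z) 0))).
have HA n : A n <-> exists k, bsat (csnd (cpair n k)) p (edec (cpair (cfst (cpair n k)) 0)).
  rewrite -[n in A n](_ : edec (cpair n 0) 0 = n); last by rewrite edec_cons.
  by rewrite -Hp bsat_ssat; split=> -[k Hk]; exists k; rewrite !cpE in Hk *.
split=> // [|n k H]; last by apply/HA; exists k.
apply: dec_ext (dec_app (dec_bsat p) (_ : comp (fun z => cpair (csnd z) (cpair (cfst z) 0)))).
  by move=> z; rewrite !cpE.
by do ![exact: comp_id | exact: comp_const | apply: comp_pair | apply: comp_fst | apply: comp_snd].
Qed.

Lemma ce_sdef A : sdef (fun e => A (e 0)) -> ce A.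
Proof. by move=> /sdef_stages [B [HB HA _]]; apply: ce_search; exists B. Qed.

Lemma ce_ext A B : (forall n, A n <-> B n) -> ce A -> ce B.
Proof. by move=> E [c Hc]; exists c => n; rewrite -E. Qed.

Lemma ce_app A f : comp f -> ce A -> ce (fun n => A (f n)).
Proof.
move=> [c Hc] [c' Hc']; exists (RComp c' c) => n; rewrite Hc'; split=> -[y Hy].
  by exists y, (f n).
by case: Hy => z Hz Hy; exists y; rewrite (reval_inj (Hc n) Hz).
Qed.

Lemma ce_and A B : ce A -> ce B -> ce (fun n => A n /\ B n).
Proof. by move=> HA HB; apply: ce_sdef; exact: sdef_and (sdef_ce 0 HA) (sdef_ce 0 HB). Qed.

Lemma ce_ex (A : nat -> nat -> Prop) : ce (fun z => A (cfst z) (csnd z)) -> ce (fun n => exists m, A n m).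
Proof.
move=> HA; apply: ce_sdef.
apply: (@sdef_ext (fun e => exists m z, z = cpair (e 0) m /\ A (cfst z) (csnd z))).
  move=> e; split=> [[m [_ [-> ]]] | [m H]]; first by rewrite !cpE; exists m.
  by exists m; eexists; split=> //; rewrite !cpE.
apply: (@sdef_ex (fun m e => exists z, z = cpair (e 0) m /\ A (cfst z) (csnd z))).
apply: (@sdef_ex (fun z e => z = cpair (e 1) (e 0) /\ A (cfst z) (csnd z))).
by apply: sdef_and; [apply: sdef_eq; dfn_tac | exact: (sdef_ce 0 HA)].
Qed.

Lemma ce_eq f g : comp f -> comp g -> ce (fun n => f n = g n).
Proof.
move=> Hf Hg; apply: ce_search; exists (fun z => f (cfst z) == g (cfst z)); split.
  by apply: dec_eq; apply: comp_app => //; apply/comp_fst/comp_id.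
by move=> n; split=> [E | [k]]; [exists 0; rewrite cpE E | rewrite cpE => /eqP].
Qed.

(* The selector runs the enumerations of [A] and [B] in parallel. *)
Lemma ce_choose A B : ce A -> ce B -> (forall n, A n \/ B n) ->
  exists c, forall n, (reval c n 0 /\ A n) \/ (reval c n 1 /\ B n).
Proof.
move=> /(sdef_ce 0)/sdef_stages [A' [HA EA SA]] /(sdef_ce 0)/sdef_stages [B' [HB EB SB]] HAB.
have [c Hc] := dec_or HA HB; have [d Hd] := HA.
(* The program finds the least stage at which one of the two enumerations succeeds and applies the
   test of [A'] there. Tests return 0 for truth, so the answer 0 means that [A] holds and 1 that the
   success came from [B]. *)
exists (RComp d (RPair (RPair RLeft RRight) (RMin c))) => n.
have : exists k, A' (cpair n k) || B' (cpair n k).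
  by case: (HAB n) => [/EA|/EB] [k Hk]; exists k; rewrite Hk ?orbT.
move=> H; case: (ex_minnP H) => k Hk Hmin.
have Hr : reval (RPair (RPair RLeft RRight) (RMin c)) n (cpair n k).
  exists n, k; split=> //.
    exists (cfst n), (csnd n).
    by split; [exists (csnd n) | exists (cfst n)|]; rewrite cpair_eta.
  split=> [|z Hz]; first by have := Hc (cpair n k); rewrite Hk.
  exists 0; have := Hc (cpair n z); case E: (_ || _) => //.
  by have := Hmin _ E; rewrite leqNgt Hz.
have Hd' := Hd (cpair n k).
case EA' : (A' (cpair n k)) in Hd' Hk.
  by left; split; [exists (cpair n k) | apply: SA EA'].
by right; split; [exists (cpair n k) | apply: SB Hk].
Qed.

(** * Recursively inseparable sets *)

(** Self-application needs a universal predicate for programs. Presenting evaluation as derivability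
    makes it definable by coding finite sequences alone, with no interpreter written as a
    program. *)
Inductive derivable (ax : nat -> Prop) (rule : nat -> nat -> nat -> Prop) : nat -> Prop :=
| DAx x : ax x -> derivable ax rule x
| DRule x y z : derivable ax rule y -> derivable ax rule z -> rule x y z -> derivable ax rule x.

Definition deriv_seq ax rule (s : nat -> nat) k := forall i, i <= k ->
  ax (s i) \/ exists j l, [/\ j < i, l < i & rule (s i) (s j) (s l)].

Lemma derivable_seq ax rule x :
  derivable ax rule x <-> exists s k, deriv_seq ax rule s k /\ s k = x.
Proof.
split=> [|[s [k [Hs <-]]]]; last first.
  have [n] := ubnP k; elim: n k Hs => // n IH k Hs Hk.
  case: (Hs k (leqnn k)) => [|[j [l [Hj Hl Hr]]]]; first exact: DAx.
  have H m : m < k -> derivable ax rule (s m).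
    move=> Hm; apply: IH; last exact: leq_trans Hm Hk.
    by move=> i Hi; apply: Hs; apply: leq_trans Hi (ltnW Hm).
  exact: DRule (H j Hj) (H l Hl) Hr.
elim=> [{}x Hx | {}x y z _ [s [k [Hs Ey]]] _ [t [l [Ht Ez]]] Hr].
  by exists (fun=> x), 0; split=> // i _; left.
(* Positions [0] to [k] hold the derivation of [y], the next [l.+1] positions that of [z], and the
   last one [x]. *)
exists (fun i => if i <= k then s i else if i <= k + l.+1 then t (i - k.+1) else x), (k + l.+1).+1.
split; last by rewrite ltnn; case: ltnP => //; lia.
move=> i Hi; case: (leqP i k) => Hik.
  case: (Hs i Hik) => [|[j [m [Hj Hm H]]]]; [by left | right; exists j, m; split=> //].
  by rewrite !(leq_trans (ltnW _) Hik).
case: (leqP i (k + l.+1)) => Hil.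
  case: (Ht (i - k.+1)) => [|H|[j [m [Hj Hm H]]]]; [lia | by left | right].
  exists (k.+1 + j), (k.+1 + m); split; [lia | lia |].
  have -> : (k.+1 + j <= k) = false by lia.
  have -> : (k.+1 + m <= k) = false by lia.
  have -> : (k.+1 + j <= k + l.+1) by lia.
  have -> : (k.+1 + m <= k + l.+1) by lia.
  by rewrite !addKn.
right; exists k, (k.+1 + l); split; [lia | lia |].
rewrite leqnn; have -> : (k.+1 + l <= k) = false by lia.
have -> : k.+1 + l <= k + l.+1 by lia.
by rewrite addKn Ey Ez.
Qed.

Lemma sdef_derivable ax rule i : sdef (fun e => ax (e 0)) -> sdef (fun e => rule (e 0) (e 1) (e 2)) ->
  sdef (fun e => derivable ax rule (e i)).
Proof.
move=> Hax Hrule.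
apply: (@sdef_ext (fun e => exists a b k, (forall x, x <= k -> exists y, y = beta a b x /\
    (ax y \/ exists j l u v, (j < x /\ l < x) /\ (u = beta a b j /\ v = beta a b l) /\ rule y u v)) /\ e i = beta a b k)).
  move=> e; rewrite derivable_seq; split=> [[a [b [k [H ->]]]] | [s [k [Hs E]]]].
    exists (beta a b), k; split=> // x /H [_ [-> [|[j [l [_ [_ [[Hj Hl] [[-> ->] Hr]]]]]]]]]; [by left | right].
    by exists j, l.
  have [a [b Hab]] := betaP s k; exists a, b, k; rewrite Hab //; split=> // x Hx.
  exists (s x); split; first by rewrite Hab.
  case: (Hs x Hx) => [|[j [l [Hj Hl Hr]]]]; [by left | right].
  exists j, l, (s j), (s l); rewrite !Hab ?(leq_trans (ltnW _) Hx) //.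
apply: (@sdef_ex (fun a e => exists b k, _)).
apply: (@sdef_ex (fun b e => exists k, _)).
apply: (@sdef_ex (fun k e => _)).
apply: sdef_and; last by apply: sdef_eq; dfn_tac.
apply: (@sdef_fball (fun e => e 0) (fun x e => exists y, y = beta (e 2) (e 1) x /\
    (ax y \/ exists j l u v, (j < x /\ l < x) /\ (u = beta (e 2) (e 1) j /\ v = beta (e 2) (e 1) l) /\ rule y u v)));
  first exact: dfn_var.
apply: (@sdef_ex (fun y e => _)).
apply: sdef_and; first by apply: sdef_eq; dfn_tac.
apply: sdef_or => //.
apply: (@sdef_ex (fun j e => exists l u v, _)).
apply: (@sdef_ex (fun l e => exists u v, _)).
apply: (@sdef_ex (fun u e => exists v, _)).
apply: (@sdef_ex (fun v e => _)).
apply: sdef_and; first by apply: sdef_and; apply: sdef_le; dfn_tac.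
apply: sdef_and; first by apply: sdef_and; apply: sdef_eq; dfn_tac.
exact: (sdef_ren (fun i => match i with 0 => 4 | 1 => 1 | _ => 0 end) Hrule).
Qed.

(** * Evaluation of programs as a derivation system *)

Fixpoint rcode (c : recfun) : nat :=
  match c with
  | RZero => cpair 0 0
  | RSucc => cpair 1 0
  | RLeft => cpair 2 0
  | RRight => cpair 3 0
  | RPair f g => cpair 4 (cpair (rcode f) (rcode g))
  | RComp f g => cpair 5 (cpair (rcode f) (rcode g))
  | RPrec f g => cpair 6 (cpair (rcode f) (rcode g))
  | RMin f => cpair 7 (rcode f)
  end.

(* [jev c n y] codes "program [c] maps [n] to [y]", and [jpos c n y] codes
   "program [c] is defined and positive at [(n, z)] for all [z < y]". *)
Definition jev c n y := cpair 0 (cpair c (cpair n y)).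
Definition jpos c n y := cpair 1 (cpair c (cpair n y)).

Inductive jax : nat -> Prop :=
| JZero n : jax (jev (cpair 0 0) n 0)
| JSucc n : jax (jev (cpair 1 0) n n.+1)
| JLeft a b : jax (jev (cpair 2 0) (cpair a b) a)
| JRight a b : jax (jev (cpair 3 0) (cpair a b) b)
| JPos0 f n : jax (jpos f n 0).

(** All rules have exactly two premises, so [JPrec0] repeats its only one. Minimization has
    unboundedly many premises; these are collected one at a time by the judgment [jpos]. *)
Inductive jrule : nat -> nat -> nat -> Prop :=
| JPair f g n a b : jrule (jev (cpair 4 (cpair f g)) n (cpair a b)) (jev f n a) (jev g n b)
| JComp f g n z y : jrule (jev (cpair 5 (cpair f g)) n y) (jev g n z) (jev f z y)
| JPrec0 f g a y : jrule (jev (cpair 6 (cpair f g)) (cpair a 0) y) (jev f a y) (jev f a y)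
| JPrecS f g a k z y : jrule (jev (cpair 6 (cpair f g)) (cpair a k.+1) y)
    (jev (cpair 6 (cpair f g)) (cpair a k) z) (jev g (cpair a (cpair k z)) y)
| JMin f n y : jrule (jev (cpair 7 f) n y) (jpos f n y) (jev f (cpair n y) 0)
| JPosS f n y k : jrule (jpos f n y.+1) (jpos f n y) (jev f (cpair n y) k.+1).

Ltac sdef_eqs := do ?[apply: (@sdef_ex (fun x e => _))]; do ?[apply: sdef_and]; apply: sdef_eq; rewrite /jev /jpos; dfn_tac.

Lemma sdef_jax : sdef (fun e => jax (e 0)).
Proof.
apply: (@sdef_ext (fun e => (exists n, e 0 = jev (cpair 0 0) n 0) \/ (exists n, e 0 = jev (cpair 1 0) n n.+1) \/
  (exists a b, e 0 = jev (cpair 2 0) (cpair a b) a) \/ (exists a b, e 0 = jev (cpair 3 0) (cpair a b) b) \/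
  (exists f n, e 0 = jpos f n 0))).
  move=> e; split=> [|[]].
    case=> [[n ->]|[[n ->]|[[a [b ->]]|[[a [b ->]]|[f [n ->]]]]]].
    + exact: JZero. + exact: JSucc. + exact: JLeft. + exact: JRight. + exact: JPos0.
  - by left; exists n.
  - by right; left; exists n.
  - by do 2!right; left; exists a, b.
  - by do 3!right; left; exists a, b.
  - by do 4!right; exists f, n.
do 4?[apply: sdef_or]; sdef_eqs.
Qed.

Lemma sdef_jrule : sdef (fun e => jrule (e 0) (e 1) (e 2)).
Proof.
apply: (@sdef_ext (fun e =>
  (exists f g n a b, e 0 = jev (cpair 4 (cpair f g)) n (cpair a b) /\ e 1 = jev f n a /\ e 2 = jev g n b) \/
  (exists f g n z y, e 0 = jev (cpair 5 (cpair f g)) n y /\ e 1 = jev g n z /\ e 2 = jev f z y) \/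
  (exists f g a y, e 0 = jev (cpair 6 (cpair f g)) (cpair a 0) y /\ e 1 = jev f a y /\ e 2 = jev f a y) \/
  (exists f g a k z y, e 0 = jev (cpair 6 (cpair f g)) (cpair a k.+1) y /\
     e 1 = jev (cpair 6 (cpair f g)) (cpair a k) z /\ e 2 = jev g (cpair a (cpair k z)) y) \/
  (exists f n y, e 0 = jev (cpair 7 f) n y /\ e 1 = jpos f n y /\ e 2 = jev f (cpair n y) 0) \/
  (exists f n y k, e 0 = jpos f n y.+1 /\ e 1 = jpos f n y /\ e 2 = jev f (cpair n y) k.+1))).
  move=> e; split.
    case=> [[f [g [n [a [b [-> [-> ->]]]]]]]|]; first exact: JPair.
    case=> [[f [g [n [z [y [-> [-> ->]]]]]]]|]; first exact: JComp.
    case=> [[f [g [a [y [-> [-> ->]]]]]]|]; first exact: JPrec0.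
    case=> [[f [g [a [k [z [y [-> [-> ->]]]]]]]]|]; first exact: JPrecS.
    case=> [[f [n [y [-> [-> ->]]]]]|]; first exact: JMin.
    by case=> [f [n [y [k [-> [-> ->]]]]]]; exact: JPosS.
  move: (e 0) (e 1) (e 2) => x u v; case.
  - by move=> f g n a b; left; exists f, g, n, a, b.
  - by move=> f g n z y; right; left; exists f, g, n, z, y.
  - by move=> f g a y; do 2!right; left; exists f, g, a, y.
  - by move=> f g a k z y; do 3!right; left; exists f, g, a, k, z, y.
  - by move=> f n y; do 4!right; left; exists f, n, y.
  - by move=> f n y k; do 5!right; exists f, n, y, k.
do 5?[apply: sdef_or]; sdef_eqs.
Qed.

Lemma derivable_reval c n y : reval c n y -> derivable jax jrule (jev (rcode c) n y).
Proof.
elim: c n y => [|||| f IHf g IHg|f IHf g IHg|f IHf g IHg|f IHf] n y /=.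
- by move=> ->; apply/DAx/JZero.
- by move=> ->; apply/DAx/JSucc.
- by move=> [b ->]; apply/DAx/JLeft.
- by move=> [b ->]; apply/DAx/JRight.
- by move=> [a [b [/IHf Ha /IHg Hb ->]]]; apply: DRule Ha Hb (JPair _ _ _ _ _).
- by move=> [z /IHg Ha /IHf Hb]; apply: DRule Ha Hb (JComp _ _ _ _ _).
- move=> [a [k [-> H]]]; elim: k y H => [|k IH] y; first by move=> /IHf Hf; exact: (DRule Hf Hf (JPrec0 _ _ _ _)).
  by move=> [z /IH Ha /IHg Hb]; apply: DRule Ha Hb (JPrecS _ _ _ _ _ _).
- move=> [/IHf H Hlt]; apply: DRule _ H (JMin _ _ _).
  elim: y Hlt => [|y IH] Hlt; first exact/DAx/JPos0.
  have [k /IHf Hk] := Hlt y (ltnSn y).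
  by apply: DRule (IH _) Hk (JPosS _ _ _ _) => z Hz; apply: Hlt; apply: ltnW.
Qed.

(** Both judgments are treated in one induction because [JMin] and [JPosS] interleave them. The
    rules do not check that their numbers code programs, whence the restriction to [rcode c]. *)
Lemma reval_derivable x : derivable jax jrule x ->
  (forall c n y, x = jev (rcode c) n y -> reval c n y) /\
  (forall c n y, x = jpos (rcode c) n y -> forall z, z < y -> exists k, reval c (cpair n z) k.+1).
Proof.
have jevI c n y c' n' y' : jev c n y = jev c' n' y' -> [/\ c = c', n = n' & y = y'].
  by move=> /cpair_inj [_ /cpair_inj [-> /cpair_inj [-> ->]]].
have jposI c n y c' n' y' : jpos c n y = jpos c' n' y' -> [/\ c = c', n = n' & y = y'].
  by move=> /cpair_inj [_ /cpair_inj [-> /cpair_inj [-> ->]]].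
have jne c n y c' n' y' : jev c n y = jpos c' n' y' -> False by move=> /cpair_inj [].
elim=> {x} [x Hx | x y z _ [IHy IHy'] _ [IHz IHz'] Hr].
  split=> c n y; last by case: Hx => [n0|n0|a b|a b|f n0] E; [by case: (jne _ _ _ _ _ _ E) ..|case: (jposI _ _ _ _ _ _ E) => _ _ <-].
  case: Hx => [n0|n0|a b|a b|f n0] E; last by case: (jne _ _ _ _ _ _ (esym E)).
  + by case: (jevI _ _ _ _ _ _ E) => Ec <- <-; case: c Ec {E} => [||||f g|f g|f g|f] /= /cpair_inj [].
  + by case: (jevI _ _ _ _ _ _ E) => Ec <- <-; case: c Ec {E} => [||||f g|f g|f g|f] /= /cpair_inj [].
  + by case: (jevI _ _ _ _ _ _ E) => Ec <- <-; case: c Ec {E} => [||||f g|f g|f g|f] /= /cpair_inj [] // _ _; exists b.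
  + by case: (jevI _ _ _ _ _ _ E) => Ec <- <-; case: c Ec {E} => [||||f g|f g|f g|f] /= /cpair_inj [] // _ _; exists a.
case: Hr IHy IHy' IHz IHz' => [f g n a b|f g n u v|f g a v|f g a k u v|f n v|f n v k] IHy IHy' IHz IHz'; split=> c n0 y0 E;
  try by [case: (jne _ _ _ _ _ _ E) | case: (jne _ _ _ _ _ _ (esym E))].
1-5: case: (jevI _ _ _ _ _ _ E) => Ec <- <-; case: c Ec {E} => [||||f' g'|f' g'|f' g'|f'] /= /cpair_inj [] // _;
  try (move=> /cpair_inj [? ?]); subst.
- by exists a, b; split; [apply: IHy | apply: IHz |].
- by exists u; [apply: IHy | apply: IHz].
- by exists a, 0; split=> //; apply: IHy.
- have /= := IHy (RPrec f' g') (cpair a k) u erefl => -[a' [k' [/cpair_inj [<- <-] H]]].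
  by exists a, k.+1; split=> //; exists u => //; apply: IHz.
- by move=> Ef; subst; split; [apply: IHz | apply: IHy'].
- case: (jposI _ _ _ _ _ _ E) => Ec <- <- z0; subst.
  rewrite ltnS leq_eqVlt => /orP [/eqP-> | Hz0]; last exact: IHy' erefl _ Hz0.
  by exists k; apply: IHz.
Qed.

(* Meaningful only when [n] is the code of a program. *)
Definition selfmaps (v n : nat) : Prop := derivable jax jrule (jev n n v).

Lemma selfmapsP v c : selfmaps v (rcode c) <-> reval c (rcode c) v.
Proof. by split=> [/reval_derivable [H _] | /derivable_reval //]; apply: H. Qed.

Lemma ce_selfmaps v : ce (selfmaps v).
Proof.
apply: (ce_app (A := derivable jax jrule)).
  by do ![exact: comp_id | exact: comp_const | apply: comp_pair].
exact/ce_sdef/sdef_derivable/sdef_jrule/sdef_jax.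
Qed.

(** * Models *)

(* Equality is interpreted by a congruence, so that inner models need no
   quotient. *)
Record model (L : signature) : Type := Model {
  carrier :> Type;
  point : carrier;
  meq : carrier -> carrier -> Prop;
  mfun : forall f : fsym L, ('I_(far f) -> carrier) -> carrier;
  mrel : forall r : rsym L, ('I_(rar r) -> carrier) -> Prop;
  meq_refl : forall x, meq x x;
  meq_sym : forall x y, meq x y -> meq y x;
  meq_trans : forall x y z, meq x y -> meq y z -> meq x z;
  mfun_cong : forall f a b, (forall i, meq (a i) (b i)) -> meq (@mfun f a) (@mfun f b);
  mrel_cong : forall r a b, (forall i, meq (a i) (b i)) -> @mrel r a -> @mrel r b
}.
Arguments meq {L m}.
Arguments mfun {L m}.
Arguments mrel {L m}.

Section Semantics.
Variables (L : signature) (M : model L).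
Implicit Types (e : nat -> M) (t : term L) (p q : form L).

Fixpoint eval e t {struct t} : M :=
  match t with
  | Var x => e x
  | Fun f a => mfun f (fun i => eval e (a i))
  end.

Fixpoint sat e p {struct p} : Prop :=
  match p with
  | Bot => False
  | Eq t u => meq (eval e t) (eval e u)
  | Rel r a => mrel r (fun i => eval e (a i))
  | Imp p q => sat e p -> sat e q
  | All p => forall x, sat (x .: e) p
  end.

Lemma eval_tsubst e s t : eval e (tsubst s t) = eval (fun x => eval e (s x)) t.
Proof.
elim/term_ind': t => //= f a IH; congr mfun.
by apply: funext => i; rewrite ffunE.
Qed.

Lemma sat_subst e s p : sat e (subst s p) <-> sat (fun x => eval e (s x)) p.
Proof.
elim: p e s => //= [t u|r a|p IHp q IHq|p IHp] e s.
- by rewrite !eval_tsubst.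
- suff -> : (fun i => eval e ([ffun i => tsubst s (a i)] i)) = (fun i => eval (fun x => eval e (s x)) (a i)) by [].
  by apply: funext => i; rewrite ffunE eval_tsubst.
- by rewrite IHp IHq.
- suff E x : (fun y => eval (x .: e) (up s y)) = x .: (fun y => eval e (s y)).
    by split=> H x; move: (H x); rewrite IHp E.
  by apply: funext => -[|y] //=; rewrite eval_tsubst.
Qed.

Lemma sat_ren e f p : sat e (ren f p) <-> sat (fun x => e (f x)) p.
Proof. exact: sat_subst. Qed.

Lemma sat_inst e p t : sat e (inst p t) <-> sat (eval e t .: e) p.
Proof.
rewrite sat_subst; suff -> : (fun x => eval e (if x is y.+1 then Var y else t)) = eval e t .: e by [].
by apply: funext => -[].
Qed.

Lemma eval_cong e e' t : (forall x, meq (e x) (e' x)) -> meq (eval e t) (eval e' t).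
Proof. by move=> H; elim/term_ind': t => //= f a IH; apply: mfun_cong. Qed.

Lemma sat_cong e e' p : (forall x, meq (e x) (e' x)) -> sat e p <-> sat e' p.
Proof.
elim: p e e' => //= [t u|r a|p IHp q IHq|p IHp] e e' H.
- have Ht := eval_cong t H; have Hu := eval_cong u H.
  split=> E; first exact: meq_trans (meq_sym Ht) (meq_trans E Hu).
  exact: meq_trans Ht (meq_trans E (meq_sym Hu)).
- by split; apply: mrel_cong => i; [|apply: meq_sym]; apply: eval_cong.
- by rewrite (IHp _ _ H) (IHq _ _ H).
- have E x y : meq ((x .: e) y) ((x .: e') y) by case: y => //= ; apply: meq_refl.
  by split=> Hx x; move: (Hx x); rewrite (IHp _ _ (E x)).
Qed.

Lemma eval_bounded n e e' t : tbounded n t -> (forall x, x < n -> e x = e' x) -> eval e t = eval e' t.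
Proof.
move=> Ht H; elim/term_ind': t Ht => [x|f a IH] /=; first exact: H.
move/all_codomP => Ha; congr mfun; apply: funext => i.
exact: IH.
Qed.

Lemma sat_bounded n e e' p : bounded n p -> (forall x, x < n -> e x = e' x) -> sat e p <-> sat e' p.
Proof.
elim: p n e e' => //= [t u|r a|p IHp q IHq|p IHp] n e e'.
- by case/andP => Ht Hu H; rewrite (eval_bounded Ht H) (eval_bounded Hu H).
- move/all_codomP => Ha H.
  suff -> : (fun i => eval e (a i)) = (fun i => eval e' (a i)) by [].
  by apply: funext => i; apply: eval_bounded H.
- by case/andP => Hp Hq H; rewrite (IHp _ _ _ Hp H) (IHq _ _ _ Hq H).
- move=> Hp H.
  have E x y : y < n.+1 -> (x .: e) y = (x .: e') y by case: y => //= y; apply: H.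
  by split=> Hx x; move: (Hx x); rewrite (IHp _ _ _ Hp (E x)).
Qed.

Lemma sat_sentence e e' p : sentence p -> sat e p <-> sat e' p.
Proof. by move=> Hp; apply: (sat_bounded Hp). Qed.

Lemma sat_And e p q : sat e (And p q) <-> sat e p /\ sat e q.
Proof. by rewrite /=; split=> [|[]]; tauto. Qed.

Lemma sat_Or e p q : sat e (Or p q) <-> sat e p \/ sat e q.
Proof. by rewrite /=; split=> [|[]]; tauto. Qed.

Lemma sat_Ex e p : sat e (Ex p) <-> exists x, sat (x .: e) p.
Proof.
rewrite /=; split=> [H | [x Hx] H]; last exact: H Hx.
by apply: NNPP => Hn; apply: H => x Hx; apply: Hn; exists x.
Qed.

Definition bcons (T : Type) (k : nat) (b e : nat -> T) (v : nat) : T := if v < k then b v else e (v - k).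

Lemma bcons_scons (T : Type) k (b e : nat -> T) x :
  bcons k b (x .: e) = bcons k.+1 (fun v => if v < k then b v else x) e.
Proof.
apply: funext => v; rewrite /bcons ltnS.
case: (ltngtP v k) => [Hv|Hv|->]; last by rewrite subnn.
  by [].
by rewrite /scons; case E : (v - k) => [|w]; [|congr e]; lia.
Qed.

Lemma bconsS (T : Type) k (b e : nat -> T) : bcons k.+1 b e = bcons k b (b k .: e).
Proof.
apply: funext => v; rewrite /bcons ltnS.
case: (ltngtP v k) => [Hv|Hv|->]; last by rewrite subnn.
  by [].
by rewrite /scons; case E : (v - k) => [|w]; [|congr e]; lia.
Qed.

Lemma bcons0 (T : Type) (b e : nat -> T) : bcons 0 b e = e.
Proof. by apply: funext => v; rewrite /bcons subn0. Qed.

Lemma sat_Alls k e p : sat e (Alls k p) <-> forall b, sat (bcons k b e) p.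
Proof.
elim: k e => [|k IH] e /=; first by split=> [H b | H]; [|move: (H e)]; rewrite bcons0.
split=> H; first by move=> b; rewrite bconsS; apply: ((IH _).1 (H _)).
by move=> x; apply/IH => b; rewrite bcons_scons.
Qed.

Lemma sat_Exs k e p : sat e (Exs k p) <-> exists b, sat (bcons k b e) p.
Proof.
elim: k e => [|k IH] e; first by split=> [H|[b]]; [exists e|]; rewrite bcons0.
rewrite [Exs _ _]/(Ex _) sat_Ex; split=> [[x /IH [b]] | [b]].
  by rewrite bcons_scons; eexists; eassumption.
by rewrite bconsS => H; exists (b k); apply/IH; exists b.
Qed.

Lemma sat_Imps e ps p : sat e (Imps ps p) <-> ((forall q, List.In q ps -> sat e q) -> sat e p).
Proof.
elim: ps => /= [|q ps ->]; first by split=> [//|]; apply.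
split=> [H Hq | H Hq Hp]; first by apply: H => [|r Hr]; apply: Hq; [left|right].
by apply: H => r [<-|/Hp].
Qed.

Lemma sat_Ands e ps p : sat e (Ands ps p) <-> (forall q, List.In q ps -> sat e q) /\ sat e p.
Proof.
elim: ps => [|q ps IH]; first by split=> [//|[]].
rewrite [Ands _ _]/(And _ _) sat_And IH /=; split=> [[Hq [Hps Hp]] | [H Hp]].
  by split=> // r [<-|/Hps].
by do ![split] => //; [apply: H; left | move=> r Hr; apply: H; right].
Qed.

Lemma sat_Ors e ps : sat e (Ors ps) <-> exists2 q, List.In q ps & sat e q.
Proof.
elim: ps => [|q ps IH]; first by split=> [//|[]].
rewrite [Ors _]/(Or _ _) sat_Or IH /=; split=> [[Hq|[r Hr H]] | [r [->|Hr] H]].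
- by exists q => //; left.
- by exists r => //; right.
- by left.
- by right; exists r.
Qed.

End Semantics.

Lemma iff_refl_eq (P Q : Prop) : P = Q -> P <-> Q.
Proof. by move=> ->. Qed.

Lemma and_iff_congr (P P' Q Q' : Prop) : (P <-> P') -> (Q <-> Q') -> (P /\ Q) <-> (P' /\ Q').
Proof. by tauto. Qed.

Lemma In_map (T U : Type) (f : T -> U) s x : List.In x (map f s) <-> exists2 y, List.In y s & x = f y.
Proof.
elim: s => /= [|y s IH]; first by split=> [|[]].
rewrite IH; split=> [[<-|[z Hz ->]] | [z [<-|Hz] ->]]; [by exists y; [left|]|by exists z; [right|]|by left|].
by right; exists z.
Qed.

Lemma In_mem (T : eqType) (x : T) s : List.In x s <-> x \in s.
Proof.
elim: s => //= y s IH; rewrite inE IH; split=> [[->|->]|/orP [/eqP->|->]]; rewrite ?eqxx ?orbT //; by [left|right].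
Qed.

Lemma prf_sound (L : signature) G (p : form L) : prf G p ->
  forall (M : model L) (e : nat -> M), (forall q, List.In q G -> sat e q) -> sat e p.
Proof.
elim=> {G p} [G p HG|G p q _ IH|G p q _ IH _ IH'|G p _ IH|G p t _ IH|G p _ IH|G t|G p t u _ IH _ IH'] M e H.
- exact: H.
- by move=> Hp; apply: IH => r [<-|/H].
- exact: IH H (IH' _ _ H).
- by move=> x; apply: IH => q /In_map [r /H Hr ->]; apply/sat_ren.
- by apply/sat_inst; apply: IH.
- by apply: NNPP => Hp; apply: (IH M e) => q [<-|/H].
- exact: meq_refl.
- apply/sat_inst; move/sat_inst: (IH' _ _ H); apply: (sat_cong _ _).1 => -[|x] /=; [exact: IH | exact: meq_refl].
Qed.

Lemma proves_sound (L : signature) (X : form L -> Prop) p : proves X p ->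
  forall (M : model L) (e : nat -> M), (forall q, X q -> sat e q) -> sat e p.
Proof. by case=> G HG /prf_sound H M e HX; apply: H => q /HG/HX. Qed.

(** * Injectivity of the coding *)

Lemma code_seq_inj : injective code_seq.
Proof. by elim=> [|n s IH] [|m t] //= -[/cpair_inj [-> /IH->]]. Qed.

Lemma codom_inj (T : Type) n (U : Type) (f : T -> U) (a b : {ffun 'I_n -> T}) :
  (forall i x, f (a i) = f x -> a i = x) ->
  codom (fun i => f (a i)) = codom (fun i => f (b i)) -> a = b.
Proof.
move=> Hf; rewrite !codomE => /eq_in_map H; apply/ffunP => i.
by apply: Hf; apply: H; rewrite mem_enum.
Qed.

Section Code.
Variable L : signature.

Lemma code_term_inj : injective (@code_term L).
Proof.
move=> t; elim/term_ind': t => [x|f a IH] [y|g b] /= /cpair_inj [] // _; first by move=> ->.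
move=> /cpair_inj [/(pcan_inj pickleK) E]; subst g => /code_seq_inj Ea.
by rewrite (codom_inj (f := @code_term L) (fun i x => @IH i x) Ea).
Qed.

Lemma code_inj : injective (@code L).
Proof.
elim=> [|t u|r a|p IHp q IHq|p IHp] [|t' u'|r' a'|p' q'|p'] /= /cpair_inj [] // _.
- by move=> /cpair_inj [/code_term_inj-> /code_term_inj->].
- move=> /cpair_inj [/(pcan_inj pickleK) E]; subst r' => /code_seq_inj Ea.
  by rewrite (codom_inj (f := @code_term L) (fun i x => @code_term_inj _ x) Ea).
- by move=> /cpair_inj [/IHp-> /IHq->].
- by move/IHp->.
Qed.

(** Chosen classically, since no computability is asked of it: it enumerates the formulas for
    Henkin's construction and turns the entries of a code into the formulas of a translation. *)
Definition decode (n : nat) : form L :=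
  if excluded_middle_informative (exists p : form L, code p = n) is left H
  then proj1_sig (constructive_indefinite_description _ H) else Bot.

Lemma codeK p : decode (code p) = p.
Proof.
rewrite /decode; case: excluded_middle_informative => [H|[]]; last by exists p.
by apply: code_inj; case: constructive_indefinite_description.
Qed.

End Code.

(** * Completeness *)

Section Completeness.
Variable L : signature.
Implicit Types (s : nat -> term L) (t u : term L) (p q : form L) (G : seq (form L)).

Lemma tsubst_comp s s' t : tsubst s (tsubst s' t) = tsubst (fun x => tsubst s (s' x)) t.
Proof.
elim/term_ind': t => //= f a IH; congr Fun.
by apply/ffunP => i; rewrite !ffunE IH.
Qed.

Lemma up_comp s s' : (fun x => tsubst (up s) (up s' x)) = up (fun x => tsubst s (s' x)).
Proof. by apply: funext => -[|x] //=; rewrite !tsubst_comp. Qed.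

Lemma subst_comp s s' p : subst s (subst s' p) = subst (fun x => tsubst s (s' x)) p.
Proof.
elim: p s s' => //= [t u|r a|p IHp q IHq|p IHp] s s'.
- by rewrite !tsubst_comp.
- by congr Rel; apply/ffunP => i; rewrite !ffunE tsubst_comp.
- by rewrite IHp IHq.
- by rewrite IHp up_comp.
Qed.

Lemma tsubst_bounded n s s' t : tbounded n t -> (forall x, x < n -> s x = s' x) -> tsubst s t = tsubst s' t.
Proof.
move=> Ht H; elim/term_ind': t Ht => [x|f a IH] /=; first exact: H.
by move/all_codomP => Ha; congr Fun; apply/ffunP => i; rewrite !ffunE IH.
Qed.

Lemma subst_bounded n s s' p : bounded n p -> (forall x, x < n -> s x = s' x) -> subst s p = subst s' p.
Proof.
elim: p n s s' => //= [t u|r a|p IHp q IHq|p IHp] n s s'.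
- by case/andP => Ht Hu H; rewrite (tsubst_bounded Ht H) (tsubst_bounded Hu H).
- by move/all_codomP => Ha H; congr Rel; apply/ffunP => i; rewrite !ffunE (tsubst_bounded (Ha i) H).
- by case/andP => Hp Hq H; rewrite (IHp _ _ _ Hp H) (IHq _ _ _ Hq H).
- by move=> Hp H; rewrite (IHp _ _ (up s') Hp) // => -[|x] //= /H ->.
Qed.

Lemma tsubst_Var t : tsubst Var t = t.
Proof. by elim/term_ind': t => //= f a IH; congr Fun; apply/ffunP => i; rewrite !ffunE IH. Qed.

Lemma up_Var : up (@Var L) = Var.
Proof. by apply: funext => -[]. Qed.

Lemma subst_Var p : subst Var p = p.
Proof.
elim: p => //= [t u|r a|p -> q -> //|p IHp]; first by rewrite !tsubst_Var.
  by congr Rel; apply/ffunP => i; rewrite !ffunE tsubst_Var.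
by rewrite up_Var IHp.
Qed.

Fixpoint tbnd t : nat :=
  match t with
  | Var x => x.+1
  | Fun f a => foldr maxn 0 (codom (fun i => tbnd (a i)))
  end.

Lemma leq_foldr_maxn (x : nat) (r : seq nat) : x \in r -> x <= foldr maxn 0 r.
Proof.
elim: r => //= y r IH; rewrite inE leq_max => /orP [/eqP->|/IH->]; rewrite ?leqnn ?orbT //.
Qed.

Lemma tbounded_mono n m t : n <= m -> tbounded n t -> tbounded m t.
Proof.
move=> Hnm; elim/term_ind': t => [x|f a IH] /=; first by move=> H; apply: leq_trans Hnm.
by move/all_codomP => H; apply/all_codomP => i; apply: IH.
Qed.

Lemma bounded_mono n m p : n <= m -> bounded n p -> bounded m p.
Proof.
elim: p n m => //= [t u|r a|p IHp q IHq|p IHp] n m Hnm.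
- by case/andP => Ht Hu; rewrite !(tbounded_mono Hnm).
- by move/all_codomP => H; apply/all_codomP => i; apply: (tbounded_mono Hnm).
- by case/andP => Hp Hq; rewrite (IHp n m) // (IHq n m).
- exact: IHp.
Qed.

Lemma tbndP t : tbounded (tbnd t) t.
Proof.
elim/term_ind': t => //= f a IH; apply/all_codomP => i.
by apply: tbounded_mono (IH i); apply: leq_foldr_maxn; apply: codom_f.
Qed.

Fixpoint bnd p : nat :=
  match p with
  | Bot => 0
  | Eq t u => maxn (tbnd t) (tbnd u)
  | Rel r a => foldr maxn 0 (codom (fun i => tbnd (a i)))
  | Imp p q => maxn (bnd p) (bnd q)
  | All p => bnd p
  end.

Lemma bndP p : bounded (bnd p) p.
Proof.
elim: p => //= [t u|r a|p IHp q IHq|p IHp].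
- by rewrite !(tbounded_mono _ (tbndP _)) ?leq_maxl ?leq_maxr.
- by apply/all_codomP => i; apply: tbounded_mono (tbndP _); apply: leq_foldr_maxn; apply: codom_f.
- by rewrite (bounded_mono _ IHp) ?(bounded_mono _ IHq) ?leq_maxl ?leq_maxr.
- by apply: bounded_mono IHp.
Qed.

Definition lbnd G := foldr maxn 0 (map bnd G).

Lemma lbndP G p : List.In p G -> bounded (lbnd G) p.
Proof.
elim: G => //= q G IH [->|/IH]; last by apply: bounded_mono; rewrite leq_maxr.
by apply: bounded_mono (bndP _); rewrite leq_maxl.
Qed.

Lemma prf_weak G G' p : prf G p -> (forall q, List.In q G -> List.In q G') -> prf G' p.
Proof.
move=> H; elim: H G' => {G p} [G p HG|G p q _ IH|G p q _ IH _ IH'|G p _ IH|G p t _ IH|G p _ IH|G t|G p t u _ IH _ IH'] G' HG'.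
- exact/PAx/HG'.
- by apply/PImpI/IH => r [->|/HG']; [left|right].
- exact: PImpE (IH _ HG') (IH' _ HG').
- by apply/PAllI/IH => q /In_map [r /HG' Hr ->]; apply/In_map; exists r.
- exact/PAllE/IH.
- by apply/PRaa/IH => r [->|/HG']; [left|right].
- exact: PRefl.
- exact: PLeibniz (IH _ HG') (IH' _ HG').
Qed.

Lemma prf_weak1 G p q : prf G p -> prf (q :: G) p.
Proof. by move=> H; apply: (prf_weak H) => r; right. Qed.

Lemma subst_inst s p t : subst s (inst p t) = inst (subst (up s) p) (tsubst s t).
Proof.
rewrite /inst !subst_comp; congr subst; apply: funext => -[|x] //=.
by rewrite tsubst_comp -[LHS]tsubst_Var.
Qed.

Lemma subst_ren_up s p : subst (up s) (ren succn p) = ren succn (subst s p).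
Proof. by rewrite /ren !subst_comp. Qed.

Lemma prf_subst G p s : prf G p -> prf (map (subst s) G) (subst s p).
Proof.
move=> H; elim: H s => {G p} [G p HG|G p q _ IH|G p q _ IH _ IH'|G p _ IH|G p t _ IH|G p _ IH|G t|G p t u _ IH _ IH'] s.
- by apply/PAx/In_map; exists p.
- exact/PImpI/(IH s).
- exact: PImpE (IH s) (IH' s).
- apply: PAllI; move: (IH (up s)); rewrite -!map_comp.
  by rewrite (eq_map (g := ren succn \o subst s)) // => q /=; rewrite subst_ren_up.
- by rewrite subst_inst; apply/PAllE/(IH s).
- exact/PRaa/(IH s).
- exact: PRefl.
- by move: (IH' s); rewrite !subst_inst; apply: PLeibniz (IH s).
Qed.

Lemma prf_gen G p v : (forall q, List.In q G -> bounded v q) -> bounded v.+1 p ->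
  prf G (inst p (Var v)) -> prf G (All p).
Proof.
move=> HG Hp H; apply: PAllI.
(* The fresh variable becomes the bound one and all others are shifted, which is the shape demanded
   by [PAllI]. *)
pose s x : term L := if x == v then Var 0 else Var x.+1.
have := prf_subst s H.
have -> : map (subst s) G = map (ren succn) G.
  elim: G HG {H} => //= q G IH HG; rewrite IH => [|r Hr]; last by apply: HG; right.
  congr cons; apply: (@subst_bounded v); first by apply: HG; left.
  by move=> x Hx; rewrite /s; case: eqP => // E; rewrite E ltnn in Hx.
rewrite /inst subst_comp (_ : subst _ p = p) // -[RHS]subst_Var.
apply: (subst_bounded Hp) => -[|x] Hx /=; rewrite /s ?eqxx //.
by case: eqP => // E; rewrite E ltnn in Hx.
Qed.

Lemma prf_exfalso G p : prf G Bot -> prf G p.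
Proof. by move=> H; apply/PRaa/(prf_weak H) => q Hq; right. Qed.

Variable X : form L -> Prop.
Hypothesis X_sentence : forall p, X p -> sentence p.

Local Notation addl G := (fun q => X q \/ List.In q G).

Lemma proves_imp p q G : proves (addl (p :: G)) q -> proves (addl G) (Imp p q).
Proof.
case=> H HH Hq.
suff [H' HH' Hin] : exists2 H', (forall r, List.In r H' -> X r \/ List.In r G) &
    forall r, List.In r H -> r = p \/ List.In r H'.
  exists H' => //; apply/PImpI/(prf_weak Hq) => r /Hin [->|]; by [left|right].
elim: H HH {Hq} => [|r H IH] HH; first by exists [::].
case: IH => [u Hu|H' HH' Hin]; first by apply: HH; right.
case: (HH r (or_introl erefl)) => [Hr|[<-|Hr]]; last 1 first.
- by exists (r :: H') => u [<-|Hu]; [right|exact: HH'|right; left|case: (Hin u Hu); [left|right; right]].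
- by exists (r :: H') => u [<-|Hu]; [left|exact: HH'|right; left|case: (Hin u Hu); [left|right; right]].
- by exists H' => // u [<-|Hu]; [left|apply: Hin].
Qed.

Definition con G := ~ proves (addl G) (@Bot L).

Definition henkin p v : form L := Imp (inst p (Var v)) (All p).

(** Free variables play the role of Henkin constants, so the signature is not extended: the axioms
    in [X] are sentences and each stage adds finitely many formulas, which leaves fresh variables.
    Stage [m] decides the formula with code [m] and then adds the Henkin axiom for its universal
    closure over the first variable. *)
Fixpoint extn (n : nat) : seq (form L) :=
  if n is m.+1 then
    let p := decode L m in
    let G := if excluded_middle_informative (con (p :: extn m)) then p :: extn m else extn m in
    henkin p (lbnd (All p :: G)) :: G
  else [::].

(** If the Henkin axiom were refutable, its premise [inst p (Var v)] would be provable, as the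
    negation of a premise implies the implication. Freshness of [v] then gives [All p], and with it
    the Henkin axiom. *)
Lemma con_henkin p v G : (forall q, List.In q G -> bounded v q) -> bounded v.+1 p ->
  con G -> con (henkin p v :: G).
Proof.
move=> HG Hp Hcon /proves_imp [H HH Hh]; apply: Hcon; exists H => //.
have H1 : prf H (inst p (Var v)).
  apply: PRaa; apply: PImpE (prf_weak1 _ Hh) _.
  apply: PImpI; apply: prf_exfalso; apply: PImpE (PAx _) (PAx _); first by right; left.
  by left.
have H2 : prf H (All p).
  apply: (prf_gen (v := v)) => // q /HH [/X_sentence|/HG //].
  exact: bounded_mono.
apply: PImpE Hh _; apply: PImpI; apply: prf_weak H2 _ => q; by right.
Qed.

Hypothesis X_con : con [::].

Lemma con_extn n : con (extn n).
Proof.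
elim: n => //= n IH; set p := decode L n; set G := if _ then _ else _.
apply: con_henkin; last by rewrite /G; case: excluded_middle_informative.
  by move=> q Hq; apply: (@lbndP (All p :: G)); right.
by have := @lbndP (All p :: G) (All p) (or_introl erefl).
Qed.

Lemma extnS n q : List.In q (extn n) -> List.In q (extn n.+1).
Proof. by move=> H /=; right; case: excluded_middle_informative => ? //; right. Qed.

Lemma extn_mono n m q : n <= m -> List.In q (extn n) -> List.In q (extn m).
Proof. by move=> /subnK <-; elim: (m - n) => // k IH /IH; apply: extnS. Qed.

Definition lim q := X q \/ exists n, List.In q (extn n).

Definition Th q := proves lim q.

Lemma Th_con : ~ Th Bot.
Proof.
case=> H HH Hq.
suff [n Hn] : exists n, forall r, List.In r H -> X r \/ List.In r (extn n) by case: (@con_extn n); exists H.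
elim: H HH {Hq} => [|r H IH] HH; first by exists 0.
case: IH => [u Hu|n Hn]; first by apply: HH; right.
case: (HH r (or_introl erefl)) => [Hr|[m Hr]].
  by exists n => u [<-|/Hn //]; left.
exists (maxn n m) => u [<-|/Hn []]; [right|by left|right]; apply: extn_mono; try eassumption; by rewrite ?leq_maxl ?leq_maxr.
Qed.

Lemma Th_incl p : lim p -> Th p.
Proof. by move=> H; exists [:: p] => [q [<-|]|] //; apply: PAx; left. Qed.

Lemma Th_max p : Th p \/ Th (Neg p).
Proof.
case: (classic (con (p :: extn (code p)))) => [Hc|/NNPP/proves_imp [G HG H]].
  left; apply: Th_incl; right; exists (code p).+1; right.
  by rewrite codeK; case: excluded_middle_informative => // ?; left.
by right; exists G => // q /HG [|Hq]; [left | right; exists (code p)].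
Qed.

Lemma Th_imp2 p q r : (forall G, prf G p -> prf G q -> prf G r) -> Th p -> Th q -> Th r.
Proof.
move=> H [G HG Hp] [G' HG' Hq]; exists (G ++ G') => [u /List.in_app_iff [/HG|/HG'] //|].
by apply: H; [apply: prf_weak Hp _ | apply: prf_weak Hq _] => u Hu; apply/List.in_app_iff; [left|right].
Qed.

Lemma Th_imp1 p r : (forall G, prf G p -> prf G r) -> Th p -> Th r.
Proof. by move=> H Hp; apply: (@Th_imp2 p p) => // G _; apply: H. Qed.

Lemma Th_mp p q : Th (Imp p q) -> Th p -> Th q.
Proof. by apply: Th_imp2 => G; apply: PImpE. Qed.

Lemma Th_refl t : Th (Eq t t).
Proof. by exists [::] => //; apply: PRefl. Qed.

Lemma inst_shift s p (n : nat) t :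
  inst (subst (fun x => if x == n then Var 0 else tsubst (fun z => Var z.+1) (s x)) p) t
  = subst (fun x => if x == n then t else s x) p.
Proof.
rewrite /inst subst_comp; congr subst; apply: funext => x.
by case: eqP => // _; rewrite tsubst_comp -[RHS]tsubst_Var.
Qed.

(** [PLeibniz] replaces a single term, so the simultaneous replacement is made one variable at a
    time, from the highest down; [inst_shift] supplies the formula with a hole. *)
Lemma Th_subst_eq s s' p n : (forall x, x < n -> Th (Eq (s x) (s' x))) -> (forall x, n <= x -> s x = s' x) ->
  Th (subst s p) -> Th (subst s' p).
Proof.
elim: n s => [|n IH] s Heq Hs H; first by rewrite -(_ : s = s') //; apply: funext => x; apply: Hs.
apply: (IH (fun x => if x == n then s' n else s x)) => [x Hx|x Hx|].
- by case: eqP => [->|_]; [apply: Th_refl | apply: Heq; apply: ltnW].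
- by case: eqP => [->//|/eqP Hn]; apply: Hs; rewrite ltn_neqAle Hx andbT eq_sym.
rewrite -inst_shift.
apply: Th_imp2 (Heq n (ltnSn n)) H => G H1 H2.
apply: PLeibniz H1 _; rewrite inst_shift (_ : (fun x => _) = s) //.
by apply: funext => x; case: eqP => [->|].
Qed.

Definition argn n (a : 'I_n -> term L) (x : nat) : term L := if insub x is Some i then a i else Var 0.

Lemma argnE n (a : 'I_n -> term L) (i : 'I_n) : argn a i = a i.
Proof. by rewrite /argn valK. Qed.

Definition tm_fun (f : fsym L) (a : 'I_(far f) -> term L) : term L := Fun (finfun a).
Definition tm_rel (r : rsym L) (a : 'I_(rar r) -> term L) : Prop := Th (Rel (finfun a)).
Definition tm_eq t u : Prop := Th (Eq t u).

Lemma tm_sym t u : tm_eq t u -> tm_eq u t.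
Proof.
move=> H; have := @Th_subst_eq (fun x => if x is 0 then t else t) (fun x => if x is 0 then u else t) (Eq (Var 0) (Var 1)) 1.
by apply=> [[]|[]|] //; apply: Th_refl.
Qed.

Lemma tm_trans t u v : tm_eq t u -> tm_eq u v -> tm_eq t v.
Proof.
move=> H H'; have := @Th_subst_eq (fun x => if x is 0 then u else t) (fun x => if x is 0 then v else t) (Eq (Var 1) (Var 0)) 1.
by apply=> [[]|[]|].
Qed.

Lemma tm_fun_cong f a b : (forall i, tm_eq (a i) (b i)) -> tm_eq (@tm_fun f a) (@tm_fun f b).
Proof.
move=> H; set n := far f.
(* In the equation [p] between two applications of [f], the left arguments stay at [a] while the
   right ones are moved from [a] to [b], starting from reflexivity. *)
pose s c x := if x < n then argn a x else argn (c : 'I_n -> term L) (x - n).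
pose p : form L := Eq (@Fun L f [ffun i : 'I_n => Var i]) (@Fun L f [ffun i : 'I_n => Var (n + i)]).
have Hp c : subst (s c) p = Eq (tm_fun a) (tm_fun c).
  rewrite /p /=; congr Eq; congr Fun; apply/ffunP => i; rewrite !ffunE /= /s.
    by rewrite ltn_ord argnE.
  by rewrite ltnNge leq_addr /= addKn argnE.
rewrite /tm_eq -Hp; apply: (@Th_subst_eq (s a) (s b) p (n + n)) => [x Hx|x Hx|]; last by rewrite Hp; apply: Th_refl.
  rewrite /s; case: ltnP => Hn; first exact: Th_refl.
  have Hxn : x - n < n by rewrite ltn_subLR.
  by have := H (Ordinal Hxn); rewrite -!argnE.
have Hn : n <= x - n by rewrite leq_subRL // (leq_trans (leq_addr _ _) Hx).
rewrite /s ltnNge (leq_trans (leq_addr _ _) Hx) /= /argn !insubN -?leqNgt //.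
Qed.

Lemma tm_rel_cong r a b : (forall i, tm_eq (a i) (b i)) -> @tm_rel r a -> @tm_rel r b.
Proof.
move=> H; set n := rar r.
pose p : form L := @Rel L r [ffun i : 'I_n => Var i].
have Hp c : subst (argn (c : 'I_n -> term L)) p = Rel (finfun c).
  by rewrite /p /=; congr Rel; apply/ffunP => i; rewrite !ffunE /= argnE.
rewrite /tm_rel -!Hp; apply: (@Th_subst_eq _ _ _ n) => [x Hx|x Hx].
  by have := H (Ordinal Hx); rewrite -!argnE.
by rewrite /argn !insubN -?leqNgt.
Qed.

Definition tm_model : model L :=
  Model (Var 0) Th_refl tm_sym tm_trans tm_fun_cong tm_rel_cong.

Lemma tm_eval s t : @eval L tm_model s t = tsubst s t.
Proof. by []. Qed.

Lemma tm_sat s p : @sat L tm_model s p <-> Th (subst s p).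
Proof.
elim: p s => [|t u|r a|p IHp q IHq|p IHp] s.
- by split=> // /Th_con.
- by rewrite /= !tm_eval.
- by [].
- rewrite /= IHp IHq; split=> [H|]; last exact: Th_mp.
  case: (Th_max (subst s p)) => [/H|]; apply: Th_imp1 => G HG.
    by apply/PImpI/(prf_weak HG) => r; right.
  apply: PImpI; apply: prf_exfalso; apply: PImpE (PAx _); last by left.
  by apply: (prf_weak HG) => r; right.
- have E t : inst (subst (up s) p) t = subst (t .: s) p.
    rewrite /inst subst_comp; congr subst; apply: funext => -[|x] //=.
    by rewrite tsubst_comp -[RHS]tsubst_Var.
  split=> /= [H|H t]; last by apply/IHp; rewrite -E; apply: Th_imp1 H => G; apply: PAllE.
  set q := subst (up s) p.
  have [v Hv] : exists v, Th (henkin q v).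
    by eexists; apply: Th_incl; right; exists (code q).+1; rewrite /= codeK; left.
  by apply: Th_mp Hv _; rewrite E; apply/IHp/H.
Qed.

Lemma tm_modelP q : X q -> @sat L tm_model Var q.
Proof. by move=> Hq; apply/tm_sat; rewrite subst_Var; apply: Th_incl; left. Qed.

End Completeness.

Lemma completeness (L : signature) (X : form L -> Prop) p :
  (forall q, X q -> sentence q) -> sentence p ->
  (forall (M : model L) (e : nat -> M), (forall q, X q -> sat e q) -> sat e p) -> proves X p.
Proof.
move=> HX Hp H; apply: NNPP => Hn.
pose X' q := X q \/ q = Neg p.
have HX' q : X' q -> sentence q by case=> [/HX // | ->]; rewrite /sentence /= andbT.
have Hc : con X' [::].
  move=> [G HG HB]; apply: Hn.
  have : proves (fun q => X q \/ List.In q [:: Neg p]) Bot.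
    by exists G => // q /HG [[|->]|[]]; [left | right; left].
  case/proves_imp => G' HG' Hp'; exists G' => [q /HG' [//|[]]|].
  by apply: PRaa; apply: PImpE (prf_weak1 _ Hp') (PAx _); left.
have := @tm_modelP _ _ HX' Hc (Neg p) (or_intror erefl); apply.
by apply: H => q Hq; apply: (@tm_modelP _ _ HX' Hc); left.
Qed.

Definition entails (L : signature) (X : theory L) (p : form L) : Prop :=
  forall (M : model L) (e : nat -> M), (forall q, axiom X q -> sat e q) -> sat e p.

Lemma is_theoremP (L : signature) (X : theory L) p : sentence p -> is_theorem X p <-> entails X p.
Proof.
move=> Hp; split=> [[_ /proves_sound //] | H]; split=> //.
by apply: completeness => // q /axiom_sentence.
Qed.

(** * Semantics of translations *)

Fixpoint tsym_in (L : signature) (F : fsym L -> Prop) (t : term L) : Prop :=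
  match t with
  | Var _ => True
  | Fun f a => F f /\ forall i, tsym_in F (a i)
  end.

Fixpoint sym_in (L : signature) (F : fsym L -> Prop) (R : rsym L -> Prop) (p : form L) : Prop :=
  match p with
  | Bot => True
  | Eq t u => tsym_in F t /\ tsym_in F u
  | Rel r a => R r /\ forall i, tsym_in F (a i)
  | Imp p q => sym_in F R p /\ sym_in F R q
  | All p => sym_in F R p
  end.

Section TranslationSemantics.
Variables (L L' : signature) (tau : translation L L') (A : model L').
Local Notation d := (tdim tau).
Local Notation P := (tpar tau).
Local Notation vblock := (nat -> A).
Local Notation venv := (nat -> nat -> A).

(* [p], a formula about [n] objects, holds of the objects [b] with the
   parameters [w]. *)
Definition tsat (n : nat) (p : form L') (b : venv) (w : vblock) : Prop :=
  sat (fun v => if v < n * d then b (v %/ d) (v %% d) else w (v - n * d)) p.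

Lemma sat_tapply e n p b w :
  sat e (tapply tau n p b w) <-> tsat n p (fun i j => e (b i j)) (fun k => e (w k)).
Proof.
rewrite /tapply sat_ren /tsat; apply: iff_refl_eq.
by congr sat; apply: funext => v; case: ifP.
Qed.


Lemma tsat_ext n p b b' w : (forall i j, i < n -> j < d -> b i j = b' i j) ->
  tsat n p b w <-> tsat n p b' w.
Proof.
move=> H; apply: iff_refl_eq; rewrite /tsat; congr sat; apply: funext => v.
case: ifP => // Hv; apply: H; last by rewrite ltn_mod tdim_gt0.
by rewrite ltn_divLR ?tdim_gt0.
Qed.

Lemma tsat_imp n p b b' w : tsat n p b w -> (forall i j, i < n -> j < d -> b i j = b' i j) -> tsat n p b' w.
Proof. by move=> Hp H; apply: (tsat_ext _ _ H).1. Qed.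

Section AtParams.
Variable w : vblock.

Definition tdomain (b : vblock) : Prop := tsat 1 (tdom tau) (fun=> b) w.
Definition tequal (b b' : vblock) : Prop := tsat 2 (teq tau) (fun i => if i is 0 then b else b') w.
Definition trelation (r : rsym L) (a : venv) : Prop := tsat (rar r) (trel tau r) a w.
Definition tgraph (f : fsym L) (a : venv) (y : vblock) : Prop :=
  tsat (far f).+1 (tfun tau f) (fun i => if i < far f then a i else y) w.

(** Blocks are total functions of which only the first [d] components have a meaning. *)
Definition blk_eq (b b' : vblock) := forall j, j < d -> b j = b' j.

Lemma blk_eq_sym b b' : blk_eq b b' -> blk_eq b' b.
Proof. by move=> H j Hj; rewrite H. Qed.

Lemma tdomain_ext b b' : blk_eq b b' -> tdomain b <-> tdomain b'.
Proof. by move=> H; apply: tsat_ext => i j _; apply: H. Qed.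

Lemma tequal_ext b b' c c' : blk_eq b b' -> blk_eq c c' -> tequal b c <-> tequal b' c'.
Proof. by move=> H H'; apply: tsat_ext => -[|i] j _; [apply: H | apply: H']. Qed.

Definition argblk n (a : 'I_n -> term L) (E : venv) (z : 'I_n -> vblock) (y : vblock) : venv :=
  fun x => if insub x is Some i then if a i is Var v then E v else z i else y.

(** The semantic counterpart of [unnest]: a family of blocks replaces the quantifier prefix. From
    here on translations are studied through [rsat], free of variable bookkeeping. *)
Definition runnest (n m : nat) (a : 'I_n -> term L) (rd : 'I_n -> venv -> vblock -> Prop)
    (p : form L') (E : venv) (y : vblock) : Prop :=
  exists z : 'I_n -> vblock,
    (forall i, ~~ is_var (a i) -> tdomain (z i) /\ rd i E (z i)) /\
    tsat m p (argblk a E z y) w.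

Fixpoint rden (t : term L) (E : venv) (y : vblock) {struct t} : Prop :=
  match t with
  | Var x => tequal (E x) y
  | Fun f a => runnest (far f).+1 a (fun i => rden (a i)) (tfun tau f) E y
  end.

Fixpoint rsat (p : form L) (E : venv) {struct p} : Prop :=
  match p with
  | Bot => False
  | Eq t u => runnest 2 (pair_args t u) (fun i => rden (pair_args t u i)) (teq tau) E (fun=> point A)
  | Rel r a => runnest (rar r) a (fun i => rden (a i)) (trel tau r) E (fun=> point A)
  | Imp p q => rsat p E -> rsat q E
  | All p => forall b, tdomain b -> rsat p (b .: E)
  end.

Lemma argblk_ord n a E z y (i : 'I_n) : argblk a E z y i = if a i is Var v then E v else z i.
Proof. by rewrite /argblk valK. Qed.

Lemma argblk_last n a E z y : argblk (a : 'I_n -> term L) E z y n = y.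
Proof. by rewrite /argblk insubN // ltnn. Qed.

Lemma runnest_ext n0 n m (a : 'I_n -> term L) rd p E E' y y' :
  (forall i z, rd i E z -> rd i E' z) -> (forall i, tbounded n0 (a i)) ->
  (forall x, x < n0 -> blk_eq (E x) (E' x)) -> (n < m -> blk_eq y y') ->
  runnest m a rd p E y -> runnest m a rd p E' y'.
Proof.
move=> Hrd Ha HE Hy [z [Hz Hp]]; exists z; split=> [i /Hz [Hd /Hrd] // |].
apply: tsat_imp Hp _ => x j Hx Hj; rewrite /argblk; case: insubP => [i _ Hi|Hn].
  by case Ea: (a i) => [v|//]; rewrite HE //; have := Ha i; rewrite Ea.
by rewrite Hy //; apply: leq_ltn_trans Hx; rewrite leqNgt.
Qed.

Lemma rden_ext n t E E' y y' : tbounded n t -> (forall x, x < n -> blk_eq (E x) (E' x)) -> blk_eq y y' ->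
  rden t E y -> rden t E' y'.
Proof.
move=> Ht HE; elim/term_ind': t y y' Ht => [x|f a IH] y y' /= Ht Hy.
  by apply: (tequal_ext _ _).1 => //; apply: HE.
move/all_codomP in Ht.
by apply: (runnest_ext (n0 := n)) => // i z; apply: IH.
Qed.

Lemma rsat_ext n p E E' : bounded n p -> (forall x, x < n -> blk_eq (E x) (E' x)) -> rsat p E <-> rsat p E'.
Proof.
suff H : forall E E' : venv, bounded n p -> (forall x, x < n -> blk_eq (E x) (E' x)) -> rsat p E -> rsat p E'.
  by move=> Hp HE; split; apply: H => // x Hx; apply/blk_eq_sym/HE.
move=> {}E {}E'; suff : bounded n p -> (forall x, x < n -> blk_eq (E x) (E' x)) -> rsat p E <-> rsat p E'.
  by move=> H Hp HE; rewrite H.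
have Ha m t u : tbounded m t && tbounded m u -> forall i, tbounded m (pair_args t u i).
  by case/andP => Ht Hu i; rewrite /pair_args; case: ifP.
elim: p n E E' => //= [t u|r a|p IHp q IHq|p IHp] n E E' Hp HE.
- have HE' x : x < n -> blk_eq (E' x) (E x) by move=> Hx; apply/blk_eq_sym/HE.
  by split; apply: (runnest_ext (n0 := n)) => //;
    [move=> i z; apply: rden_ext HE _ => //; apply: Ha | exact: Ha
    |move=> i z; apply: rden_ext HE' _ => //; apply: Ha | exact: Ha].
- have HE' x : x < n -> blk_eq (E' x) (E x) by move=> Hx; apply/blk_eq_sym/HE.
  move/all_codomP in Hp.
  by split; apply: (runnest_ext (n0 := n)) => // i z; [apply: rden_ext HE _ | apply: rden_ext HE' _].
- by case/andP: Hp => Hp Hq; rewrite (IHp n _ E') // (IHq n _ E').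
- have H b : forall x, x < n.+1 -> blk_eq ((b .: E) x) ((b .: E') x) by case=> //= x; apply: HE.
  by split=> Hb b /Hb; rewrite (IHp _ _ _ Hp (H b)).
Qed.

Lemma bcons_lt (T : Type) k (b e : nat -> T) v : v < k -> bcons k b e v = b v.
Proof. by rewrite /bcons => ->. Qed.

Lemma bcons_add (T : Type) k (b e : nat -> T) v : bcons k b e (k + v) = e v.
Proof. by rewrite /bcons ltnNge leq_addr /= addKn. Qed.

Lemma sat_Ands_map (M : model L') (e : nat -> M) (T : eqType) (g : T -> form L') s p :
  sat e (Ands [seq g i | i <- s] p) <-> (forall i, i \in s -> sat e (g i)) /\ sat e p.
Proof.
rewrite sat_Ands; split=> -[H Hp]; split=> //.
  by move=> i /In_mem Hi; apply: H; apply/In_map; exists i.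
by move=> q /In_map [i /In_mem Hi ->]; apply: H.
Qed.

Lemma sat_unnest n m (a : 'I_n -> term L) den rd p e eb w0 y :
  (forall i e eb w0 y, (fun k => e (w0 k)) = w ->
     sat e (den i eb w0 y) <-> rd i (fun x j => e (eb x j)) (fun j => e (y j))) ->
  (forall i E y y', blk_eq y y' -> rd i E y -> rd i E y') -> (fun k => e (w0 k)) = w ->
  sat e (unnest tau m a den p eb w0 y) <-> runnest m a rd p (fun x j => e (eb x j)) (fun j => e (y j)).
Proof.
move=> Hden Hrd Hw; rewrite /unnest; set nv := [seq i <- _ | _]; set k := size nv * d.
have Hnv i : (i \in nv) = ~~ is_var (a i) by rewrite mem_filter mem_enum andbT.
pose zz blk i : vblock := fun j => bcons k blk e (bnth tau (index i nv) j).
have Hw' blk : (fun k0 => bcons k blk e (bshift k w0 k0)) = w.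
  by rewrite -Hw; apply: funext => x; rewrite /bshift bcons_add.
have HE blk : (fun x j => bcons k blk e (eshift k eb x j)) = (fun x j => e (eb x j)).
  by do 2!apply: funext => ?; rewrite /eshift /bshift bcons_add.
have Hsat blk : sat (bcons k blk e) (Ands [seq And (tapply tau 1 (tdom tau) (fun=> bnth tau (index i nv)) (bshift k w0))
      (den i (eshift k eb) (bshift k w0) (bnth tau (index i nv))) | i <- nv]
    (tapply tau m p (fun x => if insub x is Some i then if a i is Var v then eshift k eb v else bnth tau (index i nv)
        else bshift k y) (bshift k w0))) <->
    (forall i, ~~ is_var (a i) -> tdomain (zz blk i) /\ rd i (fun x j => e (eb x j)) (zz blk i)) /\
    tsat m p (argblk a (fun x j => e (eb x j)) (zz blk) (fun j => e (y j))) w.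
  rewrite sat_Ands_map; apply: and_iff_congr.
    split=> H i; [rewrite -Hnv | rewrite Hnv] => /H.
      by rewrite sat_And sat_tapply Hden // Hw' HE.
    by rewrite sat_And sat_tapply Hden // Hw' HE.
  rewrite sat_tapply Hw'; apply: tsat_ext => x j _ _; rewrite /argblk; case: insubP => [i _ _|_].
    by case: (a i) => [v|f b] //; rewrite /eshift /bshift bcons_add.
  by rewrite /bshift bcons_add.
rewrite sat_Exs; split=> [[blk /Hsat H] | [z [Hz Hp]]]; first by exists (zz blk).
(* With only variables as arguments nothing is quantified, and there is no index to serve as the
   default of [nth] below. *)
case: (posnP (size nv)) => Hs.
  have Hv i : is_var (a i) by apply: contraT; rewrite -Hnv (size0nil Hs).
  exists e; apply/Hsat; split=> [i|]; first by rewrite Hv.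
  apply: tsat_imp Hp _ => x j _ _; rewrite /argblk; case: insubP => // i _ _.
  by have := Hv i; case: (a i).
have [i0 _] : exists i0, i0 \in nv by case: (nv) Hs => // i0 s _; exists i0; rewrite mem_head.
(* The chosen blocks are laid end to end in the order of [nv], which is where [bnth] at [index i nv]
   reads them. *)
pose blk v := z (nth i0 nv (v %/ d)) (v %% d).
have Hblk i : i \in nv -> blk_eq (z i) (zz blk i).
  move=> Hi j Hj; rewrite /zz /bnth bcons_lt; last first.
    rewrite /k; apply: (@leq_trans ((index i nv).+1 * d)); first by rewrite mulSn addnC ltn_add2r.
    by rewrite leq_mul2r index_mem Hi orbT.
  by rewrite /blk divnMDl ?tdim_gt0 // (divn_small Hj) addn0 nth_index // modnMDl modn_small.
exists blk; apply/Hsat; split=> [i|].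
  rewrite -Hnv => Hi; rewrite -(tdomain_ext (Hblk i Hi)).
  rewrite Hnv in Hi; case: (Hz i Hi) => Hd Hr; split=> //.
  by apply: Hrd Hr; apply: Hblk; rewrite Hnv.
apply: tsat_imp Hp _ => x j _ Hj; rewrite /argblk; case: insubP => // i _ _.
by have := Hblk i; rewrite Hnv; case: (a i) => //= f b ->.
Qed.

Lemma sat_tden e t eb w0 y : (fun k => e (w0 k)) = w ->
  sat e (tden tau t eb w0 y) <-> rden t (fun x j => e (eb x j)) (fun j => e (y j)).
Proof.
elim/term_ind': t e eb w0 y => [x|f a IH] e eb w0 y Hw /=.
  by rewrite sat_tapply Hw /tequal; apply: tsat_ext => -[].
rewrite (@sat_unnest _ _ _ _ (fun i => rden (a i))) // => i E z z' Hz.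
exact: (rden_ext (tbndP (a i))).
Qed.

Lemma sat_tform e p eb w0 : (fun k => e (w0 k)) = w ->
  sat e (tform tau p eb w0) <-> rsat p (fun x j => e (eb x j)).
Proof.
have Hrd n (a : 'I_n -> term L) i E y y' : blk_eq y y' -> rden (a i) E y -> rden (a i) E y'.
  by move=> Hy; apply: (rden_ext (tbndP (a i))).
(* When there are as many objects as arguments the final block is never read, so the dummy blocks of
   [tform] and of [rsat] need not agree. *)
have Hy n (a : 'I_n -> term L) rd q E y y' : runnest n a rd q E y <-> runnest n a rd q E y'.
  by split=> -[z [Hz Hq]]; exists z; split=> //; apply: tsat_imp Hq _ => x j Hx _;
    rewrite /argblk; case: insubP => //; rewrite Hx.
elim: p e eb w0 => //= [t u|r a|p IHp q IHq|p IHp] e eb w0 Hw.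
- rewrite (@sat_unnest _ _ _ _ (fun i => rden (pair_args t u i))) // => [i *|i E y y']; last exact: Hrd.
  exact: sat_tden.
- rewrite (@sat_unnest _ _ _ _ (fun i => rden (a i))) // => [i *|i E y y']; last exact: Hrd.
  exact: sat_tden.
- by rewrite IHp // IHq.
- rewrite sat_Alls /=.
  have Hw' blk : (fun k0 => bcons d blk e (bshift d w0 k0)) = w.
    by rewrite -Hw; apply: funext => x; rewrite /bshift bcons_add.
  have Hb blk : blk_eq (fun j => bcons d blk e (bnth tau 0 j)) blk by move=> j Hj; rewrite /bnth mul0n bcons_lt.
  have HE blk x : blk_eq (fun j => bcons d blk e (econs tau eb x j)) ((blk .: (fun x j => e (eb x j))) x).
    by move=> j Hj; case: x => [|x] /=; [rewrite -[RHS]Hb | rewrite /bshift bcons_add].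
  have E blk : sat (bcons d blk e) (tapply tau 1 (tdom tau) (fun=> bnth tau 0) (bshift d w0)) <-> tdomain blk.
    by rewrite sat_tapply Hw'; apply: tsat_ext => _ j _; apply: Hb.
  have E' blk : sat (bcons d blk e) (tform tau p (econs tau eb) (bshift d w0)) <-> rsat p (blk .: (fun x j => e (eb x j))).
    by rewrite IHp //; apply: (rsat_ext (bndP p)) => x _; apply: HE.
  by split=> H blk; move: (H blk); rewrite E E'.
Qed.


(* The identity laws make the objects of the translation into a model; they are
   required only for the symbols in [F] and [R]. *)
Record laws (F : fsym L -> Prop) (R : rsym L -> Prop) : Prop := Laws {
  law_point : exists b, tdomain b;
  law_refl : forall b, tdomain b -> tequal b b;
  law_eq : forall a b a' b', tdomain a -> tdomain b -> tdomain a' -> tdomain b' ->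
    tequal a a' -> tequal b b' -> tequal a b -> tequal a' b';
  law_rel : forall r, R r -> forall a a', (forall i, i < rar r -> tdomain (a i)) ->
    (forall i, i < rar r -> tdomain (a' i)) -> (forall i, i < rar r -> tequal (a i) (a' i)) ->
    trelation r a -> trelation r a';
  law_fun : forall f, F f -> forall a a' y y', (forall i, i < far f -> tdomain (a i)) ->
    (forall i, i < far f -> tdomain (a' i)) -> tdomain y -> tdomain y' ->
    (forall i, i < far f -> tequal (a i) (a' i)) ->
    tgraph f a y -> tgraph f a' y' -> tequal y y';
  law_total : forall f, F f -> forall a, (forall i, i < far f -> tdomain (a i)) ->
    exists2 y, tdomain y & tgraph f a y
}.

(** Blocks are related to an arbitrary model, not only to the one built from them. This allows one
    fixed [N] to be seen through a copy of the parameters, or through two translations that agree on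
    the listed symbols. *)
Record represents (F : fsym L -> Prop) (R : rsym L -> Prop) (N : model L) (v : vblock -> N) : Prop := Represents {
  rep_surj : forall x, exists2 b, tdomain b & v b = x;
  rep_eq : forall b b', tdomain b -> tdomain b' -> (tequal b b' <-> meq (v b) (v b'));
  rep_rel : forall r, R r -> forall a, (forall i, i < rar r -> tdomain (a i)) ->
    (trelation r a <-> mrel r (fun i => v (a i)));
  rep_fun : forall f, F f -> forall a y, (forall i, i < far f -> tdomain (a i)) -> tdomain y ->
    tgraph f a y -> meq (mfun f (fun i => v (a i))) (v y);
  rep_total : forall f, F f -> forall a, (forall i, i < far f -> tdomain (a i)) ->
    exists2 y, tdomain y & tgraph f a y
}.

(** * The inner model of a translation *)

Section InnerModel.
Variables (F : fsym L -> Prop) (R : rsym L -> Prop).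
Hypothesis HL : laws F R.

Lemma law_sym b b' : tdomain b -> tdomain b' -> tequal b b' -> tequal b' b.
Proof. by move=> Hb Hb' H; apply: (law_eq HL (a := b) (b := b)) => //; apply: (law_refl HL). Qed.

Lemma law_trans a b c : tdomain a -> tdomain b -> tdomain c -> tequal a b -> tequal b c -> tequal a c.
Proof. by move=> Ha Hb Hc H H'; apply: (law_eq HL (a := a) (b := b)) => //; apply: (law_refl HL). Qed.

Definition inner_type : Type := {b : vblock | tdomain b}.

Definition inner_point : inner_type :=
  let H := constructive_indefinite_description _ (law_point HL) in exist _ (proj1_sig H) (proj2_sig H).

Definition inner_eq (x y : inner_type) : Prop := tequal (proj1_sig x) (proj1_sig y).

Definition inner_args n (u : 'I_n -> inner_type) (i : nat) : vblock :=
  proj1_sig (if insub i is Some k then u k else inner_point).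

Lemma inner_argsE n (u : 'I_n -> inner_type) (i : 'I_n) : inner_args u i = proj1_sig (u i).
Proof. by rewrite /inner_args valK. Qed.

Lemma inner_args_dom n (u : 'I_n -> inner_type) i : tdomain (inner_args u i).
Proof. exact: proj2_sig. Qed.

(** Relations outside [R] are made empty, as their formulas need not respect the interpreted
    equality. *)
Definition inner_rel (r : rsym L) (u : 'I_(rar r) -> inner_type) : Prop := R r /\ trelation r (inner_args u).

Lemma inner_fun_ex (f : fsym L) (u : 'I_(far f) -> inner_type) :
  exists y : inner_type, F f -> tgraph f (inner_args u) (proj1_sig y).
Proof.
case: (classic (F f)) => Hf; last by exists inner_point.
have [|y Hy Hg] := law_total HL Hf (a := inner_args u); first by move=> i _; apply: inner_args_dom.
by exists (exist _ y Hy).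
Qed.

(* Junk value for the symbols outside [F]. *)
Definition inner_fun (f : fsym L) (u : 'I_(far f) -> inner_type) : inner_type :=
  if excluded_middle_informative (F f) is left _
  then proj1_sig (constructive_indefinite_description _ (inner_fun_ex u)) else inner_point.

Lemma inner_funP f (u : 'I_(far f) -> inner_type) : F f -> tgraph f (inner_args u) (proj1_sig (inner_fun u)).
Proof.
move=> Hf; rewrite /inner_fun; case: excluded_middle_informative => // _.
exact: (proj2_sig (constructive_indefinite_description _ (inner_fun_ex u)) Hf).
Qed.

Lemma inner_refl x : inner_eq x x.
Proof. exact: (law_refl HL (proj2_sig x)). Qed.

Lemma inner_sym x y : inner_eq x y -> inner_eq y x.
Proof. by apply: law_sym; apply: proj2_sig. Qed.

Lemma inner_trans x y z : inner_eq x y -> inner_eq y z -> inner_eq x z.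
Proof. by apply: law_trans; apply: proj2_sig. Qed.

Lemma inner_args_eq n (u u' : 'I_n -> inner_type) : (forall i, inner_eq (u i) (u' i)) ->
  forall i, i < n -> tequal (inner_args u i) (inner_args u' i).
Proof. by move=> H i Hi; have := H (Ordinal Hi); rewrite /inner_eq -!inner_argsE. Qed.

Lemma inner_fun_cong f u u' : (forall i, inner_eq (u i) (u' i)) -> inner_eq (@inner_fun f u) (@inner_fun f u').
Proof.
move=> H; case: (classic (F f)) => Hf; last first.
  by rewrite /inner_fun; case: excluded_middle_informative => // _; apply: inner_refl.
apply: (law_fun HL Hf (a := inner_args u) (a' := inner_args u')); try exact: proj2_sig.
- by move=> i _; apply: inner_args_dom.
- by move=> i _; apply: inner_args_dom.
- exact: inner_args_eq.
- exact: inner_funP.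
- exact: inner_funP.
Qed.

Lemma inner_rel_cong r u u' : (forall i, inner_eq (u i) (u' i)) -> @inner_rel r u -> @inner_rel r u'.
Proof.
move=> H [Hr Hu]; split=> //; apply: (law_rel HL Hr (a := inner_args u)) => //.
- by move=> i _; apply: inner_args_dom.
- by move=> i _; apply: inner_args_dom.
- exact: inner_args_eq.
Qed.

Definition inner_model : model L :=
  Model inner_point inner_refl inner_sym inner_trans inner_fun_cong inner_rel_cong.

Definition inner_val (b : vblock) : inner_model :=
  if excluded_middle_informative (tdomain b) is left H then exist _ b H else inner_point.

Lemma inner_valK b : tdomain b -> proj1_sig (inner_val b) = b.
Proof. by move=> Hb; rewrite /inner_val; case: excluded_middle_informative. Qed.

Lemma inner_represents : represents F R inner_val.
Proof.
have Hargs n (a : venv) : (forall i, i < n -> tdomain (a i)) ->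
    forall i, i < n -> inner_args (fun i : 'I_n => inner_val (a i)) i = a i.
  move=> Ha i Hi; have := inner_argsE (fun i : 'I_n => inner_val (a i)) (Ordinal Hi) => /= ->.
  by rewrite inner_valK //; apply: Ha.
split.
- move=> [b Hb]; exists b => //; rewrite /inner_val; case: excluded_middle_informative => // Hb'.
  by rewrite (proof_irrelevance _ Hb Hb').
- by move=> b b' Hb Hb'; rewrite /= /inner_eq !inner_valK.
- move=> r Hr a Ha; rewrite /= /inner_rel.
  have -> : trelation r a <-> trelation r (inner_args (fun i : 'I_(rar r) => inner_val (a i))).
    by apply: tsat_ext => i j Hi _; rewrite Hargs.
  by split=> [|[]].
- move=> f Hf a y Ha Hy Hg; rewrite /= /inner_eq inner_valK //.
  have Hi := inner_funP (fun i : 'I_(far f) => inner_val (a i)) Hf.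
  apply: (law_fun HL Hf (a := a) (a' := a) _ _ _ _ _ _ Hg) => //; first exact: proj2_sig.
    by move=> i Hi'; apply/(law_refl HL)/Ha.
  apply: tsat_imp Hi _ => i j Hi' _; case: ltnP => // Hlt; by rewrite Hargs.
- exact: law_total HL.
Qed.

End InnerModel.

Section Represented.
Variables (F : fsym L -> Prop) (R : rsym L -> Prop) (N : model L) (v : vblock -> N).
Hypothesis HR : represents F R v.

Lemma argblk_dom n0 n (a : 'I_n -> term L) E z : (forall i, tbounded n0 (a i)) ->
  (forall x, x < n0 -> tdomain (E x)) -> (forall i, ~~ is_var (a i) -> tdomain (z i)) ->
  forall y i, i < n -> tdomain (argblk a E z y i).
Proof.
move=> Ha HE Hz y i Hi; rewrite (argblk_ord a E z y (Ordinal Hi)).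
have := Ha (Ordinal Hi); have := Hz (Ordinal Hi).
by case: (a _) => [x|f b] /= H Hb; [apply: HE | apply: H].
Qed.

Lemma fin_choice n (T : Type) (Q : 'I_n -> T -> Prop) : (forall i, exists x, Q i x) -> exists f, forall i, Q i (f i).
Proof.
by move=> H; exists (fun i => proj1_sig (constructive_indefinite_description _ (H i))) => i; case: constructive_indefinite_description.
Qed.

Lemma tgraph_argblk f (a : 'I_(far f) -> term L) E z y :
  tsat (far f).+1 (tfun tau f) (argblk a E z y) w <-> tgraph f (argblk a E z y) y.
Proof.
apply: tsat_ext => i j Hi _; case: ltnP => // Hlt.
by rewrite (_ : i = far f) ?argblk_last //; apply/eqP; rewrite eqn_leq Hlt -ltnS Hi.
Qed.

Section Arguments.
Variables (n0 n : nat) (a : 'I_n -> term L) (E : venv).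
Hypotheses (Ha : forall i, tbounded n0 (a i)) (HE : forall x, x < n0 -> tdomain (E x)).

Lemma argblk_eval z y :
  (forall i, ~~ is_var (a i) -> meq (eval (fun x => v (E x)) (a i)) (v (z i))) ->
  forall i, meq (eval (fun x => v (E x)) (a i)) (v (argblk a E z y i)).
Proof.
move=> Hz i; rewrite argblk_ord; have := Hz i.
by case: (a i) => [x|f b] H /=; [apply: meq_refl | apply: H].
Qed.

End Arguments.

Lemma rden_rep n t E : tbounded n t -> tsym_in F t -> (forall x, x < n -> tdomain (E x)) ->
  (forall y, tdomain y -> rden t E y -> meq (eval (fun x => v (E x)) t) (v y)) /\
  exists2 y, tdomain y & rden t E y.
Proof.
move=> + + HE; elim/term_ind': t => [x|f a IH] /= Ht.
  split=> [y Hy|]; first by move/(rep_eq HR); apply=> //; apply: HE.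
  by exists (E x); [|apply/(rep_eq HR); [| |apply: meq_refl]]; apply: HE.
move/all_codomP in Ht => -[Hf Ha]; split=> [y Hy [z [Hz Hp]] | ].
  have Hdom := argblk_dom (z := z) Ht HE (fun i Hi => proj1 (Hz i Hi)) y.
  move/tgraph_argblk: Hp => /(rep_fun HR Hf Hdom Hy); apply: meq_trans.
  apply: mfun_cong; apply: argblk_eval => i Hi.
  by case: (Hz i Hi) => Hd; apply: (IH i (Ht i) (Ha i)).1.
have [z Hz] : exists z : 'I_(far f) -> vblock, forall i, tdomain (z i) /\ rden (a i) E (z i).
  apply: (@fin_choice _ _ (fun i z => tdomain z /\ rden (a i) E z)) => i; case: (IH i (Ht i) (Ha i)) => _ [z Hz Hz'].
  by exists z.
have [|y Hy Hg] := rep_total HR Hf (a := argblk a E z (E 0)).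
  by apply: (argblk_dom Ht HE) => i _; case: (Hz i).
exists y => //; exists z; split=> [i _|]; first exact: Hz.
apply: tsat_imp Hg _ => i j Hi _; case: ltnP => Hlt.
  by rewrite (argblk_ord a E z (E 0) (Ordinal Hlt)) (argblk_ord a E z y (Ordinal Hlt)).
by rewrite (_ : i = far f) ?argblk_last //; apply/eqP; rewrite eqn_leq Hlt -ltnS Hi.
Qed.

Lemma runnest_rep n0 n (a : 'I_n -> term L) p E y (Q : ('I_n -> N) -> Prop) :
  (forall i, tbounded n0 (a i)) -> (forall i, tsym_in F (a i)) -> (forall x, x < n0 -> tdomain (E x)) ->
  (forall b, (forall i, i < n -> tdomain (b i)) -> tsat n p b w <-> Q (fun i => v (b i))) ->
  (forall u u', (forall i, meq (u i) (u' i)) -> Q u -> Q u') ->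
  runnest n a (fun i => rden (a i)) p E y <-> Q (fun i => eval (fun x => v (E x)) (a i)).
Proof.
move=> Hb Ha HE HQ HQc; split=> [[z [Hz Hp]] | HQe].
  have Hdom := argblk_dom (z := z) Hb HE (fun i Hi => proj1 (Hz i Hi)) y.
  move/(HQ _ Hdom): Hp; apply: HQc => i; apply: meq_sym; apply: argblk_eval => k Hk.
  by case: (Hz k Hk) => Hd; apply: (rden_rep (Hb k) (Ha k) HE).1.
have [z Hz] : exists z : 'I_n -> vblock, forall i, tdomain (z i) /\ rden (a i) E (z i).
  apply: (@fin_choice _ _ (fun i z => tdomain z /\ rden (a i) E z)) => i; case: (rden_rep (Hb i) (Ha i) HE) => _ [z Hz Hz'].
  by exists z.
exists z; split=> [i _|]; first exact: Hz.
apply/HQ; first by apply: (argblk_dom Hb HE) => i _; case: (Hz i).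
apply: HQc HQe => i; apply: argblk_eval => k Hk.
by case: (Hz k) => Hd; apply: (rden_rep (Hb k) (Ha k) HE).1.
Qed.

(** The purpose of [represents]: a translated formula is replaced by the formula itself in an
    ordinary model, where soundness and the arithmetical arguments apply. *)
Lemma rsat_rep n p E : bounded n p -> sym_in F R p -> (forall x, x < n -> tdomain (E x)) ->
  rsat p E <-> sat (fun x => v (E x)) p.
Proof.
elim: p n E => //= [t u|r a|p IHp q IHq|p IHp] n E.
- move=> /andP [Ht Hu] [St Su] HE.
  rewrite (@runnest_rep n _ _ _ _ _ (fun u => meq (u ord0) (u ord_max))) //.
  + by move=> i; rewrite /pair_args; case: ifP.
  + by move=> i; rewrite /pair_args; case: ifP.
  + move=> b Hb; rewrite -(rep_eq HR); [|exact: Hb|exact: Hb].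
    by apply: tsat_ext => -[|[]].
  + move=> c c' Hc H; apply: meq_trans (meq_trans H (Hc ord_max)).
    exact/meq_sym/Hc.
- move=> /all_codomP Ha [Hr Sa] HE.
  rewrite (@runnest_rep n _ _ _ _ _ (fun u => mrel r u)) //; first by move=> b Hb; apply: (rep_rel HR).
  by move=> c c' Hc; apply: mrel_cong.
- by move=> /andP [Hp Hq] [Sp Sq] HE; rewrite (IHp n) // (IHq n).
- move=> Hp Sp HE.
  have E' b : tdomain b -> rsat p (b .: E) <-> sat (v b .: (fun x => v (E x))) p.
    by move=> Hb; rewrite (IHp n.+1) // ?scons_comp // => -[|x] //; apply: HE.
  split=> H => [x|b Hb]; last by apply/E'.
  by case: (rep_surj HR x) => b Hb <-; apply/E' => //; apply: H.
Qed.

End Represented.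
End AtParams.
End TranslationSemantics.

(** * Identity axioms for finitely many symbols *)

Section IdentityList.
Variable L : signature.

Definition id_refl : form L := All (Eq (Var 0) (Var 0)).
Definition id_eq : form L := Alls 4 (Imps (eqs L 2) (Imp (Eq (Var 0) (Var 1)) (Eq (Var 2) (Var 3)))).
Definition id_rel (r : rsym L) : form L := Alls (rar r + rar r) (Imps (eqs L (rar r))
    (Imp (Rel (vars L (rar r) 0)) (Rel (vars L (rar r) (rar r))))).
Definition id_fun (f : fsym L) : form L := Alls (far f + far f) (Imps (eqs L (far f))
    (Eq (Fun (vars L (far f) 0)) (Fun (vars L (far f) (far f))))).
Definition id_total (f : fsym L) : form L := Alls (far f) (Ex (Eq (Fun (vars L (far f) 1)) (Var 0))).
Definition id_unique (f : fsym L) : form L := Alls (far f).+2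
    (Imp (Eq (Fun (vars L (far f) 2)) (Var 0))
    (Imp (Eq (Fun (vars L (far f) 2)) (Var 1)) (Eq (Var 0) (Var 1)))).

(* The logic excludes empty models, so the first sentence is a theorem. *)
Definition id_list (fs : seq (fsym L)) (rs : seq (rsym L)) : seq (form L) :=
  [:: Ex (Eq (Var 0) (Var 0)); id_refl; id_eq] ++ map id_rel rs ++
  map id_fun fs ++ map id_total fs ++ map id_unique fs.

Lemma id_listP fs rs q : List.In q (id_list fs rs) ->
  q = Ex (Eq (Var 0) (Var 0)) \/ id_axiom q.
Proof.
rewrite /id_list => -[<-|[<-|[<-|]]]; [by left | by right; apply: IdRefl | by right; apply: IdEq |].
move=> /List.in_app_iff [/In_map [r _ ->]|]; first by right; apply: IdRel.
move=> /List.in_app_iff [/In_map [f _ ->]|]; first by right; apply: IdFun.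
by move=> /List.in_app_iff [/In_map [f _ ->]|/In_map [f _ ->]]; right; [apply: IdTotal | apply: IdUnique].
Qed.

Lemma id_list_sentence fs rs q : List.In q (id_list fs rs) -> sentence q.
Proof. by move/id_listP => [->|/sentence_id_axiom]. Qed.

Lemma id_axiom_valid q (M : model L) (e : nat -> M) : id_axiom q -> sat e q.
Proof.
have Heqs n (B : nat -> M) (e' : nat -> M) : (forall q, List.In q (eqs L n) -> sat (bcons (n + n) B e') q) ->
    forall i : 'I_n, meq (B i) (B (n + i)).
  move=> H i; have Hi : i < n + n by rewrite (leq_trans (ltn_ord i)) ?leq_addr.
  have /= := H (Eq (Var i) (Var (n + i))); rewrite /bcons ltn_add2l ltn_ord Hi; apply.
  by apply/In_map; exists (i : nat) => //; apply/In_mem; rewrite mem_iota leq0n add0n ltn_ord.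
have Hv n k (B e' : nat -> M) (m : nat) : k + n <= m -> (fun i => eval (bcons m B e') (vars L n k i)) = (fun i => B (k + i)).
  move=> H; apply: funext => i; rewrite ffunE /= /bcons ifT //.
  by apply: leq_trans H; rewrite ltn_add2l.
case=> [||r|f|f|f].
- by move=> x; apply: meq_refl.
- apply/sat_Alls => B; apply/sat_Imps => H /= H'.
  have H1 := Heqs 2 B e H ord0; have H2 := Heqs 2 B e H ord_max.
  exact: meq_trans (meq_sym H1) (meq_trans H' H2).
- apply/sat_Alls => B; apply/sat_Imps => /Heqs H /=; rewrite !Hv ?leq_addr //.
  by apply: mrel_cong => i; apply: H.
- apply/sat_Alls => B; apply/sat_Imps => /Heqs H /=; rewrite !Hv ?leq_addr //.
  by apply: mfun_cong => i; apply: H.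
- by apply/sat_Alls => B; apply/sat_Ex; eexists (eval _ (Fun (vars L (far f) 0))); apply: mfun_cong => i; rewrite !ffunE; apply: meq_refl.
- apply/sat_Alls => B /= H1 H2; exact: meq_trans (meq_sym H1) H2.
Qed.

Lemma id_list_valid fs rs q (M : model L) (e : nat -> M) : List.In q (id_list fs rs) -> sat e q.
Proof.
move/id_listP => [->|/id_axiom_valid //]; apply/sat_Ex; exists (point M); exact: meq_refl.
Qed.

End IdentityList.

Section IdentityLaws.
Variables (L L' : signature) (tau : translation L L') (A : model L') (w : nat -> A).
Local Notation vblock := (nat -> A).
Local Notation D := (tdomain tau w).
Local Notation rsat := (rsat tau w).
Local Notation E0 := (fun _ _ : nat => point A).

Lemma rsat_Alls n p E : rsat (Alls n p) E <->
  forall B : nat -> vblock, (forall i, i < n -> D (B i)) -> rsat p (bcons n B E).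
Proof.
elim: n E => [|n IH] E; first by split=> [H B _ | H]; [|move: (H E)]; rewrite bcons0 //; apply.
split=> /= H.
  move=> B HB; rewrite bconsS; apply: ((IH _).1 (H _ _)); first exact: HB.
  by move=> i Hi; apply: HB; apply: ltnW.
move=> b Hb; apply/IH => B HB; rewrite bcons_scons; apply: H => i Hi; case: ltnP => Hin //; exact: HB.
Qed.

Lemma rsat_Imps ps p E : rsat (Imps ps p) E <-> ((forall q, List.In q ps -> rsat q E) -> rsat p E).
Proof.
elim: ps => /= [|q ps ->]; first by split=> [//|]; apply.
split=> [H Hq | H Hq Hp]; first by apply: H => [|r Hr]; apply: Hq; [left|right].
by apply: H => r [<-|/Hp].
Qed.

Lemma rsat_Ex p E : rsat (Ex p) E <-> exists2 b, D b & rsat p (b .: E).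
Proof.
split=> /= [H | [b Hb Hp] H]; last exact: H Hb Hp.
by apply: NNPP => Hn; apply: H => b Hb Hp; apply: Hn; exists b.
Qed.

Lemma rsat_eq t u E : rsat (Eq t u) E <-> exists z z' : vblock,
  [/\ if t is Var x then z = E x else D z /\ rden tau w t E z,
      if u is Var y then z' = E y else D z' /\ rden tau w u E z' & tequal tau w z z'].
Proof.
have E1 : pair_args t u ord0 = t by [].
have E2 : pair_args t u ord_max = u by [].
split=> [[z [Hz Hp]] | [z [z' [Hz Hz' Hp]]]].
  exists (argblk (pair_args t u) E z (fun=> point A) 0), (argblk (pair_args t u) E z (fun=> point A) 1).
  have -> := argblk_ord (pair_args t u) E z (fun=> point A) ord0.
  have -> := argblk_ord (pair_args t u) E z (fun=> point A) ord_max.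
  have H1 := Hz ord0; have H2 := Hz ord_max; rewrite E1 E2 in H1 H2 *.
  split; first by case: (t) H1 => //= f a; apply.
    by case: (u) H2 => //= f a; apply.
  apply: tsat_imp Hp _ => -[|[|//]] j _ _.
    by have -> := argblk_ord (pair_args t u) E z (fun=> point A) ord0; rewrite E1.
  by have -> := argblk_ord (pair_args t u) E z (fun=> point A) ord_max; rewrite E2.
exists (fun i => if i == ord0 then z else z'); split=> [i|].
  rewrite /pair_args; case: eqP => _; first by case: (t) Hz.
  by case: (u) Hz'.
apply: tsat_imp Hp _ => -[|[|//]] j _ _.
  have -> := argblk_ord (pair_args t u) E (fun i => if i == ord0 then z else z') (fun=> point A) ord0.
  by rewrite E1 eqxx; case: (t) Hz => // x ->.
have -> := argblk_ord (pair_args t u) E (fun i => if i == ord0 then z else z') (fun=> point A) ord_max.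
by rewrite E2; case: (u) Hz' => // x ->.
Qed.

Lemma rsat_eq_var x y E : rsat (Eq (Var x) (Var y)) E <-> tequal tau w (E x) (E y).
Proof. by rewrite rsat_eq; split=> [[z [z' [-> ->]]] //|H]; exists (E x), (E y). Qed.

Lemma runnest_vars n m k p rd E y : n <= m ->
  runnest tau w m (vars L n k) rd p E y <-> tsat tau m p (fun i => if i < n then E (k + i) else y) w.
Proof.
move=> Hm; split=> [[z [_ Hp]] | Hp].
  apply: tsat_imp Hp _ => i j Hi _; rewrite /argblk; case: insubP => [i' Hi' Ei|/negbTE-> //].
  by rewrite ffunE Hi' Ei.
exists (fun=> y); split=> [i|]; first by rewrite ffunE.
apply: tsat_imp Hp _ => i j Hi _; rewrite /argblk; case: insubP => [i' Hi' Ei|/negbTE-> //].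
by rewrite ffunE Hi' Ei.
Qed.

Lemma rsat_rel_vars r k E : rsat (Rel (vars L (rar r) k)) E <-> trelation tau w r (fun i => E (k + i)).
Proof. by rewrite /= runnest_vars //; apply: tsat_ext => i j ->. Qed.

Lemma rden_fun_vars f k E y : rden tau w (Fun (vars L (far f) k)) E y <-> tgraph tau w f (fun i => E (k + i)) y.
Proof. by rewrite /= runnest_vars. Qed.

Lemma tgraph_ext f a a' y : (forall i, i < far f -> a i = a' i) -> tgraph tau w f a y <-> tgraph tau w f a' y.
Proof. by move=> H; apply: tsat_ext => i j _ _; case: ltnP => // Hi; rewrite H. Qed.

(** The only law that is not immediate is [law_fun]. The translated congruence sentence for [f]
    yields some pair of equal values of the two terms; uniqueness of values, established first as
    [Hu], carries this over to the given pair. *)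
Lemma id_list_laws fs rs : (forall q, List.In q (id_list fs rs) -> rsat q E0) ->
  laws tau w (fun f => f \in fs) (fun r => r \in rs).
Proof.
move=> H.
have Hpt : rsat (Ex (Eq (Var 0) (Var 0))) E0 by apply: H; left.
have Hrefl : forall b, D b -> tequal tau w b b.
  have : rsat (id_refl L) E0 by apply: H; right; left.
  by move=> Hr b /Hr /rsat_eq_var.
have Heqs n (a a' : nat -> vblock) : (forall i, i < n -> tequal tau w (a i) (a' i)) ->
    forall q, List.In q (eqs L n) -> rsat q (bcons (n + n) (fun i => if i < n then a i else a' (i - n)) E0).
  move=> Ha q /In_map [i /In_mem]; rewrite mem_iota leq0n add0n /= => Hi ->; apply/rsat_eq_var.
  rewrite /bcons ltn_add2l Hi (leq_trans Hi) ?leq_addr // ltnNge leq_addr /= addKn; exact: Ha.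
have Hdom n (a a' : nat -> vblock) : (forall i, i < n -> D (a i)) -> (forall i, i < n -> D (a' i)) ->
    forall i, i < n + n -> D (if i < n then a i else a' (i - n)).
  by move=> Ha Ha' i Hi; case: ltnP => Hin; [apply: Ha | apply: Ha'; rewrite ltn_subLR].
have Harg n (a a' : nat -> vblock) i : i < n ->
    bcons (n + n) (fun i => if i < n then a i else a' (i - n)) E0 (0 + i) = a i /\
    bcons (n + n) (fun i => if i < n then a i else a' (i - n)) E0 (n + i) = a' i.
  move=> Hi; rewrite /bcons add0n ltn_add2l Hi (leq_trans Hi) ?leq_addr //.
  by rewrite ltnNge leq_addr /= addKn.
have Heq a b a' b' : D a -> D b -> D a' -> D b' ->
    tequal tau w a a' -> tequal tau w b b' -> tequal tau w a b -> tequal tau w a' b'.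
  move=> Da Db Da' Db' H1 H2 H3.
  have : rsat (id_eq L) E0 by apply: H; do 2!right; left.
  move/rsat_Alls/(_ (fun i => if i < 2 then (if i is 0 then a else b) else (if i - 2 is 0 then a' else b'))) => K.
  have /K/rsat_Imps K1 : forall i, i < 4 -> D (if i < 2 then (if i is 0 then a else b) else (if i - 2 is 0 then a' else b')).
    by case=> [|[|[|[|]]]].
  have K2 := K1 (Heqs 2 (fun i => if i is 0 then a else b) (fun i => if i is 0 then a' else b') _).
  apply: ((rsat_eq_var _ _ _).1 (K2 _ ((rsat_eq_var _ _ _).2 H3))).
  by case=> [|[|]].
have Hu f : f \in fs -> forall a y y', (forall i, i < far f -> D (a i)) -> D y -> D y' ->
    tgraph tau w f a y -> tgraph tau w f a y' -> tequal tau w y y'.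
  move=> Hf a y y' Da Dy Dy' Hg Hg'.
  have : rsat (id_unique f) E0.
    apply: H; do 3!right; apply/List.in_app_iff; right; apply/List.in_app_iff; right; apply/List.in_app_iff; right.
    by apply/In_map; exists f => //; apply/In_mem.
  pose B i := match i with 0 => y | 1 => y' | i.+2 => a i end.
  move/rsat_Alls/(_ B) => K.
  have {}K := K (fun i => match i return i < (far f).+2 -> D (B i) with 0 => fun _ => Dy | 1 => fun _ => Dy' | i.+2 => Da i end).
  have HB i : i < far f -> bcons (far f).+2 B E0 (2 + i) = a i by rewrite /bcons !add2n !ltnS => ->.
  apply: ((rsat_eq_var _ _ _).1 (K _ _)).
    apply/rsat_eq; exists y, y; split=> //; last exact: Hrefl.
    by split=> //; apply/rden_fun_vars/(tgraph_ext _ (fun i Hi => HB i Hi)).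
  apply/rsat_eq; exists y', y'; split=> //; last exact: Hrefl.
  by split=> //; apply/rden_fun_vars/(tgraph_ext _ (fun i Hi => HB i Hi)).
split.
- by move/rsat_Ex: Hpt => [b Hb _]; exists b.
- exact: Hrefl.
- exact: Heq.
- move=> r Hr a a' Da Da' Haa Hra.
  have : rsat (id_rel r) E0.
    by apply: H; do 3!right; apply/List.in_app_iff; left; apply/In_map; exists r => //; apply/In_mem.
  move/rsat_Alls/(_ _ (Hdom _ a a' Da Da'))/rsat_Imps/(_ (Heqs _ _ _ Haa)) => /= H'.
  have /rsat_rel_vars H2 := H' ((rsat_rel_vars _ _ _).2 (tsat_imp Hra (fun i j Hi _ => f_equal (fun g => g j) (esym (Harg _ a a' i Hi).1)))).
  by apply: tsat_imp H2 _ => i j Hi _; rewrite (Harg _ a a' i Hi).2.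
- move=> f Hf a a' y y' Da Da' Dy Dy' Haa Hg Hg'.
  have : rsat (id_fun f) E0.
    apply: H; do 3!right; apply/List.in_app_iff; right; apply/List.in_app_iff; left.
    by apply/In_map; exists f => //; apply/In_mem.
  move/rsat_Alls/(_ _ (Hdom _ a a' Da Da'))/rsat_Imps/(_ (Heqs _ _ _ Haa)).
  move/rsat_eq => [z [z' [[Dz /rden_fun_vars Hz] [Dz' /rden_fun_vars Hz'] Hzz]]].
  move/(tgraph_ext _ (fun i Hi => (Harg _ a a' i Hi).1)): Hz => Hz.
  move/(tgraph_ext _ (fun i Hi => (Harg _ a a' i Hi).2)): Hz' => Hz'.
  apply: (Heq z z' y y' Dz Dz' Dy Dy' _ _ Hzz); first exact: (Hu f Hf) Da Dz Dy Hz Hg.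
  exact: (Hu f Hf) Da' Dz' Dy' Hz' Hg'.
- move=> f Hf a Da.
  have : rsat (id_total f) E0.
    apply: H; do 3!right; apply/List.in_app_iff; right; apply/List.in_app_iff; right; apply/List.in_app_iff; left.
    by apply/In_map; exists f => //; apply/In_mem.
  move/rsat_Alls/(_ a Da)/rsat_Ex => [y Dy /rsat_eq [z [_ [[Dz /rden_fun_vars Hz] _ _]]]].
  exists z => //; apply: (tgraph_ext _ _).1 Hz => i Hi.
  by rewrite /= /bcons Hi.
Qed.

End IdentityLaws.

(** * A translation without renaming *)

Definition eqblk (L : signature) (a b len : nat) (q : form L) : form L :=
  Ands [seq Eq (Var (a + j)) (Var (b + j)) | j <- iota 0 len] q.

Lemma sat_eqblk (L : signature) (M : model L) (e : nat -> M) a b len q :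
  sat e (eqblk a b len q) <-> (forall j, j < len -> meq (e (a + j)) (e (b + j))) /\ sat e q.
Proof.
rewrite /eqblk sat_Ands_map; apply: and_iff_congr => //.
split=> H j; first by move=> Hj; apply: H; rewrite mem_iota leq0n add0n.
by rewrite mem_iota leq0n add0n /=; apply: H.
Qed.

Lemma bounded_eqblk (L : signature) m a b len (q : form L) : (forall j, j < len -> a + j < m) ->
  (forall j, j < len -> b + j < m) -> bounded m q -> bounded m (eqblk a b len q).
Proof.
move=> Ha Hb Hq; rewrite bounded_Ands Hq andbT all_map; apply/allP => j.
by rewrite mem_iota leq0n add0n inE => /= Hj; rewrite Ha ?Hb.
Qed.

Section Wtranslate.
Variables (L L' : signature) (tau : translation L L').
Local Notation d := (tdim tau).
Local Notation P := (tpar tau).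

(* Agrees with [tapply] up to provable equivalence, but instead of renaming
   the variables of [p] it quantifies copies of the objects, whose code is
   easier to compute.  A block is given by its first variable. *)
Definition wapply (n : nat) (p : form L') (b : nat -> nat) (w : nat) : form L' :=
  let K := n * d + P in
  Exs K (foldr (fun i q => eqblk (i * d) (K + b i) d q) (eqblk (n * d) (K + w) P p) (iota 0 n)).

Definition wunnest (n m : nat) (a : 'I_n -> term L) (den : 'I_n -> nat -> nat -> nat -> form L')
    (p : form L') (s w y : nat) : form L' :=
  let nv := [seq i <- enum 'I_n | ~~ is_var (a i)] in
  let k := size nv * d in
  let z i := index i nv * d in
  let b x := if insub x is Some i then if a i is Var v then k + s + v * d else z i else k + y in
  Exs k (Ands [seq And (wapply 1 (tdom tau) (fun=> z i) (k + w)) (den i (k + s) (k + w) (z i)) | i <- nv]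
           (wapply m p b (k + w))).

Fixpoint wden (t : term L) (s w y : nat) {struct t} : form L' :=
  match t with
  | Var x => wapply 2 (teq tau) (fun i => if i is 0 then s + x * d else y) w
  | Fun f a => wunnest (far f).+1 a (fun i => wden (a i)) (tfun tau f) s w y
  end.

Fixpoint wtform (p : form L) (w : nat) {struct p} : form L' :=
  match p with
  | Bot => Bot
  | Eq t u => wunnest 2 (pair_args t u) (fun i => wden (pair_args t u i)) (teq tau) 0 w 0
  | Rel r a => wunnest (rar r) a (fun i => wden (a i)) (trel tau r) 0 w 0
  | Imp p q => Imp (wtform p w) (wtform q w)
  | All p => Alls d (Imp (wapply 1 (tdom tau) (fun=> 0) (d + w)) (wtform p (d + w)))
  end.

Definition wtranslate (p : form L) : form L' :=
  And (Exs P (tparam tau)) (Alls P (Imp (tparam tau) (wtform p 0))).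

Lemma sat_foldr_eqblk (M : model L') (e : nat -> M) K b q s :
  sat e (foldr (fun i q => eqblk (i * d) (K + b i) d q) q s) <->
  (forall i, i \in s -> forall j, j < d -> meq (e (i * d + j)) (e (K + b i + j))) /\ sat e q.
Proof.
elim: s => [|i s IH] /=; first by split=> [|[]].
rewrite sat_eqblk IH; split=> [[H1 [H2 H3]] | [H1 H2]].
  by split=> // i'; rewrite inE => /orP [/eqP-> | /H2].
split; first by apply: H1; rewrite mem_head.
by split=> // i' Hi'; apply: H1; rewrite inE Hi' orbT.
Qed.

Lemma sat_wapply (M : model L') (e : nat -> M) n p b w : bounded (n * d + P) p ->
  sat e (wapply n p b w) <-> tsat tau n p (fun i j => e (b i + j)) (fun k => e (w + k)).
Proof.
move=> Hp; rewrite /wapply sat_Exs /tsat; set K := n * d + P; set e2 := (X in _ <-> sat X p).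
have Hlt i j : i < n -> j < d -> i * d + j < n * d.
  move=> Hi Hj; apply: (@leq_trans (i.+1 * d)); first by rewrite mulSn addnC ltn_add2r.
  by rewrite leq_mul2r Hi orbT.
have He2 i j : i < n -> j < d -> e2 (i * d + j) = e (b i + j).
  move=> Hi Hj; rewrite /e2 Hlt // divnMDl ?tdim_gt0 // (divn_small Hj) addn0.
  by rewrite modnMDl modn_small.
have Hw2 k : e2 (n * d + k) = e (w + k) by rewrite /e2 ltnNge leq_addr /= addKn.
split=> [[blk] | H].
  rewrite sat_foldr_eqblk sat_eqblk => -[H1 [H2 H]].
  (* The quantified copies are only congruent to the originals. The intermediate assignment agrees
     with the copies on the variables of [p] and with [e2] elsewhere, so [sat_bounded] and
     [sat_cong] can be applied in succession. *)
  have Hc x : meq (if x < K then bcons K blk e x else e2 x) (e2 x).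
    case: ltnP => Hx; last exact: meq_refl.
    case: (ltnP x (n * d)) => Hn.
      have Hi : x %/ d < n by rewrite ltn_divLR ?tdim_gt0.
      have Hj : x %% d < d by rewrite ltn_mod tdim_gt0.
      have := H1 (x %/ d) _ _ Hj; rewrite mem_iota leq0n add0n Hi => /(_ isT).
      by rewrite -addnA bcons_add -He2 // -divn_eq.
    have := H2 (x - n * d); rewrite ltn_subLR // Hx => /(_ isT).
    by rewrite subnKC // -addnA bcons_add -Hw2 subnKC.
  apply/(sat_cong _ Hc); apply: ((sat_bounded Hp _).1 H) => x Hx.
  by rewrite Hx.
exists e2; rewrite sat_foldr_eqblk sat_eqblk; split=> [i|].
  rewrite mem_iota leq0n add0n /= => Hi j Hj.
  rewrite -addnA bcons_add bcons_lt ?He2 //; first exact: meq_refl.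
  by rewrite (leq_trans (Hlt _ _ Hi Hj)) ?leq_addr.
split=> [k Hk|].
  by rewrite -addnA bcons_add bcons_lt ?ltn_add2l // Hw2; apply: meq_refl.
by apply: ((sat_bounded Hp _).1 H) => x Hx; rewrite bcons_lt.
Qed.

Lemma sat_wunnest (M : model L') (e : nat -> M) n m a wd den p s w y : bounded (m * d + P) p ->
  (forall (e : nat -> M) i s w y, sat e (wd i s w y) <->
     sat e (den i (fun x j => s + x * d + j) (fun k => w + k) (fun j => y + j))) ->
  sat e (@wunnest n m a wd p s w y) <->
  sat e (@unnest L L' tau n m a den p (fun x j => s + x * d + j) (fun k => w + k) (fun j => y + j)).
Proof.
move=> Hp Hden; rewrite /wunnest /unnest; set nv := [seq i <- _ | _]; set k := size nv * d.
have Hs : (fun x j => k + s + x * d + j) = eshift k (fun x j => s + x * d + j).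
  by do 2!apply: funext => ?; rewrite /eshift /bshift !addnA.
have Hw c : (fun j => k + c + j) = bshift k (fun j => c + j).
  by apply: funext => ?; rewrite /bshift addnA.
have Hex (q q' : form L') : (forall blk : nat -> M, sat (bcons k blk e) q <-> sat (bcons k blk e) q') ->
    sat e (Exs k q) <-> sat e (Exs k q').
  by move=> H; rewrite !sat_Exs; split=> -[blk Hb]; exists blk; apply/H.
apply: Hex => blk; rewrite !sat_Ands_map; apply: and_iff_congr.
  have Hi i : sat (bcons k blk e) (And (wapply 1 (tdom tau) (fun=> index i nv * d) (k + w))
        (wd i (k + s) (k + w) (index i nv * d))) <->
      sat (bcons k blk e) (And (tapply tau 1 (tdom tau) (fun=> bnth tau (index i nv)) (bshift k (fun k => w + k)))
        (den i (eshift k (fun x j => s + x * d + j)) (bshift k (fun k => w + k)) (bnth tau (index i nv)))).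
    rewrite !sat_And Hden Hs Hw sat_wapply ?mul1n ?tdomP // sat_tapply /bshift.
    apply: and_iff_congr => //; apply: iff_refl_eq; congr tsat.
    by apply: funext => x; rewrite addnA.
  by split=> H i /H /Hi.
rewrite sat_wapply // sat_tapply.
have -> : (fun k0 => bcons k blk e (k + w + k0)) = (fun k0 => bcons k blk e (bshift k (fun k => w + k) k0)).
  by apply: funext => x; rewrite /bshift addnA.
apply: tsat_ext => x j _ _; case: insubP => [i _ _|_]; last by rewrite /bshift addnA.
by case: (a i) => [v|f c] //; rewrite /eshift /bshift !addnA.
Qed.

Lemma sat_wden (M : model L') (e : nat -> M) t s w y : sat e (wden t s w y) <->
  sat e (tden tau t (fun x j => s + x * d + j) (fun k => w + k) (fun j => y + j)).
Proof.
elim/term_ind': t e s w y => [x|f a IH] e s w y /=.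
  rewrite sat_wapply ?teqP // sat_tapply; apply: tsat_ext => -[|i] //.
by apply: sat_wunnest => //; apply: tfunP.
Qed.

Lemma sat_wtform (M : model L') (e : nat -> M) p w : sat e (wtform p w) <->
  sat e (tform tau p (fun x j => x * d + j) (fun k => w + k)).
Proof.
have Hs : (fun x j => x * d + j) = (fun x j => 0 + x * d + j) by [].
elim: p e w => //= [t u|r a|p IHp q IHq|p IHp] e w.
- rewrite Hs; apply: (@sat_wunnest M e 2 2 (pair_args t u) _ _ (teq tau) 0 w 0); first exact: teqP.
  by move=> *; apply: sat_wden.
- rewrite Hs; apply: (@sat_wunnest M e _ _ a _ _ (trel tau r) 0 w 0); first exact: trelP.
  by move=> *; apply: sat_wden.
- by rewrite IHp IHq.
- rewrite !sat_Alls /=.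
  have Hw : (fun k => d + w + k) = bshift d (fun k => w + k).
    by apply: funext => k; rewrite /bshift addnA.
  have He : econs tau (fun x j => x * d + j) = (fun x j => x * d + j).
    by apply: funext => -[|x] //; apply: funext => j; rewrite /= /bshift mulSn addnA.
  have H1 blk : sat (bcons d blk e) (wapply 1 (tdom tau) (fun=> 0) (d + w)) <->
     sat (bcons d blk e) (tapply tau 1 (tdom tau) (fun=> bnth tau 0) (bshift d (fun k => w + k))).
    rewrite sat_wapply ?mul1n ?tdomP // sat_tapply; apply: iff_refl_eq; congr tsat.
    by apply: funext => k; rewrite /bshift addnA.
  have H2 blk : sat (bcons d blk e) (wtform p (d + w)) <-> sat (bcons d blk e)
      (tform tau p (econs tau (fun x j => x * d + j)) (bshift d (fun k => w + k))).
    by rewrite He -Hw IHp.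
  by split=> H blk; move: (H blk); rewrite H1 H2.
Qed.

Lemma sat_wtform_rsat (M : model L') (e : nat -> M) p w :
  sat e (wtform p w) <-> rsat tau (fun k => e (w + k)) p (fun x j => e (x * d + j)).
Proof. by rewrite sat_wtform (@sat_tform _ _ _ _ (fun k => e (w + k))). Qed.

Lemma bounded_wapply n m p b w : bounded (n * d + P) p ->
  (forall i j, i < n -> j < d -> b i + j < m) -> (forall k, k < P -> w + k < m) -> bounded m (wapply n p b w).
Proof.
move=> Hp Hb Hw; rewrite /wapply bounded_Exs; set K := n * d + P.
have : forall i, i \in iota 0 n -> i < n by move=> i; rewrite mem_iota leq0n add0n.
elim: (iota 0 n) => [|i s IH] Hs /=.
  apply: bounded_eqblk => [k Hk|k Hk|].
  - by apply: (@leq_trans K); [rewrite ltn_add2l | rewrite leq_addr].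
  - by rewrite -addnA ltn_add2l Hw.
  - by apply: bounded_mono Hp; rewrite leq_addr.
have Hi : i < n by apply: Hs; rewrite mem_head.
apply: bounded_eqblk => [j Hj|j Hj|].
- apply: (@leq_trans K); last by rewrite leq_addr.
  apply: (@leq_trans (n * d)); last by rewrite leq_addr.
  apply: (@leq_trans (i.+1 * d)); first by rewrite mulSn addnC ltn_add2r.
  by rewrite leq_mul2r Hi orbT.
- by rewrite -addnA ltn_add2l Hb.
- by apply: IH => i' Hi'; apply: Hs; rewrite inE Hi' orbT.
Qed.

Lemma bounded_wunnest n0 m n l (a : 'I_n -> term L) den p s w y :
  (forall i m' s' w' y',
     (forall x j, x < n0 -> j < d -> s' + x * d + j < m') ->
     (forall k, k < P -> w' + k < m') -> (forall j, j < d -> y' + j < m') ->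
     bounded m' (den i s' w' y')) ->
  (forall i, tbounded n0 (a i)) ->
  bounded (l * d + P) p ->
  (forall x j, x < n0 -> j < d -> s + x * d + j < m) ->
  (forall k, k < P -> w + k < m) ->
  (n < l -> forall j, j < d -> y + j < m) ->
  bounded m (wunnest l a den p s w y).
Proof.
move=> Hden Ha Hp He Hw Hy; rewrite /wunnest bounded_Exs bounded_Ands.
set nv := [seq i <- _ | _]; set k := size nv * d.
have Hz i j : i \in nv -> j < d -> index i nv * d + j < k + m.
  move=> Hi Hj; apply: leq_trans (leq_addr _ _).
  apply: (@leq_trans ((index i nv).+1 * d)); first by rewrite mulSn addnC ltn_add2r.
  by rewrite leq_mul2r index_mem Hi orbT.
have Hw' j : j < P -> k + w + j < k + m by move=> Hj; rewrite -addnA ltn_add2l Hw.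
have He' x j : x < n0 -> j < d -> k + s + x * d + j < k + m.
  by move=> Hx Hj; rewrite -!addnA ltn_add2l addnA He.
apply/andP; split.
  rewrite all_map; apply/allP => i Hi; rewrite inE bounded_And.
  apply/andP; split; last by apply: Hden => // j; apply: Hz.
  apply: bounded_wapply => //; first by rewrite mul1n tdomP.
  by move=> _ j _; apply: Hz.
apply: bounded_wapply => // x j Hx Hj.
case: insubP => [i _ Hi | Hnx].
  case Eai: (a i) => [v|f b].
    by apply: He' => //; have := Ha i; rewrite Eai.
  by apply: Hz => //; rewrite mem_filter mem_enum Eai.
rewrite -addnA ltn_add2l; apply: Hy Hj.
by apply: leq_ltn_trans Hx; rewrite leqNgt.
Qed.

Lemma bounded_wden n t m s w y :
  tbounded n t -> (forall x j, x < n -> j < d -> s + x * d + j < m) ->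
  (forall k, k < P -> w + k < m) -> (forall j, j < d -> y + j < m) ->
  bounded m (wden t s w y).
Proof.
elim/term_ind': t m s w y => [x | f a IH] m s w y /= Ht He Hw Hy.
  apply: bounded_wapply => //; first exact: teqP.
  by move=> [|i] j _ Hj; [apply: He | apply: Hy].
move/all_codomP in Ht.
by apply: (bounded_wunnest (n0 := n)) => //; [move=> i *; apply: IH | apply: tfunP].
Qed.

Lemma bounded_wtform n p m w :
  bounded n p -> (forall x j, x < n -> j < d -> x * d + j < m) ->
  (forall k, k < P -> w + k < m) -> bounded m (wtform p w).
Proof.
elim: p n m w => [|t u|r a|p IHp q IHq|p IHp] n m w //= Hp He Hw.
- have H i : tbounded n (pair_args t u i).
    by case/andP: Hp => Ht Hu; rewrite /pair_args; case: ifP.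
  apply: (bounded_wunnest (n0 := n)) => //; last exact: teqP.
  by move=> i *; apply: bounded_wden.
- move/all_codomP in Hp.
  apply: (bounded_wunnest (n0 := n)) => //; last by rewrite ltnn.
    by move=> i *; apply: bounded_wden.
  exact: trelP.
- by case/andP: Hp => Hp Hq; rewrite (IHp n) // (IHq n).
- have Hw' k : k < P -> d + w + k < d + m by move=> Hk; rewrite -addnA ltn_add2l Hw.
  have Hb j : j < d -> j < d + m by move=> Hj; apply: leq_trans Hj (leq_addr _ _).
  rewrite bounded_Alls /=; apply/andP; split.
    apply: bounded_wapply => //; first by rewrite mul1n tdomP.
    by move=> _ j _; apply: Hb.
  apply: (IHp n.+1) => // -[|x] j Hx Hj; first exact: Hb.
  by rewrite mulSn -addnA ltn_add2l He.
Qed.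

Lemma sentence_wtranslate p : sentence p -> sentence (wtranslate p).
Proof.
move=> Hp; rewrite /sentence /wtranslate bounded_And bounded_Exs bounded_Alls /= addn0.
by rewrite tparamP; apply: bounded_wtform Hp _ _.
Qed.

Lemma sat_translate_gen (M : model L') (e : nat -> M) q (Q : (nat -> M) -> Prop) :
  (forall b, sat (bcons P b e) q <-> Q (bcons P b e)) ->
  sat e (And (Exs P (tparam tau)) (Alls P (Imp (tparam tau) q))) <->
  (exists b, sat (bcons P b e) (tparam tau)) /\
  forall b, sat (bcons P b e) (tparam tau) -> Q (bcons P b e).
Proof.
move=> H; rewrite sat_And sat_Exs sat_Alls; apply: and_iff_congr => //.
by split=> H' b /H' /H.
Qed.

Lemma sat_wtranslate (M : model L') (e : nat -> M) p : sentence p ->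
  sat e (wtranslate p) <-> (exists b, sat (bcons P b e) (tparam tau)) /\
    forall b, sat (bcons P b e) (tparam tau) -> rsat tau (bcons P b e) p (fun _ _ => point M).
Proof.
move=> Hp; apply: (sat_translate_gen (Q := fun w => rsat tau w p (fun _ _ => point M))) => b.
by rewrite sat_wtform_rsat; apply: (@rsat_ext _ _ _ _ _ 0).
Qed.

Lemma sat_translate (M : model L') (e : nat -> M) p : sentence p ->
  sat e (translate tau p) <-> (exists b, sat (bcons P b e) (tparam tau)) /\
    forall b, sat (bcons P b e) (tparam tau) -> rsat tau (bcons P b e) p (fun _ _ => point M).
Proof.
move=> Hp; apply: (sat_translate_gen (Q := fun w => rsat tau w p (fun _ _ => point M))) => b.
by rewrite (@sat_tform _ _ _ _ (bcons P b e)) //; apply: (@rsat_ext _ _ _ _ _ 0).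
Qed.

(** Computability is thus needed for the codes of [wtranslate] only. *)
Lemma translateE (X : theory L') p : sentence p -> is_theorem X (translate tau p) <-> is_theorem X (wtranslate p).
Proof.
move=> Hp; rewrite !is_theoremP ?sentence_wtranslate ?sentence_translate //.
by split=> H M e /(H M e); rewrite sat_wtranslate // sat_translate.
Qed.

End Wtranslate.

(** * Certified initial segments *)

Section Arithmetic.
Variable N : model L_ap.
Implicit Types (x y z u t : N) (e : nat -> N).

Definition nzero : N := @mfun L_ap N FZero (fun=> point N).
Definition nsucc x : N := @mfun L_ap N FSucc (fun=> x).
Definition nadd x y : N := @mfun L_ap N FAdd (fun i => if val i == 0 then x else y).
Definition nmul x y : N := @mfun L_ap N FMul (fun i => if val i == 0 then x else y).
Definition nle x y : Prop := @mrel L_ap N RLe (fun i => if val i == 0 then x else y).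
Definition nnum n : N := iter n nsucc nzero.

Lemma eval_zero e : eval e zero_ap = nzero.
Proof. by rewrite /nzero /=; congr mfun; apply: funext => -[]. Qed.

Lemma eval_succ e (t : term L_ap) : eval e (succ_ap t) = nsucc (eval e t).
Proof. by rewrite /nsucc /=; congr mfun; apply: funext => i; rewrite ffunE. Qed.

Lemma eval_add e (t u : term L_ap) : eval e (add_ap t u) = nadd (eval e t) (eval e u).
Proof. by rewrite /nadd /=; congr mfun; apply: funext => i; rewrite ffunE; case: ifP. Qed.

Lemma eval_mul e (t u : term L_ap) : eval e (mul_ap t u) = nmul (eval e t) (eval e u).
Proof. by rewrite /nmul /=; congr mfun; apply: funext => i; rewrite ffunE; case: ifP. Qed.

Lemma sat_le e (t u : term L_ap) : sat e (le_ap t u) = nle (eval e t) (eval e u).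
Proof. by rewrite /nle /=; congr mrel; apply: funext => i; rewrite ffunE; case: ifP. Qed.

Lemma eval_num e n : eval e (num n) = nnum n.
Proof. by elim: n => [|n IH]; [exact: eval_zero | rewrite eval_succ IH]. Qed.

Lemma eval_Var e (x : nat) : eval e (@Var L_ap x) = e x. Proof. by []. Qed.
Lemma sat_EqE e (t u : term L_ap) : sat e (@Eq L_ap t u) = meq (eval e t) (eval e u). Proof. by []. Qed.
Lemma sat_ImpE e (p q : form L_ap) : sat e (Imp p q) = (sat e p -> sat e q). Proof. by []. Qed.
Lemma sat_BotE e : sat e (@Bot L_ap) = False. Proof. by []. Qed.
Lemma sat_AllP e (p : form L_ap) : sat e (All p) -> forall x, sat (x .: e) p. Proof. by []. Qed.
Lemma sat_AllI e (p : form L_ap) : (forall x, sat (x .: e) p) -> sat e (All p). Proof. by []. Qed.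
Definition apE := (sat_ImpE, sat_EqE, sat_BotE, sat_le, eval_add, eval_mul, eval_succ, eval_zero, eval_Var).

Lemma nsucc_cong x y : meq x y -> meq (nsucc x) (nsucc y).
Proof. by move=> H; apply: mfun_cong. Qed.

Lemma nadd_cong x y z u : meq x y -> meq z u -> meq (nadd x z) (nadd y u).
Proof. by move=> H H'; apply: mfun_cong => i; case: ifP. Qed.

Lemma nmul_cong x y z u : meq x y -> meq z u -> meq (nmul x z) (nmul y u).
Proof. by move=> H H'; apply: mfun_cong => i; case: ifP. Qed.

Lemma nle_cong x y z u : meq x y -> meq z u -> nle x z -> nle y u.
Proof. by move=> H H'; apply: mrel_cong => i; case: ifP. Qed.

(* The conditions hold at every numeral in models of [R0].  Conversely they
   force the elements below [x] to behave like an initial segment of the natural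
   numbers, as far as numerals can tell. *)
Record good (x : N) : Prop := Good {
  good_0 : nle nzero x;
  good_S : forall y, nle y x -> ~ meq y x -> nle (nsucc y) x;
  good_le00 : nle nzero nzero;
  good_le0 : forall z, nle z nzero -> meq z nzero;
  good_leS : forall y z, nle y x -> ~ meq y x -> nle z (nsucc y) -> ~ nle z y -> meq z (nsucc y);
  good_leW : forall y z, nle y x -> ~ meq y x -> nle z y -> nle z (nsucc y);
  good_leSS : forall y, nle y x -> ~ meq y x -> nle (nsucc y) (nsucc y);
  good_S0 : forall y, nle y x -> ~ meq (nsucc y) nzero;
  good_SS : forall y z, nle y x -> nle z x -> meq (nsucc y) (nsucc z) -> meq y z;
  good_add0 : forall y, nle y x -> meq (nadd y nzero) y;
  good_addS : forall y z u, nle y x -> nle z x -> nle u x ->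
    meq (nadd y z) u -> meq (nadd y (nsucc z)) (nsucc u);
  good_addSV : forall y z u, nle y x -> nle z x -> nle u x ->
    meq (nadd y (nsucc z)) (nsucc u) -> meq (nadd y z) u;
  good_addS0 : forall y z, nle y x -> nle z x -> ~ meq (nadd y (nsucc z)) nzero;
  good_mul0 : forall y, nle y x -> meq (nmul y nzero) nzero;
  good_mulS : forall y z t u, nle y x -> nle z x -> nle t x -> nle u x ->
    meq (nmul y z) t -> meq (nadd t y) u -> meq (nmul y (nsucc z)) u;
  good_mulSV : forall y z u, nle y x -> nle z x -> nle u x -> meq (nmul y (nsucc z)) u ->
    ~ forall t, nle t x -> meq (nmul y z) t -> ~ meq (nadd t y) u
}.

End Arithmetic.
Arguments nle {N}.
Arguments nsucc {N}.
Arguments nadd {N}.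
Arguments nmul {N}.
Arguments nzero {N}.
Arguments nnum {N}.

Section GoodFormula.
Local Notation v := (@Var L_ap).
Local Notation Z := zero_ap.
Local Notation S := succ_ap.
Local Notation "p ==> q" := (Imp p q) (at level 55, right associativity).
Local Notation "t <=' u" := (le_ap t u) (at level 50).
Local Notation "t =' u" := (@Eq L_ap t u) (at level 50).

(* The free variable is the endpoint of the segment. *)
Definition good_list : seq (form L_ap) :=
 [:: Z <=' v 0;
     All (v 0 <=' v 1 ==> Neg (v 0 =' v 1) ==> S (v 0) <=' v 1);
     Z <=' Z;
     All (v 0 <=' Z ==> v 0 =' Z);
     All (All (v 1 <=' v 2 ==> Neg (v 1 =' v 2) ==> v 0 <=' S (v 1) ==> Neg (v 0 <=' v 1) ==> v 0 =' S (v 1)));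
     All (All (v 1 <=' v 2 ==> Neg (v 1 =' v 2) ==> v 0 <=' v 1 ==> v 0 <=' S (v 1)));
     All (v 0 <=' v 1 ==> Neg (v 0 =' v 1) ==> S (v 0) <=' S (v 0));
     All (v 0 <=' v 1 ==> Neg (S (v 0) =' Z));
     All (All (v 1 <=' v 2 ==> v 0 <=' v 2 ==> S (v 1) =' S (v 0) ==> v 1 =' v 0));
     All (v 0 <=' v 1 ==> add_ap (v 0) Z =' v 0);
     All (All (All (v 2 <=' v 3 ==> v 1 <=' v 3 ==> v 0 <=' v 3 ==>
       add_ap (v 2) (v 1) =' v 0 ==> add_ap (v 2) (S (v 1)) =' S (v 0))));
     All (All (All (v 2 <=' v 3 ==> v 1 <=' v 3 ==> v 0 <=' v 3 ==>
       add_ap (v 2) (S (v 1)) =' S (v 0) ==> add_ap (v 2) (v 1) =' v 0)));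
     All (All (v 1 <=' v 2 ==> v 0 <=' v 2 ==> Neg (add_ap (v 1) (S (v 0)) =' Z)));
     All (v 0 <=' v 1 ==> mul_ap (v 0) Z =' Z);
     All (All (All (All (v 3 <=' v 4 ==> v 2 <=' v 4 ==> v 1 <=' v 4 ==> v 0 <=' v 4 ==>
       mul_ap (v 3) (v 2) =' v 1 ==> add_ap (v 1) (v 3) =' v 0 ==> mul_ap (v 3) (S (v 2)) =' v 0))));
     All (All (All (v 2 <=' v 3 ==> v 1 <=' v 3 ==> v 0 <=' v 3 ==> mul_ap (v 2) (S (v 1)) =' v 0 ==>
       Neg (All (v 0 <=' v 4 ==> mul_ap (v 3) (v 2) =' v 0 ==> Neg (add_ap (v 0) (v 3) =' v 1)))))) ].

Definition good_form : form L_ap := Ands good_list (Neg Bot).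

Lemma sat_good_form (N : model L_ap) (e : nat -> N) : sat e good_form <-> good (e 0).
Proof.
rewrite /good_form sat_Ands; split=> [[H _] | H].
  split.
  - by have := H _ (or_introl erefl); rewrite !apE.
  - by move=> y; have := (sat_AllP (H _ (or_intror (or_introl erefl))) y); rewrite !apE.
  - by have := H _ (or_intror (or_intror (or_introl erefl))); rewrite !apE.
  - by move=> y; have := (sat_AllP (H _ (ltac:(do 3!right; left; reflexivity))) y); rewrite !apE.
  - by move=> y z; have := (sat_AllP (sat_AllP (H _ (ltac:(do 4!right; left; reflexivity))) y) z); rewrite !apE.
  - by move=> y z; have := (sat_AllP (sat_AllP (H _ (ltac:(do 5!right; left; reflexivity))) y) z); rewrite !apE.
  - by move=> y; have := (sat_AllP (H _ (ltac:(do 6!right; left; reflexivity))) y); rewrite !apE.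
  - by move=> y; have := (sat_AllP (H _ (ltac:(do 7!right; left; reflexivity))) y); rewrite !apE.
  - by move=> y z; have := (sat_AllP (sat_AllP (H _ (ltac:(do 8!right; left; reflexivity))) y) z); rewrite !apE.
  - by move=> y; have := (sat_AllP (H _ (ltac:(do 9!right; left; reflexivity))) y); rewrite !apE.
  - by move=> y z u; have := (sat_AllP (sat_AllP (sat_AllP (H _ (ltac:(do 10!right; left; reflexivity))) y) z) u); rewrite !apE.
  - by move=> y z u; have := (sat_AllP (sat_AllP (sat_AllP (H _ (ltac:(do 11!right; left; reflexivity))) y) z) u); rewrite !apE.
  - by move=> y z; have := (sat_AllP (sat_AllP (H _ (ltac:(do 12!right; left; reflexivity))) y) z); rewrite !apE.
  - by move=> y; have := (sat_AllP (H _ (ltac:(do 13!right; left; reflexivity))) y); rewrite !apE.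
  - by move=> y z t u; have := (sat_AllP (sat_AllP (sat_AllP (sat_AllP (H _ (ltac:(do 14!right; left; reflexivity))) y) z) t) u); rewrite !apE.
  - move=> y z u Hy Hz Hu Hm K; have := (sat_AllP (sat_AllP (sat_AllP (H _ (ltac:(do 15!right; left; reflexivity))) y) z) u); rewrite !apE.
    by move/(_ Hy Hz Hu Hm); apply; apply: sat_AllI => t; rewrite !apE; apply: K.
split; last by [].
move=> q [<-|]; first by rewrite !apE; apply: (good_0 H).
move=> [<-|]; first by apply: sat_AllI => y; rewrite !apE; apply: (good_S H).
move=> [<-|]; first by rewrite !apE; apply: (good_le00 H).
move=> [<-|]; first by apply: sat_AllI => y; rewrite !apE; apply: (good_le0 H).
move=> [<-|]; first by apply: sat_AllI => y; apply: sat_AllI => z; rewrite !apE; apply: (good_leS H).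
move=> [<-|]; first by apply: sat_AllI => y; apply: sat_AllI => z; rewrite !apE; apply: (good_leW H).
move=> [<-|]; first by apply: sat_AllI => y; rewrite !apE; apply: (good_leSS H).
move=> [<-|]; first by apply: sat_AllI => y; rewrite !apE; apply: (good_S0 H).
move=> [<-|]; first by apply: sat_AllI => y; apply: sat_AllI => z; rewrite !apE; apply: (good_SS H).
move=> [<-|]; first by apply: sat_AllI => y; rewrite !apE; apply: (good_add0 H).
move=> [<-|]; first by apply: sat_AllI => y; apply: sat_AllI => z; apply: sat_AllI => u; rewrite !apE; apply: (good_addS H).
move=> [<-|]; first by apply: sat_AllI => y; apply: sat_AllI => z; apply: sat_AllI => u; rewrite !apE; apply: (good_addSV H).
move=> [<-|]; first by apply: sat_AllI => y; apply: sat_AllI => z; rewrite !apE; apply: (good_addS0 H).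
move=> [<-|]; first by apply: sat_AllI => y; rewrite !apE; apply: (good_mul0 H).
move=> [<-|]; first by apply: sat_AllI => y; apply: sat_AllI => z; apply: sat_AllI => t; apply: sat_AllI => u; rewrite !apE; apply: (good_mulS H).
move=> [<-|//]; apply: sat_AllI => y; apply: sat_AllI => z; apply: sat_AllI => u; rewrite !apE => Hy Hz Hu Hm K.
by apply: (good_mulSV H Hy Hz Hu Hm) => t; have := sat_AllP K t; rewrite !apE.
Qed.

End GoodFormula.

Section GoodSegments.
Variable N : model L_ap.
Implicit Types (x y z u t : N) (e : nat -> N).

Lemma good_cong x y : meq x y -> good x -> good y.
Proof.
move=> Hxy; rewrite -(sat_good_form (x .: fun=> x)) -(sat_good_form (y .: fun=> x)).
by apply: (sat_cong _ _).1 => -[|i] //=; apply: meq_refl.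
Qed.

(** The numeral of [k] itself is allowed to be the endpoint. *)
Definition reaches x k := (forall i, i <= k -> nle (nnum i) x) /\ (forall i, i < k -> ~ meq (nnum i) x).

(** [good_S] climbs through the numerals until the endpoint is met. A segment whose endpoint is no
    numeral falls under the second alternative for every [q]. *)
Lemma reaches_dicho x q : good x -> (exists k, [/\ k < q, reaches x k & meq (nnum k) x]) \/ reaches x q.
Proof.
move=> Hx; elim: q => [|q [[k [Hk H1 H2]]|[H1 H2]]].
- by right; split=> // -[|//] _; apply: (good_0 Hx).
- by left; exists k; split=> //; apply: ltnW.
case: (classic (meq (nnum q) x)) => Hq; first by left; exists q.
right; split=> i.
  rewrite leq_eqVlt => /orP [/eqP-> | /H1 //].
  by apply: (good_S Hx) => //; apply: H1.
by rewrite ltnS leq_eqVlt => /orP [/eqP-> | /H2].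
Qed.

Section Reached.
Variables (x : N) (k : nat).
Hypotheses (Hx : good x) (Hk : reaches x k).

Let Hle i : i <= k -> nle (nnum i) x. Proof. exact: Hk.1. Qed.
Let Hne i : i < k -> ~ meq (nnum i) x. Proof. exact: Hk.2. Qed.

Lemma reached_le i z : i <= k -> nle z (nnum i) <-> exists2 j, j <= i & meq z (nnum j).
Proof.
elim: i z => [|i IH] z Hi.
  split=> [/(good_le0 Hx) H | [[|//] _ H]]; first by exists 0.
  exact: nle_cong (meq_sym H) (meq_refl _) (good_le00 Hx).
have Hi' := ltnW Hi; split=> [H | [j]].
  case: (classic (nle z (nnum i))) => [/IH H'|H'].
    by case: (H' Hi') => j Hj Hz; exists j => //; apply: leqW.
  exists i.+1 => //; apply: (good_leS Hx _ _ H H'); [exact: Hle | exact: Hne].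
rewrite leq_eqVlt => /orP [/eqP-> | Hj] Hz.
  by apply: nle_cong (meq_sym Hz) (meq_refl _) _; apply: (good_leSS Hx); [apply: Hle | apply: Hne].
apply: (good_leW Hx); [exact: Hle | exact: Hne |].
by apply/IH => //; exists j.
Qed.

Lemma reached_inj i j : i <= k -> j <= k -> meq (@nnum N i) (nnum j) <-> i = j.
Proof.
move=> Hi Hj; split=> [|->]; last exact: meq_refl.
elim: i j Hi Hj => [|i IH] [|j] Hi Hj //.
- by move=> /meq_sym /(good_S0 Hx (Hle (ltnW Hj))).
- by move=> /(good_S0 Hx (Hle (ltnW Hi))).
- by move=> /(good_SS Hx (Hle (ltnW Hi)) (Hle (ltnW Hj))) /(IH _ (ltnW Hi) (ltnW Hj)) ->.
Qed.

Lemma reached_succ i j : i <= k -> j <= k -> meq (nsucc (@nnum N i)) (nnum j) <-> i.+1 = j.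
Proof.
move=> Hi Hj; split=> [|<-]; last exact: meq_refl.
case: j Hj => [|j] Hj; first by move=> /(good_S0 Hx (Hle Hi)).
by move=> /(good_SS Hx (Hle Hi) (Hle (ltnW Hj))) /(reached_inj Hi (ltnW Hj)) ->.
Qed.

Lemma reached_add a b c : a <= k -> b <= k -> c <= k -> meq (nadd (@nnum N a) (nnum b)) (nnum c) <-> a + b = c.
Proof.
move=> Ha; elim: b c => [|b IH] c Hb Hc.
  have H0 := good_add0 Hx (Hle Ha).
  rewrite addn0 -(reached_inj Ha Hc); split=> H; [exact: meq_trans (meq_sym H0) H | exact: meq_trans H0 H].
have Hb' := ltnW Hb; case: c Hc => [|c] Hc.
  by split=> [/(good_addS0 Hx (Hle Ha) (Hle Hb'))|] //; rewrite addnS.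
have Hc' := ltnW Hc; rewrite addnS; split=> [H|[H]].
  congr S; apply/(IH c Hb' Hc'); exact: (good_addSV Hx (Hle Ha) (Hle Hb') (Hle Hc') H).
by apply: (good_addS Hx (Hle Ha) (Hle Hb') (Hle Hc')); apply/IH.
Qed.

Lemma reached_mul a b c : a <= k -> b <= k -> c <= k -> a * b = c -> meq (nmul (@nnum N a) (nnum b)) (nnum c).
Proof.
move=> Ha; elim: b c => [|b IH] c Hb Hc; first by rewrite muln0 => <-; apply: (good_mul0 Hx (Hle Ha)).
rewrite mulnS addnC => E; have Hab : a * b <= k by apply: leq_trans Hc; rewrite -E leq_addr.
apply: (good_mulS Hx (Hle Ha) (Hle (ltnW Hb)) (Hle Hab) (Hle Hc)); last exact/reached_add.
exact: IH (ltnW Hb) Hab erefl.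
Qed.

(** [good_mulSV] provides an intermediate product below [x], which is known to be a numeral only
    because the endpoint is one. *)
Lemma reached_mulV a b c : meq (nnum k) x -> a <= k -> b <= k -> c <= k ->
  meq (nmul (@nnum N a) (nnum b)) (nnum c) -> a * b = c.
Proof.
move=> Hkx Ha; elim: b c => [|b IH] c Hb Hc H.
  rewrite muln0; apply/(reached_inj (leq0n _) Hc).
  exact: meq_trans (meq_sym (good_mul0 Hx (Hle Ha))) H.
apply: NNPP => Hn; apply: (good_mulSV Hx (Hle Ha) (Hle (ltnW Hb)) (Hle Hc) H) => t Ht H1 H2; apply: Hn.
have /(reached_le _ (leqnn k)) [j Hj Htj] : nle t (nnum k) by apply: nle_cong (meq_refl _) (meq_sym Hkx) Ht.
rewrite mulnS (IH j (ltnW Hb) Hj (meq_trans H1 Htj)) addnC; apply/(reached_add Hj Ha Hc).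
exact: meq_trans (nadd_cong (meq_sym Htj) (meq_refl _)) H2.
Qed.

End Reached.

(** [m] locates the variables of [p] and [b] the endpoint of the segment. Existential quantifiers
    are restricted to the segment, to match [bsat]. *)
Fixpoint sform_ap (p : sform) (m : nat -> nat) (b : nat) : form L_ap :=
  match p with
  | SZero i => Eq (Var (m i)) zero_ap
  | SSucc i j => Eq (succ_ap (Var (m i))) (Var (m j))
  | SEq i j => Eq (Var (m i)) (Var (m j))
  | SAdd i j l => Eq (add_ap (Var (m i)) (Var (m j))) (Var (m l))
  | SMul i j l => Eq (mul_ap (Var (m i)) (Var (m j))) (Var (m l))
  | SAnd p q => And (sform_ap p m b) (sform_ap q m b)
  | SOr p q => Or (sform_ap p m b) (sform_ap q m b)
  | SEx p => Ex (And (le_ap (Var 0) (Var b.+1)) (sform_ap p (0 .: fun i => (m i).+1) b.+1))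
  | SBall i p => All (Imp (le_ap (Var 0) (Var (m i).+1)) (sform_ap p (0 .: fun i => (m i).+1) b.+1))
  end.

(** Truth with witnesses up to [k] persists to every longer segment, even a nonstandard one. The
    converse requires the segment to end exactly at [k], as a witness might otherwise not be a
    numeral. *)
Lemma sat_sform_ap p e (ee : nat -> nat) m b k : good (e b) -> reaches (e b) k ->
  (forall i, ee i <= k /\ meq (e (m i)) (nnum (ee i))) ->
  (bsat k p ee -> sat e (sform_ap p m b)) /\
  (meq (nnum k) (e b) -> sat e (sform_ap p m b) -> bsat k p ee).
Proof.
move=> Hg Hk; elim: p e ee m b Hg Hk => [i|i j|i j|i j l|i j l|p IHp q IHq|p IHp q IHq|p IHp|i p IHp] e ee m b Hg Hk He; rewrite [sform_ap _ _ _]/= [bsat _ _ _]/=.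
- have [Hi Ei] := He i; rewrite !apE; have Hz := reached_inj Hg Hk Hi (leq0n _).
  split=> [/eqP/Hz H | _ H]; first exact: meq_trans Ei H.
  by apply/eqP/Hz; apply: meq_trans (meq_sym Ei) H.
- have [Hi Ei] := He i; have [Hj Ej] := He j; rewrite !apE; have Hz := reached_succ Hg Hk Hi Hj.
  split=> [/eqP/Hz H | _ H]; first exact: meq_trans (nsucc_cong Ei) (meq_trans H (meq_sym Ej)).
  by apply/eqP/Hz; apply: meq_trans (meq_trans (meq_sym (nsucc_cong Ei)) H) Ej.
- have [Hi Ei] := He i; have [Hj Ej] := He j; rewrite !apE; have Hz := reached_inj Hg Hk Hi Hj.
  split=> [/eqP/Hz H | _ H]; first exact: meq_trans Ei (meq_trans H (meq_sym Ej)).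
  by apply/eqP/Hz; apply: meq_trans (meq_trans (meq_sym Ei) H) Ej.
- have [Hi Ei] := He i; have [Hj Ej] := He j; have [Hl El] := He l; rewrite !apE.
  have Hz := reached_add Hg Hk Hi Hj Hl; have Hc := nadd_cong Ei Ej.
  split=> [/eqP/Hz H | _ H]; first exact: meq_trans Hc (meq_trans H (meq_sym El)).
  by apply/eqP/Hz; apply: meq_trans (meq_trans (meq_sym Hc) H) El.
- have [Hi Ei] := He i; have [Hj Ej] := He j; have [Hl El] := He l; rewrite !apE.
  have Hc := nmul_cong Ei Ej; split=> [/eqP/(reached_mul Hg Hk Hi Hj Hl) H | Hkb H].
    exact: meq_trans Hc (meq_trans H (meq_sym El)).
  by apply/eqP/(reached_mulV Hg Hk Hkb Hi Hj Hl); apply: meq_trans (meq_trans (meq_sym Hc) H) El.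
- have [P1 P2] := IHp e ee m b Hg Hk He; have [Q1 Q2] := IHq e ee m b Hg Hk He; rewrite sat_And.
  by split=> [/andP [/P1 ? /Q1 ?] // | Hkb [/(P2 Hkb)-> /(Q2 Hkb)->]].
- have [P1 P2] := IHp e ee m b Hg Hk He; have [Q1 Q2] := IHq e ee m b Hg Hk He; rewrite sat_Or.
  by split=> [/orP [/P1|/Q1]| Hkb [/(P2 Hkb)->|/(Q2 Hkb)->]]; rewrite ?orbT; [left|right| |].
- have IH z j : j <= k -> meq z (nnum j) -> _ := fun Hj Hz => IHp (z .: e) (j .: ee) (0 .: fun i => (m i).+1) b.+1 Hg Hk
    (fun i => match i with 0 => conj Hj Hz | i.+1 => He i end).
  rewrite sat_Ex; split=> [/has_iota0 [j Hj Hp] | Hkb [z /sat_And []]].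
    exists (nnum j); apply/sat_And; rewrite sat_le; split; first exact: Hk.1.
    exact: (IH _ j Hj (meq_refl _)).1.
  rewrite sat_le => /= Hz Hp; apply/has_iota0.
  have /(reached_le Hg Hk _ (leqnn k)) [j Hj Hzj] : nle z (nnum k) by apply: nle_cong (meq_refl _) (meq_sym Hkb) Hz.
  by exists j => //; apply: (IH z j Hj Hzj).2.
- have IH z j : j <= k -> meq z (nnum j) -> _ := fun Hj Hz => IHp (z .: e) (j .: ee) (0 .: fun i => (m i).+1) b.+1 Hg Hk
    (fun i => match i with 0 => conj Hj Hz | i.+1 => He i end).
  have [Hi Ei] := He i; split=> [/all_iota0 H | Hkb H].
    apply: sat_AllI => z; rewrite sat_ImpE sat_le => /= Hz.
    have /(reached_le Hg Hk _ Hi) [j Hj Hzj] : nle z (nnum (ee i)) by apply: nle_cong (meq_refl _) Ei Hz.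
    exact: (IH z j (leq_trans Hj Hi) Hzj).1 (H j Hj).
  apply/all_iota0 => j Hj; apply: (IH (nnum j) j (leq_trans Hj Hi) (meq_refl _)).2 => //.
  have := sat_AllP H (nnum j); rewrite sat_ImpE sat_le /=; apply; apply: nle_cong (meq_refl _) (meq_sym Ei) _.
  by apply/(reached_le Hg Hk) => //; exists j => //; apply: meq_refl.
Qed.

(* Rosser-style comparison: some certified segment verifies [th] at [Var 0]
   without verifying [ch]. *)
Definition rosser (th ch : sform) : form L_ap :=
  Ex (Ands [:: le_ap (Var 1) (Var 0); good_form; sform_ap th (fun=> 1) 0] (Neg (sform_ap ch (fun=> 1) 0))).

Lemma sat_rosser th ch e : sat e (rosser th ch) <-> exists x,
  [/\ nle (e 0) x, good x, sat (x .: e) (sform_ap th (fun=> 1) 0) & ~ sat (x .: e) (sform_ap ch (fun=> 1) 0)].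
Proof.
rewrite sat_Ex; split=> -[x Hx]; exists x; move: Hx; rewrite sat_Ands.
  move=> [H Hc]; split=> //.
  - by have := H _ (or_introl erefl); rewrite sat_le.
  - by have := H _ (or_intror (or_introl erefl)); rewrite sat_good_form.
  - by apply: H; do 2!right; left.
move=> [H1 H2 H3 H4]; split=> // q [<-|[<-|[<-|//]]] //; first by rewrite sat_le.
by rewrite sat_good_form.
Qed.

(** Certificates at the numerals replace the axioms of [R0p] here: a coincidence of two numerals is
    carried down by [good_SS] until [good_S0] or the induction hypothesis excludes it. *)
Lemma nums_reached n : (forall i, i <= n -> good (@nnum N i)) -> reaches (nnum n) n.
Proof.
elim: n => [|n IH] Hg.
  by split=> // -[|//] _; apply: good_0; apply: Hg.
have Hn : good (@nnum N n) by apply: Hg.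
have [H1 H2] := IH (fun i Hi => Hg i (leqW Hi)).
case: (reaches_dicho n.+1 (Hg n.+1 (leqnn _))) => // -[k [Hk _ Hkn]].
case: k Hk Hkn => [|k] Hk Hkn; first by case: (good_S0 Hn (H1 n (leqnn n)) (meq_sym Hkn)).
by case: (H2 k Hk); apply: (good_SS Hn (H1 k (ltnW Hk)) (H1 n (leqnn n)) Hkn).
Qed.

(** A segment reaching [n + q0] verifies [ch], against the last conjunct of [rosser]. A shorter one
    ends at a numeral, so what it verifies is true, and [th] would hold at [n]. *)
Lemma rosser_refuted th ch n e : meq (e 0) (nnum n) -> (forall i, i <= n -> good (@nnum N i)) ->
  (exists k, bsat k ch (fun=> n)) -> (forall k, ~ bsat k th (fun=> n)) -> ~ sat e (rosser th ch).
Proof.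
move=> He Hg [q0 Hq0] Hth /sat_rosser [x [Hx Gx Sth Sch]].
have Hq : bsat (n + q0) ch (fun=> n) by apply: bsat_mono Hq0; rewrite leq_addl.
case: (reaches_dicho (n + q0) Gx) => [[k [_ Hk Hkx]] | Hr]; last first.
  by apply: Sch; apply: (@sat_sform_ap ch (x .: e) (fun=> n) (fun=> 1) 0 (n + q0) Gx Hr _).1 => // i; rewrite leq_addr.
(* Verification in a segment is meaningful only for values lying in it; this is the use of the first
   conjunct of [rosser]. *)
have Hnk : n <= k.
  have /(reached_le Gx Hk _ (leqnn k)) [j Hj Hej] : nle (e 0) (nnum k) by apply: nle_cong (meq_refl _) (meq_sym Hkx) Hx.
  rewrite leqNgt; apply/negP => Hkn; apply: ((nums_reached Hg).2 j (leq_ltn_trans Hj Hkn)).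
  exact: meq_trans (meq_sym Hej) He.
by apply: (Hth k); apply: (@sat_sform_ap th (x .: e) (fun=> n) (fun=> 1) 0 k Gx Hk _).2.
Qed.

(** * Numerals in models of the arithmetical axioms *)

Section ModelOfR0.
Hypothesis HR0 : forall p e, R0_axiom p -> sat e p.

Let e0 : nat -> N := fun=> point N.

Lemma R0_add a b : meq (nadd (nnum a) (nnum b)) (@nnum N (a + b)).
Proof. by have := HR0 e0 (R0Add a b); rewrite !apE !eval_num. Qed.

Lemma R0_mul a b : meq (nmul (nnum a) (nnum b)) (@nnum N (a * b)).
Proof. by have := HR0 e0 (R0Mul a b); rewrite !apE !eval_num. Qed.

Lemma R0_inj a b : meq (@nnum N a) (nnum b) -> a = b.
Proof.
move=> H; apply: NNPP => /R0Neq /(HR0 e0); rewrite !apE !eval_num; exact.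
Qed.

Lemma R0_le k z : nle z (nnum k) <-> exists2 j, j <= k & meq z (nnum j).
Proof.
split=> [H | [j Hj H]]; last first.
  have := HR0 e0 (R0Le Hj); rewrite sat_le !eval_num; apply: nle_cong; [exact: meq_sym | exact: meq_refl].
have := sat_AllP (HR0 e0 (R0Bound k)) z; rewrite sat_ImpE sat_le eval_num => /(_ H) /sat_Ors [q /In_map [j /In_mem]].
by rewrite mem_iota leq0n add0n ltnS /= => Hj ->; rewrite sat_EqE eval_num => ?; exists j.
Qed.

(** Everything below a numeral is a numeral, so each condition becomes a fact about natural numbers.
    Values such as a sum are never claimed to stay in the segment; the conditions only speak of
    values assumed to lie there. *)
Lemma R0_good k : good (@nnum N k).
Proof.
have Hlt j : meq (@nnum N j) (nnum k) -> j = k by apply: R0_inj.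
have Sn j y : meq y (nnum j) -> meq (nsucc y) (@nnum N j.+1) by apply: nsucc_cong.
split.
- by apply/R0_le; exists 0 => //; apply: meq_refl.
- move=> y /R0_le [j Hj Hy] Hn; apply/R0_le; exists j.+1; last exact: Sn.
  by rewrite ltn_neqAle Hj andbT; apply/eqP => E; apply: Hn; rewrite -E.
- by apply/(R0_le 0); exists 0 => //; apply: meq_refl.
- by move=> z /(R0_le 0) [[|//] _].
- move=> y z /R0_le [j Hj Hy] Hn H H'.
  have /R0_le [i] : nle z (nnum j.+1) by apply: nle_cong (meq_refl _) (Sn _ _ Hy) H.
  rewrite leq_eqVlt => /orP [/eqP-> | Hi] Hz; first exact: meq_trans Hz (meq_sym (Sn _ _ Hy)).
  case: H'; apply: nle_cong (meq_refl _) (meq_sym Hy) _; by apply/R0_le; exists i.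
- move=> y z /R0_le [j Hj Hy] Hn H.
  have /R0_le [i Hi Hz] : nle z (nnum j) by apply: nle_cong (meq_refl _) Hy H.
  apply: nle_cong (meq_refl _) (meq_sym (Sn _ _ Hy)) _; apply/R0_le; exists i => //; exact: leqW.
- move=> y /R0_le [j Hj Hy] _; apply: nle_cong (meq_sym (Sn _ _ Hy)) (meq_sym (Sn _ _ Hy)) _.
  by apply/R0_le; exists j.+1 => //; apply: meq_refl.
- by move=> y /R0_le [j Hj Hy] H; have := R0_inj (meq_trans (meq_sym (Sn _ _ Hy)) H : meq _ (nnum 0)).
- move=> y z /R0_le [j Hj Hy] /R0_le [i Hi Hz] H.
  have [E] := R0_inj (meq_trans (meq_trans (meq_sym (Sn _ _ Hy)) H) (Sn _ _ Hz)).
  by rewrite E in Hy; apply: meq_trans Hy (meq_sym Hz).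
- move=> y /R0_le [j Hj Hy]; apply: meq_trans (nadd_cong Hy (meq_refl (nnum 0))) _.
  by apply: meq_trans (R0_add j 0) _; rewrite addn0; apply: meq_sym.
- move=> y z u /R0_le [a Ha Hy] /R0_le [b Hb Hz] /R0_le [c Hc Hu] H.
  have E : a + b = c by apply: R0_inj; apply: meq_trans (meq_sym (R0_add a b)) (meq_trans (nadd_cong (meq_sym Hy) (meq_sym Hz)) (meq_trans H Hu)).
  apply: meq_trans (nadd_cong Hy (Sn _ _ Hz)) (meq_trans (R0_add a b.+1) _).
  by rewrite addnS E; apply/meq_sym/Sn.
- move=> y z u /R0_le [a Ha Hy] /R0_le [b Hb Hz] /R0_le [c Hc Hu] H.
  have : a + b.+1 = c.+1.
    apply: R0_inj; apply: meq_trans (meq_sym (R0_add a b.+1)) _.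
    exact: meq_trans (nadd_cong (meq_sym Hy) (meq_sym (Sn _ _ Hz))) (meq_trans H (Sn _ _ Hu)).
  rewrite addnS => -[E]; apply: meq_trans (nadd_cong Hy Hz) (meq_trans (R0_add a b) _).
  by rewrite E; apply: meq_sym.
- move=> y z /R0_le [a Ha Hy] /R0_le [b Hb Hz] H.
  have : a + b.+1 = 0; last by rewrite addnS.
  apply: R0_inj; apply: meq_trans (meq_sym (R0_add a b.+1)) _.
  exact: meq_trans (nadd_cong (meq_sym Hy) (meq_sym (Sn _ _ Hz))) H.
- move=> y /R0_le [j Hj Hy]; apply: meq_trans (nmul_cong Hy (meq_refl (nnum 0))) _.
  by apply: meq_trans (R0_mul j 0) _; rewrite muln0; apply: meq_refl.
- move=> y z t u /R0_le [a Ha Hy] /R0_le [b Hb Hz] /R0_le [f Hf Ht] /R0_le [c Hc Hu] H H'.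
  have E : a * b = f by apply: R0_inj; apply: meq_trans (meq_sym (R0_mul a b)) (meq_trans (nmul_cong (meq_sym Hy) (meq_sym Hz)) (meq_trans H Ht)).
  have E' : f + a = c by apply: R0_inj; apply: meq_trans (meq_sym (R0_add f a)) (meq_trans (nadd_cong (meq_sym Ht) (meq_sym Hy)) (meq_trans H' Hu)).
  apply: meq_trans (nmul_cong Hy (Sn _ _ Hz)) (meq_trans (R0_mul a b.+1) _).
  by rewrite mulnS E addnC E'; apply/meq_sym.
- move=> y z u /R0_le [a Ha Hy] /R0_le [b Hb Hz] /R0_le [c Hc Hu] H.
  have E : a * b.+1 = c.
    apply: R0_inj; apply: meq_trans (meq_sym (R0_mul a b.+1)) _.
    exact: meq_trans (nmul_cong (meq_sym Hy) (meq_sym (Sn _ _ Hz))) (meq_trans H Hu).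
  move/(_ (nnum (a * b))); apply.
  + apply/R0_le; exists (a * b); last exact: meq_refl.
    by apply: leq_trans Hc; rewrite -E mulnS leq_addl.
  + exact: meq_trans (nmul_cong Hy Hz) (R0_mul a b).
  + apply: meq_trans (nadd_cong (meq_refl _) Hy) (meq_trans (R0_add _ _) _).
    by rewrite addnC -mulnS E; apply: meq_sym.
Qed.

Lemma rosser_proved th ch n e : meq (e 0) (nnum n) ->
  (exists k, bsat k th (fun=> n)) -> (forall k, ~ bsat k ch (fun=> n)) -> sat e (rosser th ch).
Proof.
(* The segment must contain both the argument [n] and the witnesses, which are bounded by [q0]. *)
move=> He [q0 Hq0] Hch; set q := n + q0.
have Hq : bsat q th (fun=> n) by apply: bsat_mono Hq0; rewrite leq_addl.
have Hr : reaches (@nnum N q) q.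
  split=> i Hi; first by apply/R0_le; exists i => //; apply: meq_refl.
  by move/R0_inj => E; rewrite E ltnn in Hi.
apply/sat_rosser; exists (nnum q).
have Hs p := @sat_sform_ap p (nnum q .: e) (fun=> n) (fun=> 1) 0 q (R0_good q) Hr (fun _ => conj (leq_addr _ _) He).
split.
- by apply/R0_le; exists n => //; rewrite leq_addr.
- exact: R0_good.
- exact: (Hs th).1.
- by move/((Hs ch).2 (meq_refl _))/Hch.
Qed.

End ModelOfR0.
End GoodSegments.

(** * The independent sentences *)

Lemma In_cons (T : Type) (x y : T) s : List.In x (y :: s) <-> x = y \/ List.In x s.
Proof. by split=> -[->|]; by [left|right]. Qed.

Lemma all_In (T : Type) (a : pred T) s : (forall x, List.In x s -> a x) -> all a s.
Proof. by elim: s => //= x s IH H; rewrite H; [apply: IH => y Hy; apply: H; right | left]. Qed.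

Lemma sym_all (L : signature) (F : fsym L -> Prop) (R : rsym L -> Prop) p :
  (forall f, F f) -> (forall r, R r) -> sym_in F R p.
Proof.
move=> HF HR; have Ht t : tsym_in F t by elim/term_ind': t.
by elim: p => /=.
Qed.

Section ParameterCongruence.
Variables (L L' : signature) (tau : translation L L') (A : model L').
Variables (w w' : nat -> A).
Hypothesis Hw : forall k, k < tpar tau -> meq (w k) (w' k).

Lemma tsat_wcong n p b : bounded (n * tdim tau + tpar tau) p -> tsat tau n p b w <-> tsat tau n p b w'.
Proof.
move=> Hp; set K := n * tdim tau + tpar tau.
pose e1 v := if v < n * tdim tau then b (v %/ tdim tau) (v %% tdim tau) else if v < K then w' (v - n * tdim tau) else w (v - n * tdim tau).
have -> : tsat tau n p b w' <-> sat e1 p by apply: (sat_bounded Hp) => v Hv; rewrite /e1 Hv.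
rewrite /tsat; apply: sat_cong => v; rewrite /e1; case: ltnP => // H1; first exact: meq_refl.
case: ltnP => H2; last exact: meq_refl.
by apply: Hw; rewrite ltn_subLR.
Qed.

(** The steps of the chain in [sigma] copy the parameters only up to [meq]; this keeps the inner
    model fixed along the chain. *)
Lemma represents_wcong F R (N : model L) (v : (nat -> A) -> N) : represents tau w F R v -> represents tau w' F R v.
Proof.
have HD b : tdomain tau w b <-> tdomain tau w' b by apply: tsat_wcong; rewrite mul1n tdomP.
have HE b b' : tequal tau w b b' <-> tequal tau w' b b' by apply/tsat_wcong/teqP.
have HRe r a : trelation tau w r a <-> trelation tau w' r a by apply/tsat_wcong/trelP.
have HG f a y : tgraph tau w f a y <-> tgraph tau w' f a y by apply/tsat_wcong/tfunP.
have HDn n (a : nat -> nat -> A) : (forall i, i < n -> tdomain tau w' (a i)) -> forall i, i < n -> tdomain tau w (a i).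
  by move=> H i /H /HD.
case=> H1 H2 H3 H4 H5; split.
- by move=> x; case: (H1 x) => b /HD; exists b.
- by move=> b b' /HD Hb /HD Hb'; rewrite -HE; apply: H2.
- by move=> r Hr a /HDn Ha; rewrite -HRe; apply: H3.
- by move=> f Hf a y /HDn Ha /HD Hy /HG; apply: H4.
- by move=> f Hf a /HDn /(H5 f Hf) [y /HD Hy /HG Hg]; exists y.
Qed.

End ParameterCongruence.

Definition ap_fs : seq (fsym L_ap) := [:: FZero; FSucc; FAdd; FMul].
Definition ap_rs : seq (rsym L_ap) := [:: RLe; RP].

Lemma ap_fsP f : f \in ap_fs. Proof. by case: f. Qed.
Lemma ap_rsP r : r \in ap_rs. Proof. by case: r. Qed.

Lemma bounded_ap2 (n k : nat) (t u : term L_ap) : tbounded n t -> tbounded n u ->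
  all id (codom (fun i : 'I_k => tbounded n ([ffun i : 'I_k => if val i == 0 then t else u] i))).
Proof. by move=> Ht Hu; apply/all_codomP => i; rewrite ffunE; case: ifP. Qed.

Lemma bounded_ap1 (n k : nat) (t : term L_ap) : tbounded n t ->
  all id (codom (fun i : 'I_k => tbounded n ([ffun _ : 'I_k => t] i))).
Proof. by move=> Ht; apply/all_codomP => i; rewrite ffunE. Qed.

Lemma tbounded_zero n : tbounded n zero_ap.
Proof. exact: (tbounded_num n 0). Qed.

Ltac bnd_ap := rewrite /=; do ?[apply/andP; split]; do ?[exact: tbounded_zero | apply: bounded_ap2 | apply: bounded_ap1 | by rewrite /=].

Lemma bounded_good_form : bounded 1 good_form.
Proof.
rewrite /good_form bounded_Ands andbT.
do ![apply/andP; split]; by bnd_ap.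
Qed.

Lemma bounded_sform_ap p n m b : (forall i, m i < n) -> b < n -> bounded n (sform_ap p m b).
Proof.
elim: p n m b => [i|i j|i j|i j l|i j l|p IHp q IHq|p IHp q IHq|p IHp|i p IHp] n m b Hm Hb; rewrite [sform_ap _ _ _]/=.
- by bnd_ap.
- by bnd_ap.
- by bnd_ap.
- by bnd_ap.
- by bnd_ap.
- by rewrite bounded_And IHp ?IHq.
- by rewrite /= andbT IHp ?IHq.
- rewrite bounded_Ex bounded_And IHp ?andbT //; first by bnd_ap.
  by case=> [|k] //=; rewrite ltnS.
- rewrite bounded_All_Imp IHp ?andbT //; first by bnd_ap; apply: Hm.
  by case=> [|k] //=; rewrite ltnS.
Qed.

Lemma bounded_rosser th ch : bounded 1 (rosser th ch).
Proof.
rewrite /rosser bounded_Ex bounded_Ands; apply/andP; split; last by apply/andP; split; [exact: bounded_sform_ap|].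
apply: all_In => q [<-|[<-|[<-|//]]]; [by bnd_ap | exact: (bounded_mono _ bounded_good_form) | exact: bounded_sform_ap].
Qed.

Section Sigma.
Variables (L : signature) (tau : translation L_ap L) (th ch : sform).
Local Notation d := (tdim tau).
Local Notation P := (tpar tau).
Local Notation kk := (tdim tau + tpar tau).

(* Variables [0 .. d-1] hold an object and [d .. d+P-1] the parameters.  A step
   quantifies a new object together with a copy of the parameters, so that the
   formula for the rest of the chain is used unchanged. *)
Definition chain_step : form L :=
  Ands [:: eqblk d (kk + d) P (Neg Bot);
           tform tau good_form (fun _ j => kk + j) (fun k => d + k);
           tapply tau 1 (tdom tau) (fun _ j => j) (fun k => d + k)]
    (tapply tau 2 (tfun tau FSucc) (fun i j => if i is 0 then kk + j else j) (fun k => d + k)).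

Definition chain_end : form L := tform tau (And good_form (rosser th ch)) (fun _ j => j) (fun k => d + k).

Definition chain_form (n : nat) : form L := iter n (fun q => Exs kk (And chain_step q)) chain_end.

(** The parameters are quantified existentially together with the identity laws, so every model of
    [sigma n] contains an inner model for the arithmetical symbols, whatever else it satisfies. The
    numeral of [n] is reached by a chain of [n] uniform steps, which keeps the code of the sentence
    easy to compute. *)
Definition sigma (n : nat) : form L :=
  Exs P (Ands (tparam tau :: [seq tform tau q (fun=> id) id | q <- id_list ap_fs ap_rs])
    (Exs d (Ands [:: tapply tau 1 (tdom tau) (fun _ j => j) (fun k => d + k);
                     tapply tau 1 (tfun tau FZero) (fun _ j => j) (fun k => d + k)]
       (chain_form n)))).

Lemma bounded_chain_form n : bounded kk (chain_form n).
Proof.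
elim: n => [|n IH].
  apply: (bounded_tform (n := 1)) => [|x j _ Hj|k Hk]; last by rewrite ltn_add2l.
    by rewrite bounded_And bounded_good_form bounded_rosser.
  by rewrite (leq_trans Hj) // leq_addr.
rewrite [chain_form _]/(Exs kk (And chain_step (chain_form n))) bounded_Exs bounded_And.
rewrite (bounded_mono _ IH) ?leq_addr // andbT /chain_step bounded_Ands.
have Hd j : j < d -> j < kk + kk by lia.
have Hk j : j < d -> kk + j < kk + kk by lia.
have Hp k : k < P -> d + k < kk + kk by lia.
apply/andP; split; first apply: all_In => q [<-|[<-|[<-|//]]].
- by apply: bounded_eqblk => // j Hj; lia.
- by apply: (bounded_tform (n := 1)) => // [|x j _ Hj]; [apply: bounded_good_form | apply: Hk].
- by apply: bounded_tapply => // [|i j _ Hj]; [rewrite mul1n tdomP | apply: Hd].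
- by apply: bounded_tapply => // [|[|i] j _ Hj]; [apply: tfunP | apply: Hk | apply: Hd].
Qed.

Lemma sentence_sigma n : sentence (sigma n).
Proof.
rewrite /sentence /sigma bounded_Exs addn0 bounded_Ands; apply/andP; split.
  apply: all_In => x /In_cons [->|Hx]; first exact: tparamP.
  have [q Hq ->] := (In_map _ _ _).1 Hx.
  by apply: (bounded_tform (n := 0)) => //; apply: id_list_sentence Hq.
rewrite bounded_Exs bounded_Ands bounded_chain_form andbT.
have Hd j : j < d -> j < kk by lia.
have Hp k : k < P -> d + k < kk by lia.
apply: all_In => x [<-|[<-|//]]; apply: bounded_tapply => // [|i j _ Hj]; rewrite ?Hd //.
  by rewrite mul1n tdomP.
exact: (tfunP tau FZero).
Qed.

Definition chain (N : model L_ap) (n : nat) (x : N) : Prop :=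
  (forall i, i <= n -> good (iter i nsucc x)) /\ sat (fun=> iter n nsucc x) (rosser th ch).

Lemma chain_cong (N : model L_ap) n (x y : N) : meq x y -> chain n x -> chain n y.
Proof.
have Hi i (u u' : N) : meq u u' -> meq (iter i nsucc u) (iter i nsucc u') by move=> H; elim: i => //= i; apply: nsucc_cong.
move=> H [H1 H2]; split=> [i /H1|]; first by apply: good_cong; apply: Hi.
by apply: (sat_cong _ _).1 H2 => _; apply: Hi.
Qed.

Lemma chainS (N : model L_ap) n (x : N) : chain n.+1 x <-> good x /\ chain n (nsucc x).
Proof.
split=> [[H1 H2] | [H [H1 H2]]].
  split; first exact: (H1 0).
  by split=> [i Hi|]; [have := H1 i.+1 Hi | move: H2]; rewrite iterSr.
split=> [[|i] Hi|]; rewrite ?iterSr //; exact: H1.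
Qed.

Variable M : model L.
Implicit Types (e : nat -> M).
Local Notation F := (fun f => f \in ap_fs).
Local Notation R := (fun r => r \in ap_rs).

Lemma rsat_ap w (N : model L_ap) (v : (nat -> M) -> N) p E : represents tau w F R v -> bounded 1 p ->
  tdomain tau w (E 0) -> rsat tau w p E <-> sat (fun x => v (E x)) p.
Proof.
move=> HR Hp HE; apply: (rsat_rep HR Hp); first by apply: sym_all; [apply: ap_fsP | apply: ap_rsP].
by case.
Qed.

Lemma tgraph_zero w (N : model L_ap) (v : (nat -> M) -> N) a y : represents tau w F R v -> tdomain tau w y ->
  tgraph tau w FZero a y -> meq (v y) nzero.
Proof.
move=> HR Hy Hg; apply: meq_sym; have := rep_fun HR (ap_fsP FZero) (a := a) _ Hy Hg.
by move/(_ (fun i Hi => False_ind _ (notF Hi))); apply: meq_trans; apply: mfun_cong => -[].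
Qed.

(** The induction lets the environment vary, and with it the copy of the parameters, while the inner
    model [N] and the value map [v] stay the same. *)
Lemma sat_chain_form n e (N : model L_ap) (v : (nat -> M) -> N) :
  represents tau (fun k => e (d + k)) F R v -> tdomain tau (fun k => e (d + k)) e ->
  sat e (chain_form n) <-> chain n (v e).
Proof.
elim: n e => [|n IH] e HR He.
  rewrite [chain_form 0]/(chain_end) /chain_end (@sat_tform _ _ _ _ (fun k => e (d + k))) //.
  rewrite (rsat_ap HR) //; last by rewrite bounded_And bounded_good_form bounded_rosser.
  rewrite sat_And sat_good_form /chain; apply: and_iff_congr => //.
  by split=> [H [|//] _ //|H]; apply: (H 0).
rewrite [chain_form _]/(Exs kk (And chain_step (chain_form n))) sat_Exs chainS.
have Hstep blk : let e' := bcons kk blk e in sat e' chain_step <->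
    [/\ forall k, k < P -> meq (e' (d + k)) (e (d + k)),
        rsat tau (fun k => e' (d + k)) good_form (fun _ => e),
        tdomain tau (fun k => e' (d + k)) e' & tgraph tau (fun k => e' (d + k)) FSucc (fun _ => e) e'].
  move=> e'; have Hx : (fun j => e' (kk + j)) = e by apply: funext => j; rewrite /e' bcons_add.
  have H1 : sat e' (eqblk d (kk + d) P (Neg Bot)) <-> forall k, k < P -> meq (e' (d + k)) (e (d + k)).
    rewrite sat_eqblk; split=> [[H _] k Hk | H].
      by have := H k Hk; rewrite -addnA /e' bcons_add.
    by split=> // k Hk; rewrite -addnA {2}/e' bcons_add; apply: H.
  have H2 : sat e' (tform tau good_form (fun _ j => kk + j) (fun k => d + k)) <->
      rsat tau (fun k => e' (d + k)) good_form (fun _ => e).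
    by rewrite (@sat_tform _ _ _ _ (fun k => e' (d + k))) // Hx.
  have H3 : sat e' (tapply tau 1 (tdom tau) (fun _ j => j) (fun k => d + k)) <-> tdomain tau (fun k => e' (d + k)) e'.
    by rewrite sat_tapply.
  have H4 : sat e' (tapply tau 2 (tfun tau FSucc) (fun i j => if i is 0 then kk + j else j) (fun k => d + k)) <->
      tgraph tau (fun k => e' (d + k)) FSucc (fun _ => e) e'.
    by rewrite sat_tapply; apply: tsat_ext => -[|[|//]] j _ _ //=; rewrite -[in RHS]Hx.
  rewrite /chain_step sat_Ands; split=> [[H H'] | [/H1 ? /H2 ? /H3 ? /H4 ?]]; last by split=> // q [<-|[<-|[<-|//]]].
  split; [apply/H1 | apply/H2 | apply/H3 | exact/H4]; apply: H; by [left | right; left | do 2!right; left].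
split=> [[blk] | [Hg Hc]].
  rewrite sat_And Hstep; set e' := bcons kk blk e => -[[H1 H2 H3 H4] H].
  have HR' : represents tau (fun k => e' (d + k)) F R v.
    by apply: represents_wcong HR => k Hk; apply/meq_sym/H1.
  have He' : tdomain tau (fun k => e' (d + k)) e.
    by apply: ((tsat_wcong (fun k Hk => meq_sym (H1 k Hk)) _ _).1 He); rewrite mul1n tdomP.
  split; first by move/(rsat_ap HR' bounded_good_form He'): H2; rewrite sat_good_form.
  move/(IH _ HR' H3): H; apply: chain_cong; apply: meq_sym.
  by apply: (rep_fun HR' (ap_fsP FSucc) (a := fun=> e)).
have [|y Hy Hgy] := rep_total HR (ap_fsP FSucc) (a := fun=> e); first by [].
have Hvy := rep_fun HR (ap_fsP FSucc) (a := fun=> e) (fun _ _ => He) Hy Hgy.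
(* The new object followed by the old parameters, which [e] holds from position [d] on. *)
pose blk j := if j < d then y j else e j.
exists blk; rewrite sat_And Hstep; set e' := bcons kk blk e.
have Hw : (fun k => e' (d + k)) = (fun k => if k < P then e (d + k) else e' (d + k)).
  apply: funext => k; case: ltnP => // Hk.
  by rewrite /e' bcons_lt ?ltn_add2l // /blk ltnNge leq_addr.
have H1 k : k < P -> meq (e' (d + k)) (e (d + k)).
  by move=> Hk; have -> : e' (d + k) = _ := f_equal (fun g => g k) Hw; rewrite Hk; apply: meq_refl.
have HR' : represents tau (fun k => e' (d + k)) F R v.
  by apply: represents_wcong HR => k Hk; apply/meq_sym/H1.
have He' : tdomain tau (fun k => e' (d + k)) e.
  by apply: ((tsat_wcong (fun k Hk => meq_sym (H1 k Hk)) _ _).1 He); rewrite mul1n tdomP.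
have Hye : blk_eq tau y e' by move=> j Hj; rewrite /e' bcons_lt ?(leq_trans Hj) ?leq_addr // /blk Hj.
have Hy' : tdomain tau (fun k => e' (d + k)) e'.
  by apply/(tdomain_ext _ Hye); apply: ((tsat_wcong (fun k Hk => meq_sym (H1 k Hk)) _ _).1 Hy); rewrite mul1n tdomP.
have Hg' : tgraph tau (fun k => e' (d + k)) FSucc (fun=> e) e'.
  have : tgraph tau (fun k => e' (d + k)) FSucc (fun=> e) y.
    by apply: ((tsat_wcong (fun k Hk => meq_sym (H1 k Hk)) _ _).1 Hgy); apply: tfunP.
  by move=> H; apply: tsat_imp H _ => -[|i] j _ Hj //=; apply: Hye.
split; first split=> //.
  by apply/(rsat_ap HR' bounded_good_form He'); rewrite sat_good_form.
apply/(IH _ HR' Hy'); apply: chain_cong Hc.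
by apply: (rep_fun HR' (ap_fsP FSucc) (a := fun=> e)).
Qed.

Definition sigma_body (n : nat) : form L :=
  Exs d (Ands [:: tapply tau 1 (tdom tau) (fun _ j => j) (fun k => d + k);
                  tapply tau 1 (tfun tau FZero) (fun _ j => j) (fun k => d + k)] (chain_form n)).

Lemma sat_sigma_body n w (N : model L_ap) (v : (nat -> M) -> N) : represents tau w F R v ->
  sat w (sigma_body n) <-> chain n (@nzero N).
Proof.
move=> HR; rewrite sat_Exs.
have Hw y : (fun k => bcons d y w (d + k)) = w by apply: funext => k; rewrite bcons_add.
have Hb y : sat (bcons d y w) (Ands [:: tapply tau 1 (tdom tau) (fun _ j => j) (fun k => d + k);
       tapply tau 1 (tfun tau FZero) (fun _ j => j) (fun k => d + k)] (chain_form n)) <->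
    [/\ tdomain tau w (bcons d y w), tgraph tau w FZero (fun=> w) (bcons d y w) & sat (bcons d y w) (chain_form n)].
  have H1 : sat (bcons d y w) (tapply tau 1 (tdom tau) (fun _ j => j) (fun k => d + k)) <-> tdomain tau w (bcons d y w).
    by rewrite sat_tapply Hw.
  have H2 : sat (bcons d y w) (tapply tau 1 (tfun tau FZero) (fun _ j => j) (fun k => d + k)) <->
      tgraph tau w FZero (fun=> w) (bcons d y w).
    by rewrite sat_tapply Hw.
  rewrite sat_Ands; split=> [[H H'] | [/H1 ? /H2 ? ?]]; last by split=> // q [<-|[<-|//]].
  split; [apply/H1 | apply/H2 | exact: H']; apply: H; by [left | right; left].
split=> [[y /Hb [Hy Hg]] | Hc].
  have HR' : represents tau (fun k => bcons d y w (d + k)) F R v by rewrite Hw.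
  rewrite (sat_chain_form _ HR') ?Hw //; apply: chain_cong; exact: tgraph_zero HR Hy Hg.
have [|y Hy Hg] := rep_total HR (ap_fsP FZero) (a := fun=> w); first by [].
exists y; apply/Hb.
have Hye : blk_eq tau y (bcons d y w) by move=> j Hj; rewrite bcons_lt.
have Hy' : tdomain tau w (bcons d y w) by apply/(tdomain_ext _ Hye).
have Hg' : tgraph tau w FZero (fun=> w) (bcons d y w).
  by apply: tsat_imp Hg _ => i j _ Hj /=; apply: Hye.
have HR' : represents tau (fun k => bcons d y w (d + k)) F R v by rewrite Hw.
split=> //; rewrite (sat_chain_form _ HR') ?Hw //; apply: chain_cong Hc.
exact/meq_sym/(tgraph_zero HR Hy' Hg').
Qed.

Lemma sat_sigma n e : sat e (sigma n) <-> exists b, let w := bcons P b e in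
  [/\ sat w (tparam tau), forall q, List.In q (id_list ap_fs ap_rs) -> rsat tau w q (fun _ _ => point M)
    & sat w (sigma_body n)].
Proof.
rewrite sat_Exs; have Hb b : let w := bcons P b e in
    sat w (Ands (tparam tau :: [seq tform tau q (fun=> id) id | q <- id_list ap_fs ap_rs]) (sigma_body n)) <->
    [/\ sat w (tparam tau), forall q, List.In q (id_list ap_fs ap_rs) -> rsat tau w q (fun _ _ => point M)
      & sat w (sigma_body n)].
  move=> w; rewrite sat_Ands.
  have Hq q : List.In q (id_list ap_fs ap_rs) -> sat w (tform tau q (fun=> id) id) <-> rsat tau w q (fun _ _ => point M).
    move=> /id_list_sentence Hs; rewrite (@sat_tform _ _ _ _ w) //; exact: (@rsat_ext _ _ _ _ _ 0).
  split=> [[H H'] | [H1 H2 H3]].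
    split=> //; first by apply: H; left.
    by move=> q Hin; apply/Hq => //; apply: H; right; apply/In_map; exists q.
  split=> // q /In_cons [->|Hx] //; have [q' Hin ->] := (In_map _ _ _).1 Hx.
  by apply/Hq => //; apply: H2.
by split=> -[b H]; exists b; apply/Hb.
Qed.

Lemma sigma_refuted n e : (exists k, bsat k ch (fun=> n)) -> (forall k, ~ bsat k th (fun=> n)) -> ~ sat e (sigma n).
Proof.
move=> Hch Hth /sat_sigma [b [_ Hid Hs]].
have HL := id_list_laws Hid.
move/(sat_sigma_body n (inner_represents HL)): Hs => [Hg Hr].
exact: (@rosser_refuted _ th ch n _ (meq_refl _) Hg Hch Hth Hr).
Qed.

Lemma sigma_proved n e : (exists k, bsat k th (fun=> n)) -> (forall k, ~ bsat k ch (fun=> n)) ->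
  (forall q, axiom (theory_union R0p (id_theory L_ap)) q -> sat e (translate tau q)) -> sat e (sigma n).
Proof.
move=> Hth Hch Hax.
have Hs q : axiom (theory_union R0p (id_theory L_ap)) q -> sentence q by apply: axiom_sentence.
have Hid0 : axiom (theory_union R0p (id_theory L_ap)) (id_refl L_ap) by right; apply: IdRefl.
have [[b Hb] _] := (sat_translate _ _ (Hs _ Hid0)).1 (Hax _ Hid0).
pose w := bcons P b e.
have Hw q : axiom (theory_union R0p (id_theory L_ap)) q -> rsat tau w q (fun _ _ => point M).
  by move=> Hq; have [_ H] := (sat_translate _ _ (Hs _ Hq)).1 (Hax _ Hq); apply: H.
(* Nonemptiness of the domain is listed in [id_list] but is not among the identity axioms; it comes
   from the totality of the constant zero. *)
have Hzero : exists b, tdomain tau w b.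
  have : rsat tau w (id_total (FZero : fsym L_ap)) (fun _ _ => point M) by apply: Hw; right; apply: IdTotal.
  by move/rsat_Ex => [y Hy _]; exists y.
have Hids q : List.In q (id_list ap_fs ap_rs) -> rsat tau w q (fun _ _ => point M).
  move=> /id_listP [-> | Hq]; last by apply: Hw; right.
  have [y Hy] := Hzero; apply/rsat_Ex; exists y => //.
  exact: (Hw _ Hid0 y Hy).
have HR := inner_represents (id_list_laws Hids).
apply/sat_sigma; exists b; split=> //; apply/(sat_sigma_body n HR).
have HR0 p (e' : nat -> inner_model (id_list_laws Hids)) : R0_axiom p -> sat e' p.
  move=> Hp; have Hp' : axiom (theory_union R0p (id_theory L_ap)) p by left; left.
  have Hsp := Hs _ Hp'; rewrite (sat_sentence e' (fun _ => inner_val (id_list_laws Hids) (fun _ => point M)) Hsp).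
  apply/(rsat_rep HR Hsp) => //; last exact: Hw.
  by apply: sym_all; [apply: ap_fsP | apply: ap_rsP].
split=> [i _|]; first exact: (R0_good HR0 i).
by apply: (rosser_proved HR0 (n := n)) => //; apply: meq_refl.
Qed.

End Sigma.

(** * Codes of translated sentences *)

Definition cImp a b := cpair 3 (cpair a b).
Definition cAll a := cpair 4 a.
Definition cNeg a := cImp a (cpair 0 0).
Definition cAnd a b := cNeg (cImp a (cNeg b)).
Definition cEx a := cNeg (cAll (cNeg a)).
Definition cEqv a b := cpair 1 (cpair (cpair 0 a) (cpair 0 b)).

Lemma code_Alls (L : signature) k (p : form L) : code (Alls k p) = iter k cAll (code p).
Proof. by elim: k => //= k ->. Qed.

Lemma code_Exs (L : signature) k (p : form L) : code (Exs k p) = iter k cEx (code p).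
Proof. by elim: k => //= k ->. Qed.

Lemma code_Ands (L : signature) (ps : seq (form L)) p :
  code (Ands ps p) = foldr cAnd (code p) (map (@code L) ps).
Proof. by elim: ps => //= q ps ->. Qed.

Lemma nat_rect_ext b (f g : nat -> nat -> nat) k : (forall i a, i < k -> f i a = g i a) ->
  nat_rect (fun=> nat) b f k = nat_rect (fun=> nat) b g k.
Proof. by elim: k => //= k IH H; rewrite IH ?H // => i a Hi; apply: H; apply: ltnW. Qed.

Lemma foldr_iota (h : nat -> nat -> nat) c m k :
  foldr h c (iota m k) = nat_rect (fun=> nat) c (fun i acc => h (m + (k - i.+1)) acc) k.
Proof.
elim: k m => //= k IH m; rewrite -/(iota m.+1 k) IH subnn addn0; congr h.
by apply: nat_rect_ext => i a Hi; congr h; lia.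
Qed.

Definition klist (s : seq nat) : nat := foldr cpair 0 s.

Lemma edec_klist s i : i < size s -> edec (klist s) i = nth 0 s i.
Proof. by elim: s i => //= x s IH [|i] Hi; rewrite edec_cons //= IH. Qed.

Section TranslationCodes.
Variables (L L' : signature) (fs : seq (fsym L)) (rs : seq (rsym L)).
Local Notation trans := (translation L L').

Definition kseq (k : trans) : seq nat :=
  [:: tdim k; tpar k; code (tparam k); code (tdom k); code (teq k)] ++
  [seq code (trel k r) | r <- rs] ++ [seq code (tfun k f) | f <- fs].

Definition kcode (k : trans) : nat := klist (kseq k).

(* Computability in the finite part of a translation and a further argument. *)
Definition kcomp (g : trans -> nat -> nat) : Prop :=
  exists2 F, comp F & forall k x, g k x = F (cpair (kcode k) x).

Lemma kcomp_ext g h : (forall k x, g k x = h k x) -> kcomp g -> kcomp h.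
Proof. by move=> E [F HF HE]; exists F => // k x; rewrite -E. Qed.

Lemma kcomp_arg f : comp f -> kcomp (fun k x => f x).
Proof.
by move=> Hf; exists (fun z => f (csnd z)) => [|k x]; [apply: comp_app Hf (comp_snd comp_id) | rewrite cpE].
Qed.

Lemma kcomp_const c : kcomp (fun k x => c).
Proof. by apply: kcomp_arg; apply: comp_const. Qed.

Lemma kcomp_edec i g : i < 5 + (size rs + size fs) -> (forall k, nth 0 (kseq k) i = g k) -> kcomp (fun k x => g k).
Proof.
move=> Hi Hg; exists (fun z => edec (cfst z) i) => [|k x]; first exact/comp_edec/comp_fst/comp_id.
by rewrite cpE edec_klist ?Hg // size_cat size_cat !size_map.
Qed.

Lemma kcomp_dim : kcomp (fun k x => tdim k). Proof. exact: (@kcomp_edec 0). Qed.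
Lemma kcomp_par : kcomp (fun k x => tpar k). Proof. exact: (@kcomp_edec 1). Qed.
Lemma kcomp_param : kcomp (fun k x => code (tparam k)). Proof. exact: (@kcomp_edec 2). Qed.
Lemma kcomp_dom : kcomp (fun k x => code (tdom k)). Proof. exact: (@kcomp_edec 3). Qed.
Lemma kcomp_eq : kcomp (fun k x => code (teq k)). Proof. exact: (@kcomp_edec 4). Qed.

Lemma nth_kseq_rel k r : r \in rs -> nth 0 (kseq k) (5 + index r rs) = code (trel k r).
Proof.
move=> Hr; have Hi : index r rs < size rs by rewrite index_mem.
by rewrite /kseq nth_cat ltnNge leq_addr /= addKn nth_cat size_map Hi (nth_map r) // nth_index.
Qed.

Lemma nth_kseq_fun k f : f \in fs -> nth 0 (kseq k) (5 + (size rs + index f fs)) = code (tfun k f).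
Proof.
move=> Hf; have Hi : index f fs < size fs by rewrite index_mem.
by rewrite /kseq nth_cat ltnNge leq_addr /= addKn nth_cat size_map ltnNge leq_addr /= addKn (nth_map f) // nth_index.
Qed.

Lemma kcomp_rel r : r \in rs -> kcomp (fun k x => code (trel k r)).
Proof.
move=> Hr; apply: (@kcomp_edec (5 + index r rs)) => [|k]; last exact: nth_kseq_rel.
by rewrite ltn_add2l (leq_trans _ (leq_addr _ _)) // index_mem.
Qed.

Lemma kcomp_fun f : f \in fs -> kcomp (fun k x => code (tfun k f)).
Proof.
move=> Hf; apply: (@kcomp_edec (5 + (size rs + index f fs))) => [|k]; last exact: nth_kseq_fun.
by rewrite !ltn_add2l index_mem.
Qed.

Lemma kcomp_pair g h : kcomp g -> kcomp h -> kcomp (fun k x => cpair (g k x) (h k x)).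
Proof.
by move=> [F HF E] [F' HF' E']; exists (fun z => cpair (F z) (F' z)) => [|k x]; [apply: comp_pair | rewrite E E'].
Qed.

Lemma kcomp_add g h : kcomp g -> kcomp h -> kcomp (fun k x => g k x + h k x).
Proof.
by move=> [F HF E] [F' HF' E']; exists (fun z => F z + F' z) => [|k x]; [apply: comp_add | rewrite E E'].
Qed.

Lemma kcomp_sub g h : kcomp g -> kcomp h -> kcomp (fun k x => g k x - h k x).
Proof.
by move=> [F HF E] [F' HF' E']; exists (fun z => F z - F' z) => [|k x]; [apply: comp_sub | rewrite E E'].
Qed.

Lemma kcomp_mul g h : kcomp g -> kcomp h -> kcomp (fun k x => g k x * h k x).
Proof.
by move=> [F HF E] [F' HF' E']; exists (fun z => F z * F' z) => [|k x]; [apply: comp_mul | rewrite E E'].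
Qed.

Lemma kcomp_subst g h : kcomp g -> kcomp h -> kcomp (fun k x => g k (h k x)).
Proof.
move=> [F HF E] [F' HF' E']; exists (fun z => F (cpair (cfst z) (F' z))) => [|k x].
  by apply: comp_app HF _; apply: comp_pair => //; apply/comp_fst/comp_id.
by rewrite cpE E E'.
Qed.

Lemma kcomp_rec b s n : kcomp b -> kcomp s -> kcomp n ->
  kcomp (fun k x => nat_rect (fun=> nat) (b k x) (fun i acc => s k (cpair x (cpair i acc))) (n k x)).
Proof.
move=> [B HB EB] [S HS ES] [N HN EN].
have HS' : comp (fun z => S (cpair (cfst (cfst z)) (cpair (csnd (cfst z)) (csnd z)))).
  by apply: comp_app HS _; do ![exact: comp_id | apply: comp_pair | apply: comp_fst | apply: comp_snd].
eexists; first exact: comp_rec HB HS' HN.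
move=> k x /=; rewrite EB EN; apply: nat_rect_ext => i a _.
by rewrite ES !cpE.
Qed.

Lemma kcomp_Imp g h : kcomp g -> kcomp h -> kcomp (fun k x => cImp (g k x) (h k x)).
Proof. by move=> Hg Hh; do ![exact: kcomp_const | apply: kcomp_pair]. Qed.

Lemma kcomp_Neg g : kcomp g -> kcomp (fun k x => cNeg (g k x)).
Proof. by move=> Hg; apply: kcomp_Imp Hg (kcomp_const _). Qed.

Lemma kcomp_And g h : kcomp g -> kcomp h -> kcomp (fun k x => cAnd (g k x) (h k x)).
Proof. by move=> Hg Hh; do ![apply: kcomp_Neg | apply: kcomp_Imp]. Qed.

Lemma kcomp_All g : kcomp g -> kcomp (fun k x => cAll (g k x)).
Proof. by move=> Hg; apply: kcomp_pair => //; apply: kcomp_const. Qed.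

Lemma kcomp_snd2 : kcomp (fun _ x => csnd (csnd x)).
Proof. by apply: (kcomp_arg (f := fun x => csnd (csnd x))); do 2!apply: comp_snd; apply: comp_id. Qed.

Lemma kcomp_iter h n c : kcomp (fun _ => h) -> kcomp n -> kcomp c ->
  kcomp (fun k x => iter (n k x) h (c k x)).
Proof.
move=> Hh Hn Hc; apply: kcomp_ext (kcomp_rec Hc (kcomp_subst Hh kcomp_snd2) Hn) => k x.
by elim: (n k x) => //= m ->; rewrite !cpE.
Qed.

Lemma kcomp_iterAll n c : kcomp n -> kcomp c -> kcomp (fun k x => iter (n k x) cAll (c k x)).
Proof. by apply: kcomp_iter; apply: kcomp_All (kcomp_arg comp_id). Qed.

Lemma kcomp_iterEx n c : kcomp n -> kcomp c -> kcomp (fun k x => iter (n k x) cEx (c k x)).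
Proof. by apply: kcomp_iter; apply/kcomp_Neg/kcomp_All/kcomp_Neg/(kcomp_arg comp_id). Qed.

Definition ceqblk (a b len c : nat) := foldr (fun j acc => cAnd (cEqv (a + j) (b + j)) acc) c (iota 0 len).

Lemma code_eqblk a b len (q : form L') : code (eqblk a b len q) = ceqblk a b len (code q).
Proof. by rewrite /eqblk code_Ands /ceqblk; elim: (iota 0 len) => //= j s ->. Qed.

Lemma kcomp_eqblk a b len c : kcomp a -> kcomp b -> kcomp len -> kcomp c ->
  kcomp (fun k x => ceqblk (a k x) (b k x) (len k x) (c k x)).
Proof.
move=> Ha Hb Hl Hc.
have H1 : kcomp (fun _ x => cfst x) by apply: (kcomp_arg (comp_fst comp_id)).
have Hj : kcomp (fun k x => len k (cfst x) - (cfst (csnd x)).+1).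
  apply: kcomp_sub; first exact: kcomp_subst Hl H1.
  by apply: (kcomp_arg (f := fun x => (cfst (csnd x)).+1)); apply/comp_succ/comp_fst/comp_snd/comp_id.
have Hs : kcomp (fun k x => let j := len k (cfst x) - (cfst (csnd x)).+1 in
    cAnd (cEqv (a k (cfst x) + j) (b k (cfst x) + j)) (csnd (csnd x))).
  apply: kcomp_And kcomp_snd2.
  by do ![exact: Hj | exact: kcomp_const | apply: kcomp_pair | apply: kcomp_add | exact: kcomp_subst Ha H1 | exact: kcomp_subst Hb H1].
apply: kcomp_ext (kcomp_rec Hc Hs Hl) => k x; rewrite /ceqblk foldr_iota.
by apply: nat_rect_ext => i acc _; rewrite !cpE.
Qed.

Lemma kcomp_foldr (T : Type) (s : seq T) (h : T -> trans -> nat -> nat -> nat) c :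
  (forall i g, kcomp g -> kcomp (fun k x => h i k x (g k x))) -> kcomp c ->
  kcomp (fun k x => foldr (fun i acc => h i k x acc) (c k x) s).
Proof. by move=> Hh Hc; elim: s => //= i s IH; apply: Hh. Qed.

Lemma kcomp_wapply n p b w : kcomp (fun k x => code (p k)) -> (forall i, kcomp (b i)) -> kcomp w ->
  kcomp (fun k x => code (wapply k n (p k) (fun i => b i k x) (w k x))).
Proof.
move=> Hp Hb Hw.
have HK : kcomp (fun k x => n * tdim k + tpar k).
  by do ![exact: kcomp_const | exact: kcomp_dim | exact: kcomp_par | apply: kcomp_add | apply: kcomp_mul].
have Hnd i : kcomp (fun k x => i * tdim k) by apply: kcomp_mul (kcomp_const _) kcomp_dim.
have Hend : kcomp (fun k x => ceqblk (n * tdim k) (n * tdim k + tpar k + w k x) (tpar k) (code (p k))).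
  by apply: kcomp_eqblk => //; [apply: kcomp_add | exact: kcomp_par].
have Hf := @kcomp_foldr nat (iota 0 n) (fun i k x acc => ceqblk (i * tdim k) (n * tdim k + tpar k + b i k x) (tdim k) acc) _ _ Hend.
apply: kcomp_ext (kcomp_iterEx HK (Hf _)) => [k x|i g Hg]; last first.
  by apply: kcomp_eqblk => //; [apply: kcomp_add | exact: kcomp_dim].
rewrite /wapply code_Exs; congr iter; elim: (iota 0 n) => [|i s IH] /=; first by rewrite code_eqblk.
by rewrite code_eqblk IH.
Qed.

Lemma kcomp_wunnest n m (a : 'I_n -> term L) (den : 'I_n -> trans -> nat -> nat -> nat -> form L') p s w y :
  (forall i gs gw gy, kcomp gs -> kcomp gw -> kcomp gy ->
     kcomp (fun k x => code (den i k (gs k x) (gw k x) (gy k x)))) ->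
  kcomp (fun k x => code (p k)) -> kcomp s -> kcomp w -> kcomp y ->
  kcomp (fun k x => code (wunnest k m a (fun i => den i k) (p k) (s k x) (w k x) (y k x))).
Proof.
move=> Hden Hp Hs Hw Hy; pose nv := [seq i <- enum 'I_n | ~~ is_var (a i)].
have Hmul c : kcomp (fun k x => c * tdim k) by apply: kcomp_mul (kcomp_const _) kcomp_dim.
have Hadd g : kcomp g -> kcomp (fun k x => size nv * tdim k + g k x) by move=> Hg; apply: kcomp_add.
pose b i k x := if insub i is Some i then if a i is Var v then size nv * tdim k + s k x + v * tdim k
  else index i nv * tdim k else size nv * tdim k + y k x.
have Hb i : kcomp (b i).
  rewrite /b; case: (insub i) => [i'|]; last exact: Hadd.
  by case: (a i') => [v|f c] //; apply: kcomp_add (Hadd _ Hs) _.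
have Hend : kcomp (fun k x => code (wapply k m (p k) (fun i => b i k x) (size nv * tdim k + w k x))).
  exact: kcomp_wapply Hp Hb (Hadd _ Hw).
have Hf := @kcomp_foldr 'I_n nv (fun i k x acc => cAnd (code (And (wapply k 1 (tdom k) (fun=> index i nv * tdim k) (size nv * tdim k + w k x))
   (den i k (size nv * tdim k + s k x) (size nv * tdim k + w k x) (index i nv * tdim k)))) acc) _ _ Hend.
apply: kcomp_ext (kcomp_iterEx (Hmul (size nv)) (Hf _)) => [k x|i g Hg]; last first.
  apply: kcomp_And Hg; apply: kcomp_And.
    exact: (@kcomp_wapply 1 (fun k => tdom k) (fun _ k x => index i nv * tdim k) _ kcomp_dom (fun=> Hmul _) (Hadd _ Hw)).
  by apply: Hden => //; apply: Hadd.
rewrite /wunnest code_Exs -/nv; congr iter; by rewrite code_Ands -map_comp foldr_map.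
Qed.

Local Notation inF := (fun f => f \in fs).
Local Notation inR := (fun r => r \in rs).

Lemma kcomp_wden t : tsym_in inF t -> forall gs gw gy, kcomp gs -> kcomp gw -> kcomp gy ->
  kcomp (fun k x => code (wden k t (gs k x) (gw k x) (gy k x))).
Proof.
elim/term_ind': t => [v|f a IH] /= Ht gs gw gy Hs Hw Hy.
  apply: kcomp_ext (@kcomp_wapply 2 (fun k => teq k) (fun i k x => if i is 0 then gs k x + v * tdim k else gy k x) gw kcomp_eq _ Hw) => //.
  by case=> [|i] //; apply: kcomp_add => //; apply: kcomp_mul (kcomp_const _) kcomp_dim.
case: Ht => Hf Ha.
apply: (@kcomp_wunnest _ _ _ (fun i k => wden k (a i))) => //; last exact: kcomp_fun.
by move=> i ? ? ? ? ? ?; apply: IH.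
Qed.

Lemma kcomp_wtform p : sym_in inF inR p -> forall gw, kcomp gw -> kcomp (fun k x => code (wtform k p (gw k x))).
Proof.
elim: p => [|t u|r a|p IHp q IHq|p IHp] /= Hs gw Hw.
- exact: kcomp_const.
- apply: (@kcomp_wunnest _ _ _ (fun i k => wden k (pair_args t u i)) (fun k => teq k) (fun _ _ => 0) _ (fun _ _ => 0)) => //.
  + by move=> i ? ? ? ? ? ?; apply: kcomp_wden => //; case: Hs => ? ?; rewrite /pair_args; case: ifP.
  + exact: kcomp_eq.
  + exact: kcomp_const.
  + exact: kcomp_const.
- case: Hs => Hr Ha.
  apply: (@kcomp_wunnest _ _ _ (fun i k => wden k (a i)) (fun k => trel k r) (fun _ _ => 0) _ (fun _ _ => 0)) => //.
  + by move=> i ? ? ? ? ? ?; apply: kcomp_wden.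
  + exact: kcomp_rel.
  + exact: kcomp_const.
  + exact: kcomp_const.
- by case: Hs => Hp Hq; apply: kcomp_Imp; [apply: IHp | apply: IHq].
- have Hdw : kcomp (fun k x => tdim k + gw k x) by apply: kcomp_add kcomp_dim Hw.
  apply: kcomp_ext (kcomp_iterAll kcomp_dim (kcomp_Imp (@kcomp_wapply 1 (fun k => tdom k) (fun _ _ _ => 0) _ kcomp_dom (fun=> kcomp_const 0) Hdw) (IHp Hs _ Hdw))) => k x.
  by rewrite code_Alls.
Qed.

(** The position of the parameters and the index of the family are themselves computed from the
    translation and the argument, as happens below quantifiers, where the position moves by the
    dimension. *)
Definition kfam (fam : nat -> form L) : Prop :=
  forall gw gn, kcomp gw -> kcomp gn -> kcomp (fun k x => code (wtform k (fam (gn k x)) (gw k x))).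

Lemma kfam_const p : sym_in inF inR p -> kfam (fun=> p).
Proof. by move=> Hp gw gn Hw _; apply: kcomp_wtform. Qed.

Lemma kfam_Imp p q : kfam p -> kfam q -> kfam (fun n => Imp (p n) (q n)).
Proof. by move=> Hp Hq gw gn Hw Hn; apply: kcomp_Imp; [apply: Hp | apply: Hq]. Qed.

Definition cwall (k : trans) (w c : nat) : nat :=
  iter (tdim k) cAll (cImp (code (wapply k 1 (tdom k) (fun=> 0) (tdim k + w))) c).

Lemma kcomp_cwall w c : kcomp w -> kcomp c -> kcomp (fun k x => cwall k (w k x) (c k x)).
Proof.
move=> Hw Hc; apply: (kcomp_iterAll kcomp_dim); apply: kcomp_Imp Hc.
exact: (@kcomp_wapply 1 (fun k => tdom k) (fun _ _ _ => 0) _ kcomp_dom (fun=> kcomp_const 0) (kcomp_add kcomp_dim Hw)).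
Qed.

Lemma code_wtform_All k p w : code (wtform k (All p) w) = cwall k w (code (wtform k p (tdim k + w))).
Proof. by rewrite /= code_Alls. Qed.

Lemma kfam_All p : kfam p -> kfam (fun n => All (p n)).
Proof.
move=> Hp gw gn Hw Hn.
apply: kcomp_ext (kcomp_cwall Hw (Hp _ _ (kcomp_add kcomp_dim Hw) Hn)) => k x.
by rewrite code_wtform_All.
Qed.

Lemma kfam_Bot : kfam (fun=> Bot). Proof. exact: kfam_const. Qed.
Lemma kfam_Neg p : kfam p -> kfam (fun n => Neg (p n)).
Proof. by move=> Hp; apply: kfam_Imp Hp kfam_Bot. Qed.
Lemma kfam_And p q : kfam p -> kfam q -> kfam (fun n => And (p n) (q n)).
Proof. by move=> Hp Hq; apply/kfam_Neg/kfam_Imp => //; apply: kfam_Neg. Qed.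
Lemma kfam_Or p q : kfam p -> kfam q -> kfam (fun n => Or (p n) (q n)).
Proof. by move=> Hp Hq; apply: kfam_Imp => //; apply: kfam_Neg. Qed.
Lemma kfam_Exs m p : kfam p -> kfam (fun n => Exs m (p n)).
Proof. by move=> Hp; elim: m => //= m IH; apply/kfam_Neg/kfam_All/kfam_Neg. Qed.
Lemma kfam_Ands ps p : (forall q, List.In q ps -> sym_in inF inR q) -> kfam p -> kfam (fun n => Ands ps (p n)).
Proof.
move=> + Hp; elim: ps => //= q ps IH Hq; apply: kfam_And; first by apply/kfam_const/Hq; left.
by apply: IH => r Hr; apply: Hq; right.
Qed.

Fixpoint cwexs (m : nat) (k : trans) (w c : nat) : nat :=
  if m is m'.+1 then cNeg (cwall k w (cNeg (cwexs m' k (tdim k + w) c))) else c.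

Lemma code_wtform_Exs m k p w : code (wtform k (Exs m p) w) = cwexs m k w (code (wtform k p (m * tdim k + w))).
Proof.
elim: m w => // m IH w.
rewrite -[LHS]/(cNeg (code (wtform k (All (Neg (Exs m p))) w))) code_wtform_All.
rewrite -[code (wtform k (Neg _) _)]/(cNeg (code (wtform k (Exs m p) (tdim k + w)))) IH /=.
by rewrite mulSnr -addnA.
Qed.

Lemma kcomp_cwexs m w c : kcomp w -> kcomp c -> kcomp (fun k x => cwexs m k (w k x) (c k x)).
Proof.
move=> + Hc; elim: m w => //= m IH w Hw; apply/kcomp_Neg/kcomp_cwall/kcomp_Neg => //.
by apply: IH; apply: kcomp_add kcomp_dim Hw.
Qed.

(* The position of the parameters moves at each step of the iteration, which
   is therefore computed from the innermost position outwards. *)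
Lemma kfam_iter m step p0 : sym_in inF inR step -> sym_in inF inR p0 ->
  kfam (fun n => iter n (fun q => Exs m (And step q)) p0).
Proof.
move=> Hstep Hp0 gw gn Hw Hn.
pose pos k x j := j * (m * tdim k) + gw k x.
pose ctx k w c := cwexs m k w (cAnd (code (wtform k step (m * tdim k + w))) c).
have Hmd : kcomp (fun k x => m * tdim k) by apply: kcomp_mul (kcomp_const _) kcomp_dim.
have E k n w : code (wtform k (iter n (fun q => Exs m (And step q)) p0) w) =
    nat_rect (fun=> nat) (code (wtform k p0 (n * (m * tdim k) + w)))
      (fun i acc => ctx k ((n - i.+1) * (m * tdim k) + w) acc) n.
  elim: n w => // n IH w; rewrite iterS code_wtform_Exs.
  rewrite -[code (wtform k (And _ _) _)]/(cAnd (code (wtform k step (m * tdim k + w))) (code (wtform k _ (m * tdim k + w)))) IH.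
  rewrite [RHS]/= subnn mul0n add0n {2}/ctx.
  congr cwexs; congr cAnd; rewrite mulSnr -addnA; apply: nat_rect_ext => i a Hi; rewrite /ctx.
  have -> // : (n - i.+1) * (m * tdim k) + (m * tdim k + w) = (n.+1 - i.+1) * (m * tdim k) + w.
  by rewrite addnA -mulSnr -subSn.
have Hb : kcomp (fun k x => code (wtform k p0 (gn k x * (m * tdim k) + gw k x))).
  by apply: kcomp_wtform => //; apply: kcomp_add => //; apply: kcomp_mul.
have H1 : kcomp (fun _ x => cfst x) by apply: (kcomp_arg (comp_fst comp_id)).
have Hpos : kcomp (fun k x => (gn k (cfst x) - (cfst (csnd x)).+1) * (m * tdim k) + gw k (cfst x)).
  apply: kcomp_add (kcomp_subst Hw H1); apply: kcomp_mul Hmd.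
  apply: kcomp_sub (kcomp_subst Hn H1) _.
  by apply: (kcomp_arg (f := fun x => (cfst (csnd x)).+1)); apply/comp_succ/comp_fst/comp_snd/comp_id.
have Hs : kcomp (fun k x => ctx k ((gn k (cfst x) - (cfst (csnd x)).+1) * (m * tdim k) + gw k (cfst x)) (csnd (csnd x))).
  apply: kcomp_cwexs => //; apply: kcomp_And kcomp_snd2.
  by apply: kcomp_wtform => //; apply: kcomp_add.
apply: kcomp_ext (kcomp_rec Hb Hs Hn) => k x; rewrite E.
by apply: nat_rect_ext => i a _; rewrite !cpE.
Qed.

Lemma kcomp_wtranslate fam : kfam fam -> kcomp (fun k x => code (wtranslate k (fam x))).
Proof.
move=> Hf; apply: kcomp_ext (kcomp_And (kcomp_iterEx kcomp_par kcomp_param)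
  (kcomp_iterAll kcomp_par (kcomp_Imp kcomp_param (Hf (fun _ _ => 0) (fun _ x => x) (kcomp_const 0) (kcomp_arg comp_id))))) => k x.
by rewrite -code_Exs -[cImp _ _]/(code (Imp (tparam k) (wtform k (fam x) 0))) -code_Alls.
Qed.

Definition guard (b c : nat) : form L' := if bounded b (decode L' c) then decode L' c else Bot.

Lemma guardP b c : bounded b (guard b c).
Proof. by rewrite /guard; case: ifP. Qed.

(* A left inverse of [kcode], up to the symbols that are not listed. *)
Definition ktrans (z : nat) : trans :=
  let d := (edec z 0).-1.+1 in let P := edec z 1 in
  @Translation L L' d P
    (guard P (edec z 2)) (guard (d + P) (edec z 3)) (guard (2 * d + P) (edec z 4))
    (fun r => guard (rar r * d + P) (edec z (5 + index r rs)))
    (fun f => guard ((far f).+1 * d + P) (edec z (5 + (size rs + index f fs))))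
    (ltn0Sn _) (guardP _ _) (guardP _ _) (guardP _ _) (fun r => guardP _ _) (fun f => guardP _ _).

Definition isform (b c : nat) : Prop := exists2 p : form L', bounded b p & code p = c.

Lemma code_guard b c : isform b c -> code (guard b c) = c.
Proof. by case=> p Hp <-; rewrite /guard codeK Hp. Qed.

Definition klen := 5 + (size rs + size fs).

(** The first condition excludes anything beyond the listed entries, the second says that the
    dimension is positive. *)
Definition wfk (z : nat) : Prop :=
  [/\ z = klist [seq edec z i | i <- iota 0 klen], edec z 0 = (edec z 0).-1.+1,
      isform (edec z 1) (edec z 2) /\ isform (edec z 0 + edec z 1) (edec z 3) /\
        isform (2 * edec z 0 + edec z 1) (edec z 4),
      forall r, r \in rs -> isform (rar r * edec z 0 + edec z 1) (edec z (5 + index r rs)) &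
      forall f, f \in fs -> isform ((far f).+1 * edec z 0 + edec z 1) (edec z (5 + (size rs + index f fs)))].

Hypotheses (fs_uniq : uniq fs) (rs_uniq : uniq rs).

Lemma size_kseq k : size (kseq k) = klen.
Proof. by rewrite /kseq size_cat size_cat !size_map. Qed.

Lemma wfkP z : wfk z <-> exists k, kcode k = z.
Proof.
split=> [[Hz Hd [H2 [H3 H4]] Hr Hf] | [k <-]].
  exists (ktrans z); rewrite [RHS]Hz /kcode; congr klist.
  apply: (@eq_from_nth _ 0); first by rewrite size_kseq size_map size_iota.
  move=> i; rewrite size_kseq => Hi; rewrite (nth_map 0) ?size_iota // nth_iota // add0n.
  have Hd' := esym Hd.
  case: (ltnP i 5) => Hi5.
    case: i Hi Hi5 => [|[|[|[|[|//]]]]] _ _ /=; rewrite ?code_guard //; by rewrite Hd'.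
  rewrite /kseq nth_cat ltnNge Hi5 /= nth_cat size_map; case: ltnP => Hir.
    have r0 : rsym L by case: (rs) Hir.
    rewrite (nth_map r0) //= index_uniq // subnKC // code_guard // Hd'.
    by have := Hr (nth r0 rs (i - 5)) (mem_nth _ Hir); rewrite index_uniq // subnKC.
  have Hif : i - 5 - size rs < size fs by move: Hi; rewrite /klen; lia.
  have f0 : fsym L by case: (fs) Hif.
  rewrite (nth_map f0) //= index_uniq // subnKC // subnKC // code_guard // Hd'.
  by have := Hf (nth f0 fs (i - 5 - size rs)) (mem_nth _ Hif); rewrite index_uniq // subnKC // subnKC.
have He i : i < klen -> edec (kcode k) i = nth 0 (kseq k) i by move=> Hi; rewrite edec_klist ?size_kseq.
split.
- rewrite {1}/kcode; congr klist; apply: (@eq_from_nth _ 0); first by rewrite size_kseq size_map size_iota.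
  by move=> i; rewrite size_kseq => Hi; rewrite (nth_map 0) ?size_iota // nth_iota // add0n He.
- by rewrite He //= prednK // tdim_gt0.
- rewrite !He //=; split; first by exists (tparam k) => //; apply: tparamP.
  by split; [exists (tdom k) => //; apply: tdomP | exists (teq k) => //; apply: teqP].
- move=> r Hr; exists (trel k r); first by rewrite (He 0) // (He 1) //; apply: trelP.
  by rewrite He ?nth_kseq_rel // /klen ltn_add2l (leq_trans _ (leq_addr _ _)) // index_mem.
- move=> f Hf; exists (tfun k f); first by rewrite (He 0) // (He 1) //; apply: tfunP.
  by rewrite He ?nth_kseq_fun // /klen !ltn_add2l index_mem.
Qed.

Variables (S : theory L') (S_ce : ce_theory S).

Local Notation ThS := (fun n => exists2 p, is_theorem S p & code p = n).

Lemma ThSP p : ThS (code p) <-> is_theorem S p.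
Proof. by split=> [[q Hq /code_inj <-] | H] //; exists p. Qed.

Lemma code_Alls_inv b (q : form L') c : code q = iter b cAll c -> exists2 p, q = Alls b p & code p = c.
Proof.
elim: b q => [|b IH] q /=; first by exists q.
by case: q => [|t u|r a|p q|p] /= /cpair_inj [] // _ /IH [p' -> <-]; exists p'.
Qed.

(* A formula is recognized by the provability of a tautology built from it. *)
Lemma isformP b c : isform b c <-> ThS (iter b cAll (cImp c c)).
Proof.
split=> [[p Hp <-] | [q [Hq _] /code_Alls_inv [p Eq]]].
  exists (Alls b (Imp p p)); last by rewrite code_Alls.
  have Hs : sentence (Alls b (Imp p p)) by rewrite /sentence bounded_Alls addn0 /= Hp.
  by apply/is_theoremP => // M e _; apply/sat_Alls => blk.
case: p Eq => [|t u|r a|p p'|p] Eq /= /cpair_inj [] // _ /cpair_inj [Ep _].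
exists p => //; move: Hq; rewrite Eq /sentence bounded_Alls addn0 /=.
by case/andP.
Qed.

(** The numbering of the symbols is arbitrary, so the syntax need not be decidable; its
    enumerability is inherited from the theorems of [S]. *)
Lemma ce_isform b c : comp b -> comp c -> ce (fun z => isform (b z) (c z)).
Proof.
move=> Hb Hc; apply: (ce_ext (fun z => iff_sym (isformP (b z) (c z)))).
apply: (ce_app (A := ThS)) => //.
have HA : comp (fun z => cAll (csnd (csnd z))).
  by apply: comp_pair (comp_const _) _; do 2!apply: comp_snd; apply: comp_id.
apply: comp_ext (comp_rec (_ : comp (fun z => cImp (c z) (c z))) HA Hb); last first.
  by do ![exact: comp_const | exact: Hc | apply: comp_pair].
by move=> z /=; elim: (b z) => //= m ->; rewrite !cpE.
Qed.

Lemma ce_all_in (T : eqType) (s : seq T) (B : T -> nat -> Prop) : (forall i, ce (B i)) ->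
  ce (fun z => forall i, i \in s -> B i z).
Proof.
move=> HB; elim: s => [|i s IH].
  by apply: ce_ext (ce_eq (comp_const 0) (comp_const 0)) => z; split.
apply: ce_ext (ce_and (HB i) IH) => z; split=> [[H1 H2] j | H]; first by rewrite inE => /orP [/eqP->|/H2].
by split=> [|j Hj]; apply: H; rewrite inE ?eqxx ?Hj ?orbT.
Qed.

Lemma ce_wfk : ce wfk.
Proof.
have Hd i : comp (fun z => edec z i) by apply: comp_edec comp_id.
have Hmul c : comp (fun z => c * edec z 0 + edec z 1) by apply: comp_add => //; apply: comp_mul => //; apply: comp_const.
have H1 : ce (fun z => z = klist [seq edec z i | i <- iota 0 klen]).
  apply: ce_eq comp_id _; elim: (iota 0 klen) => [|i s IH] /=; first exact: comp_const.
  exact: comp_pair.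
have H2 : ce (fun z => edec z 0 = (edec z 0).-1.+1) by apply: ce_eq => //; apply/comp_succ/comp_pred.
have H3 := ce_and (ce_isform (Hd 1) (Hd 2)) (ce_and (ce_isform (comp_add (Hd 0) (Hd 1)) (Hd 3)) (ce_isform (Hmul 2) (Hd 4))).
have H5 := @ce_all_in _ rs (fun r z => isform (rar r * edec z 0 + edec z 1) (edec z (5 + index r rs)))
  (fun r => ce_isform (Hmul _) (Hd _)).
have H6 := @ce_all_in _ fs (fun f z => isform ((far f).+1 * edec z 0 + edec z 1) (edec z (5 + (size rs + index f fs))))
  (fun f => ce_isform (Hmul _) (Hd _)).
apply: ce_ext (ce_and H1 (ce_and H2 (ce_and H3 (ce_and H5 H6)))) => z.
by split=> [[? [? [? []]]] | []].
Qed.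

(** The code of [phi k n] depends on [k] only through its finite part, so the quantifier over
    translations turns into one over numbers. *)
Lemma ce_ex_translation (phi : trans -> nat -> form L') : kcomp (fun k x => code (phi k x)) ->
  ce (fun n => exists k, is_theorem S (phi k n)).
Proof.
move=> [F HF EF].
apply: (@ce_ext (fun n => exists z, wfk z /\ ThS (F (cpair z n)))).
  move=> n; split=> [[z [/wfkP [k <-]]] | [k Hk]]; first by rewrite -EF => /ThSP; exists k.
  by exists (kcode k); split; [apply/wfkP; exists k | rewrite -EF; apply/ThSP].
apply: (@ce_ex (fun n z => wfk z /\ ThS (F (cpair z n)))); apply: ce_and.
  exact: ce_app (comp_snd comp_id) ce_wfk.
apply: (ce_app (A := ThS)) => //; apply: comp_app HF _.
by do ![exact: comp_id | apply: comp_pair | apply: comp_fst | apply: comp_snd].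
Qed.

End TranslationCodes.

(** * Restriction to finitely many symbols *)

Section Symbols.
Variable L : signature.

Fixpoint tfsyms (t : term L) : seq (fsym L) :=
  match t with
  | Var _ => [::]
  | Fun f a => f :: flatten (codom (fun i => tfsyms (a i)))
  end.

Fixpoint fsyms (p : form L) : seq (fsym L) :=
  match p with
  | Bot => [::]
  | Eq t u => tfsyms t ++ tfsyms u
  | Rel r a => flatten (codom (fun i => tfsyms (a i)))
  | Imp p q => fsyms p ++ fsyms q
  | All p => fsyms p
  end.

Fixpoint rsyms (p : form L) : seq (rsym L) :=
  match p with
  | Bot | Eq _ _ => [::]
  | Rel r a => [:: r]
  | Imp p q => rsyms p ++ rsyms q
  | All p => rsyms p
  end.

Lemma codom_subset (T : eqType) n (g : 'I_n -> seq T) (s : seq T) :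
  {subset flatten (codom g) <= s} -> forall i, {subset g i <= s}.
Proof. by move=> H i x Hx; apply: H; apply/flattenP; exists (g i) => //; apply: codom_f. Qed.

Lemma tsym_in_subset (fs : seq (fsym L)) t : {subset tfsyms t <= fs} -> tsym_in (fun f => f \in fs) t.
Proof.
elim/term_ind': t => //= f a IH H; split; first by apply: H; rewrite mem_head.
move=> i; apply: IH; apply: (codom_subset (g := fun i => tfsyms (a i))) => x Hx.
by apply: H; rewrite inE Hx orbT.
Qed.

Lemma cat_subset (T : eqType) (s t u : seq T) : {subset s ++ t <= u} -> {subset s <= u} /\ {subset t <= u}.
Proof. by move=> H; split=> x Hx; apply: H; rewrite mem_cat Hx ?orbT. Qed.

Lemma sym_in_subset (fs : seq (fsym L)) (rs : seq (rsym L)) p : {subset fsyms p <= fs} -> {subset rsyms p <= rs} ->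
  sym_in (fun f => f \in fs) (fun r => r \in rs) p.
Proof.
elim: p => //= [t u|r a|p IHp q IHq] .
- by move=> /cat_subset [Ht Hu] _; split; apply: tsym_in_subset.
- move=> Ha Hr; split; first by apply: Hr; rewrite mem_head.
  by move=> i; apply: tsym_in_subset; apply: (codom_subset (g := fun i => tfsyms (a i))).
- by move=> /cat_subset [H1 H2] /cat_subset [H3 H4]; split; [apply: IHp | apply: IHq].
Qed.

Lemma symbols_exist (ps : seq (form L)) : exists (fs : seq (fsym L)) (rs : seq (rsym L)), [/\ uniq fs, uniq rs &
  forall p, List.In p ps -> sym_in (fun f => f \in fs) (fun r => r \in rs) p].
Proof.
exists (undup (flatten (map fsyms ps))), (undup (flatten (map rsyms ps))).
rewrite !undup_uniq; split=> // p Hp; apply: sym_in_subset => x Hx; rewrite mem_undup.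
  elim: ps Hp => //= q ps IH [->|/IH H]; by rewrite mem_cat ?Hx // H orbT.
elim: ps Hp => //= q ps IH [->|/IH H]; by rewrite mem_cat ?Hx // H orbT.
Qed.

Variables (fs : seq (fsym L)) (rs : seq (rsym L)).
Local Notation inF := (fun f => f \in fs).
Local Notation inR := (fun r => r \in rs).

Lemma sym_in_Alls k p : sym_in inF inR (Alls k p) <-> sym_in inF inR p.
Proof. by elim: k. Qed.

Lemma sym_in_Exs k p : sym_in inF inR (Exs k p) <-> sym_in inF inR p.
Proof. by elim: k => //= k IH; rewrite -IH /=; tauto. Qed.

Lemma sym_in_And p q : sym_in inF inR (And p q) <-> sym_in inF inR p /\ sym_in inF inR q.
Proof. by rewrite /=; tauto. Qed.

Lemma sym_in_Ands ps p : sym_in inF inR (Ands ps p) <-> (forall q, List.In q ps -> sym_in inF inR q) /\ sym_in inF inR p.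
Proof.
elim: ps => [|q ps IH]; first by split=> [//|[]].
rewrite [Ands _ _]/(And q (Ands ps p)) [sym_in _ _ _]/= IH; split=> [[[Hq [[H Hp] _]] _] | [H Hp]].
  by split=> // r /In_cons [->|/H].
by do ![split] => //; [apply: H; left | move=> r Hr; apply: H; right].
Qed.

Lemma sym_in_Imps ps p : (forall q, List.In q ps -> sym_in inF inR q) -> sym_in inF inR p -> sym_in inF inR (Imps ps p).
Proof.
move=> + Hp; elim: ps => //= q ps IH H; split; first by apply: H; left.
by apply: IH => r Hr; apply: H; right.
Qed.

Lemma sym_in_eqs n q : List.In q (eqs L n) -> sym_in inF inR q.
Proof. by move/In_map => [i _ ->]. Qed.

Lemma sym_in_id_list q : List.In q (id_list fs rs) -> sym_in inF inR q.
Proof.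
have Hv n k i : tsym_in inF (vars L n k i) by rewrite ffunE.
rewrite /id_list => -[<-|[<-|[<-|]]] //.
move=> /List.in_app_iff [/In_map [r /In_mem Hr ->]|].
  by apply/sym_in_Alls/sym_in_Imps; [exact: sym_in_eqs |].
move=> /List.in_app_iff [/In_map [f /In_mem Hf ->]|].
  by apply/sym_in_Alls/sym_in_Imps; [exact: sym_in_eqs |].
move=> /List.in_app_iff [/In_map [f /In_mem Hf ->]|/In_map [f /In_mem Hf ->]].
  by apply/sym_in_Alls.
by apply/sym_in_Alls.
Qed.

End Symbols.

Definition single (L : signature) (p : form L) (Hp : sentence p) : theory L.
Proof. by refine (@Theory L (fun q => q = p) _) => q ->. Defined.

Lemma single_finite (L : signature) (p : form L) Hp : finitely_axiomatized (@single L p Hp).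
Proof. by exists [:: p] => q; split=> [->|[E|//]]; [left | exact: esym E]. Qed.

Lemma single_subtheory (L : signature) (X : theory L) (p : form L) Hp : is_theorem X p -> subtheory (@single L p Hp) X.
Proof.
move=> HX q Hq; have Hs := Hq.1; apply/is_theoremP => // M e HM.
move/(is_theoremP _ Hs): Hq => Hq; apply: Hq => _ ->.
exact: ((is_theoremP _ Hp).1 HX M e HM).
Qed.

(** * Interpretability as provability of a single translated sentence *)

Section Interpretation.
Variables (L : signature) (fs : seq (fsym L)) (rs : seq (rsym L)).
Local Notation inF := (fun f => f \in fs).
Local Notation inR := (fun r => r \in rs).

(** The added conjuncts are logically valid, so they are interpreted along with [p]; their
    translations turn the interpreted structure into a model. *)
Definition with_ids (p : form L) : form L := Ands (id_list fs rs) p.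

Lemma sentence_with_ids p : sentence p -> sentence (with_ids p).
Proof.
by move=> Hp; rewrite /sentence bounded_Ands -/(sentence p) Hp andbT; apply: all_In => q /id_list_sentence.
Qed.

Lemma interprets_with_ids (V : theory L) p Hp : interprets V (@single L p Hp) ->
  exists k, is_theorem V (wtranslate k (with_ids p)).
Proof.
case=> k Hk; exists k; apply/translateE; first exact: sentence_with_ids.
apply: Hk; apply/is_theoremP; first exact: sentence_with_ids.
move=> M e HM; apply/sat_Ands; split=> [q|]; first exact: id_list_valid.
exact: HM.
Qed.

Section DefaultSymbols.
Variable k : translation L L.
Local Notation d := (tdim k).
Local Notation P := (tpar k).

(* Unlisted relation symbols become empty, and unlisted function symbols
   constant, with an additional parameter as value. *)
Definition default_param : form L := And (tparam k) (tapply k 1 (tdom k) (fun _ j => P + j) id).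
Definition default_rel (r : rsym L) : form L := if r \in rs then trel k r else Bot.
Definition default_fun (f : fsym L) : form L := if f \in fs then tfun k f else
  tapply k 2 (teq k) (fun i j => if i is 0 then (far f).+1 * d + (P + j) else far f * d + j) (fun j => (far f).+1 * d + j).

Lemma default_paramP : bounded (P + d) default_param.
Proof.
rewrite bounded_And (bounded_mono _ (tparamP k)) ?leq_addr //=.
apply: bounded_tapply => [|i j _ Hj|j Hj]; [by rewrite mul1n tdomP | by rewrite ltn_add2l | by rewrite (leq_trans Hj) ?leq_addr].
Qed.

Lemma default_domP : bounded (d + (P + d)) (tdom k).
Proof. by apply: bounded_mono (tdomP k); rewrite leq_add2l leq_addr. Qed.

Lemma default_eqP : bounded (2 * d + (P + d)) (teq k).
Proof. by apply: bounded_mono (teqP k); rewrite leq_add2l leq_addr. Qed.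

Lemma default_relP r : bounded (rar r * d + (P + d)) (default_rel r).
Proof.
rewrite /default_rel; case: ifP => // _.
by apply: bounded_mono (trelP k r); rewrite leq_add2l leq_addr.
Qed.

Lemma default_funP f : bounded ((far f).+1 * d + (P + d)) (default_fun f).
Proof.
rewrite /default_fun; case: ifP => [_|_].
  by apply: bounded_mono (tfunP k f); rewrite leq_add2l leq_addr.
apply: bounded_tapply => [|[|i] j _ Hj|j Hj]; first exact: teqP.
- by rewrite !ltn_add2l.
- by apply: leq_trans (leq_addr _ _); rewrite mulSn addnC ltn_add2r.
- by rewrite ltn_add2l (leq_trans Hj) ?leq_addr.
Qed.

Definition default_trans : translation L L :=
  @Translation L L d (P + d) default_param (tdom k) (teq k) default_rel default_fun
    (tdim_gt0 k) default_paramP default_domP default_eqP default_relP default_funP.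

Variables (M : model L) (w : nat -> M).
Hypothesis Hc : tdomain k w (fun j => w (P + j)).
Hypothesis HL : laws k w inF inR.

Lemma default_graph f a y : f \notin fs -> tgraph default_trans w f a y <-> tequal k w (fun j => w (P + j)) y.
Proof.
move=> Hf; pose e v := if v < (far f).+1 * d then (if v %/ d < far f then a (v %/ d) else y) (v %% d)
  else w (v - (far f).+1 * d).
have -> : tgraph default_trans w f a y <-> sat e (default_fun f) by [].
rewrite /default_fun (negbTE Hf) sat_tapply.
have He j : e ((far f).+1 * d + j) = w j by rewrite /e ltnNge leq_addr /= addKn.
have -> : (fun j => e ((far f).+1 * d + j)) = w by apply: funext.
apply: tsat_ext => -[|i] j _ Hj; first exact: He.
have Hlt : far f * d + j < (far f).+1 * d by rewrite mulSn addnC ltn_add2r.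
rewrite /e Hlt divnMDl ?tdim_gt0 // (divn_small Hj) addn0 ltnn modnMDl modn_small //.
Qed.

Lemma default_laws : laws default_trans w (fun=> True) (fun=> True).
Proof.
split.
- exact: (law_point HL).
- exact: (law_refl HL).
- exact: (law_eq HL).
- move=> r _ a a' Ha Ha' Haa; rewrite /trelation /= /default_rel.
  by case: ifP => // Hr; apply: (law_rel HL Hr).
- move=> f _ a a' y y' Ha Ha' Hy Hy' Haa.
  case: (boolP (f \in fs)) => Hf; last first.
    move=> /(default_graph _ _ Hf) H1 /(default_graph _ _ Hf) H2.
    by apply: (law_trans HL Hy Hc Hy') => //; apply: (law_sym HL).
  rewrite /tgraph /= /default_fun Hf; exact: (law_fun HL Hf Ha Ha' Hy Hy' Haa).
- move=> f _ a Ha; case: (boolP (f \in fs)) => Hf; last first.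
    by exists (fun j => w (P + j)) => //; apply/(default_graph _ _ Hf)/(law_refl HL).
  rewrite /tgraph /= /default_fun Hf; exact: (law_total HL Hf Ha).
Qed.

Lemma default_represents (N : model L) (v : (nat -> M) -> N) :
  represents default_trans w (fun=> True) (fun=> True) v -> represents k w inF inR v.
Proof.
move=> [H1 H2 H3 H4 H5]; split=> //.
- by move=> r Hr a Ha; have := H3 r I a Ha; rewrite /trelation /= /default_rel Hr.
- by move=> f Hf a y Ha Hy; have := H4 f I a y Ha Hy; rewrite /tgraph /= /default_fun Hf.
- by move=> f Hf a Ha; have := H5 f I a Ha; rewrite /tgraph /= /default_fun Hf.
Qed.

End DefaultSymbols.

Lemma rsat_Ands (k : translation L L) (M : model L) (w : nat -> M) ps p E :
  rsat k w (Ands ps p) E <-> (forall q, List.In q ps -> rsat k w q E) /\ rsat k w p E.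
Proof.
elim: ps => [|q ps IH]; first by split=> [//|[]].
rewrite [Ands _ _]/(And q (Ands ps p)) [rsat _ _ (And _ _) _]/=.
have -> : ((rsat k w q E -> rsat k w (Ands ps p) E -> False) -> False) <-> rsat k w q E /\ rsat k w (Ands ps p) E by tauto.
rewrite IH; split=> [[Hq [Hps Hp]] | [H Hp]].
  by split=> // r /In_cons [->|/Hps].
by do ![split] => //; [apply: H; left | move=> r Hr; apply: H; right].
Qed.

(** After [k] is given default values outside the listed symbols, the identity laws hold for the
    whole signature. The objects of the translation then form a model of [p], hence of all
    consequences of [p], including those with unlisted symbols. *)
Lemma interprets_of_with_ids (V : theory L) (k : translation L L) p (Hp : sentence p) : sym_in inF inR p ->
  is_theorem V (wtranslate k (with_ids p)) -> interprets V (single Hp).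
Proof.
move=> Sp Hk; exists (default_trans k) => q Hq; have Hs := Hq.1.
have Hsp := sentence_with_ids Hp.
apply/is_theoremP; first exact: sentence_translate.
move=> M e HM; apply/sat_translate => //.
have Hsat (e' : nat -> M) : sat e' (wtranslate k (with_ids p)).
  apply: ((sat_sentence e e' (sentence_wtranslate k Hsp)).1).
  exact: ((is_theoremP _ (sentence_wtranslate k Hsp)).1 Hk M e HM).
have Hrsat (w : nat -> M) : sat w (tparam k) -> rsat k w (with_ids p) (fun _ _ => point M).
  move=> Hw; have [_ H] := (sat_wtranslate k (fun j => w (tpar k + j)) Hsp).1 (Hsat _).
  have E : bcons (tpar k) w (fun j => w (tpar k + j)) = w.
    by apply: funext => j; rewrite /bcons; case: ltnP => // Hj; rewrite subnKC.
  by move: (H w); rewrite E; apply.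
have HLw (w : nat -> M) : sat w (tparam k) -> laws k w inF inR.
  by move=> /Hrsat /rsat_Ands [H _]; apply: id_list_laws.
split.
  have [[b Hb] _] := (sat_wtranslate k e Hsp).1 (Hsat e).
  have [c Hc] := law_point (HLw _ Hb).
  (* The additional parameter, value of the unlisted functions, is any object of the domain, which
     is inhabited by [law_point]. *)
  pose b' j := if j < tpar k then b j else c (j - tpar k).
  exists b'; apply/sat_And; set w := bcons _ b' e.
  have Hw j : j < tpar k -> bcons (tpar k) b e j = w j.
    by move=> Hj; rewrite /w /= !bcons_lt ?(leq_trans Hj) ?leq_addr // /b' Hj.
  split; first by apply: ((sat_bounded (tparamP k) Hw).1 Hb).
  apply/sat_tapply; have Hc' : tdomain k w c.
    have Hm j : j < tpar k -> meq (bcons (tpar k) b e j) (w j) by move=> Hj; rewrite Hw //; apply: meq_refl.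
    by apply: ((tsat_wcong Hm _ _).1 Hc); rewrite mul1n tdomP.
  apply: tsat_imp Hc' _ => _ j _ Hj; rewrite /w /= bcons_lt ?ltn_add2l // /b'.
  by rewrite ltnNge leq_addr /= addKn.
move=> b; set w := bcons _ b e => /sat_And [Hw /sat_tapply Hc].
have Hc' : tdomain k w (fun j => w (tpar k + j)) by [].
have HR := inner_represents (default_laws Hc' (HLw w Hw)).
apply/(rsat_rep HR Hs) => //; first exact: sym_all.
have := HM; move: Hq => /(is_theoremP _ Hs) Hq _.
apply: Hq => _ ->.
apply/(rsat_rep (default_represents HR) Hp Sp) => //.
by have /rsat_Ands [] := Hrsat _ Hw.
Qed.

(** An interpretation carries over to a semantic consequence by the same [k], since the identity
    conjuncts supply an inner model in which the implication can be used. *)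
Lemma with_ids_absorb (V : theory L) (k : translation L L) p q : sentence p -> sentence q ->
  sym_in inF inR p -> sym_in inF inR q ->
  (forall (M : model L) (e : nat -> M), sat e q -> sat e p) ->
  is_theorem V (wtranslate k (with_ids q)) -> is_theorem V (wtranslate k (with_ids p)).
Proof.
move=> Hp Hq Sp Sq Hqp Hk.
have Hsp := sentence_with_ids Hp; have Hsq := sentence_with_ids Hq.
apply/is_theoremP; first exact: sentence_wtranslate.
move=> M e HM; apply/sat_wtranslate => //.
move/(is_theoremP _ (sentence_wtranslate k Hsq)): Hk => /(_ M e HM) /(sat_wtranslate _ _ Hsq) [H1 H2].
split=> // b /H2 /rsat_Ands [Hid Hqb]; apply/rsat_Ands; split=> //.
have HR := inner_represents (id_list_laws Hid).
by apply/(rsat_rep HR Hp Sp) => //; apply: Hqp; apply/(rsat_rep HR Hq Sq).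
Qed.

End Interpretation.

(** * Symbols and codes of the independent sentences *)

Section SigmaCodes.
Variables (L : signature) (tau : translation L_ap L) (th ch : sform).

(** The finitely many formulas from which all the sentences [sigma n] are assembled; one finite list
    of symbols therefore serves every [n]. *)
Definition sigma_pieces : seq (form L) :=
  [:: tparam tau; chain_step tau; chain_end tau th ch;
      tapply tau 1 (tdom tau) (fun _ j => j) (fun k => tdim tau + k);
      tapply tau 1 (tfun tau FZero) (fun _ j => j) (fun k => tdim tau + k)] ++
  [seq tform tau q (fun=> id) id | q <- id_list ap_fs ap_rs].

Variables (fs : seq (fsym L)) (rs : seq (rsym L)).
Hypothesis Hsym : forall p, List.In p sigma_pieces -> sym_in (fun f => f \in fs) (fun r => r \in rs) p.

Lemma sigma_param_sym q : List.In q (tparam tau :: [seq tform tau q (fun=> id) id | q <- id_list ap_fs ap_rs]) ->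
  sym_in (fun f => f \in fs) (fun r => r \in rs) q.
Proof.
move/In_cons => [->|Hq]; first by apply: Hsym; left.
by apply: Hsym; do 5!right.
Qed.

Lemma sigma_zero_sym q : List.In q [:: tapply tau 1 (tdom tau) (fun _ j => j) (fun k => tdim tau + k);
      tapply tau 1 (tfun tau FZero) (fun _ j => j) (fun k => tdim tau + k)] ->
  sym_in (fun f => f \in fs) (fun r => r \in rs) q.
Proof. by move=> [<-|[<-|//]]; apply: Hsym; [do 3!right; left | do 4!right; left]. Qed.

Lemma sigma_step_sym : sym_in (fun f => f \in fs) (fun r => r \in rs) (chain_step tau).
Proof. by apply: Hsym; right; left. Qed.

Lemma sigma_end_sym : sym_in (fun f => f \in fs) (fun r => r \in rs) (chain_end tau th ch).
Proof. by apply: Hsym; do 2!right; left. Qed.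

Lemma sym_in_sigma n : sym_in (fun f => f \in fs) (fun r => r \in rs) (sigma tau th ch n).
Proof.
apply/sym_in_Exs/sym_in_Ands; split; first exact: sigma_param_sym.
apply/sym_in_Exs/sym_in_Ands; split; first exact: sigma_zero_sym.
elim: n => [|n IH]; first exact: sigma_end_sym.
by apply/sym_in_Exs/sym_in_And; split; [exact: sigma_step_sym | exact: IH].
Qed.

(** In an interpretation of [A \/ sigma n] the sentence, already built from [tau], is translated
    again by a varying [k], so its code must be computable from [k] and [n] together. *)
Lemma kfam_sigma : kfam L fs rs (sigma tau th ch).
Proof.
apply/kfam_Exs/kfam_Ands; first exact: sigma_param_sym.
apply/kfam_Exs/kfam_Ands; first exact: sigma_zero_sym.
rewrite /chain_form; apply: kfam_iter; [exact: sigma_step_sym | exact: sigma_end_sym].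
Qed.

Lemma comp_iterEx m f : comp f -> comp (fun n => iter m cEx (f n)).
Proof.
move=> Hf; elim: m => //= m IH.
by do ![exact: comp_const | exact: IH | apply: comp_pair].
Qed.

Lemma comp_cAnd f g : comp f -> comp g -> comp (fun n => cAnd (f n) (g n)).
Proof. by move=> Hf Hg; do ![exact: comp_const | exact: Hf | exact: Hg | apply: comp_pair]. Qed.

Lemma comp_foldr_cAnd s f : comp f -> comp (fun n => foldr cAnd (f n) s).
Proof. by move=> Hf; elim: s => //= c s IH; apply: comp_cAnd => //; apply: comp_const. Qed.

Lemma comp_by_step g h : comp h -> (forall n, g n.+1 = h (g n)) -> comp g.
Proof.
move=> Hh Hg; have Hs : comp (fun z => h (csnd (csnd z))) by apply: comp_app Hh _; do 2!apply: comp_snd; apply: comp_id.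
apply: comp_ext (comp_rec (comp_const (g 0)) Hs comp_id) => x.
have H n : nat_rect (fun=> nat) (g 0) (fun i acc => h (csnd (csnd (cpair x (cpair i acc))))) n = g n.
  by elim: n => //= n ->; rewrite !cpE Hg.
exact: H.
Qed.

Lemma code_And (p q : form L) : code (And p q) = cAnd (code p) (code q).
Proof. by []. Qed.

Lemma chain_formS n : chain_form tau th ch n.+1 =
  Exs (tdim tau + tpar tau) (And (chain_step tau) (chain_form tau th ch n)).
Proof. by []. Qed.

Lemma comp_code_sigma : comp (fun n => code (sigma tau th ch n)).
Proof.
have Hc : comp (fun n => code (chain_form tau th ch n)).
  apply: (comp_by_step (h := fun c => iter (tdim tau + tpar tau) cEx (cAnd (code (chain_step tau)) c))).
    by apply/comp_iterEx/comp_cAnd; [exact: comp_const | exact: comp_id].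
  by move=> n; rewrite chain_formS code_Exs code_And.
apply: comp_ext (comp_iterEx (tpar tau) (comp_foldr_cAnd
  (map (@code L) (tparam tau :: [seq tform tau q (fun=> id) id | q <- id_list ap_fs ap_rs]))
  (comp_iterEx (tdim tau) (comp_foldr_cAnd (map (@code L) [:: tapply tau 1 (tdom tau) (fun _ j => j) (fun k => tdim tau + k);
      tapply tau 1 (tfun tau FZero) (fun _ j => j) (fun k => tdim tau + k)]) Hc)))) => n.
by rewrite /sigma code_Exs code_Ands code_Exs code_Ands.
Qed.

End SigmaCodes.

(** * The intermediate theory *)

Lemma axiom_theorem (L : signature) (X : theory L) p : axiom X p -> is_theorem X p.
Proof.
move=> Hp; split; first exact: axiom_sentence Hp.
by exists [:: p] => [q [<-|]|] //; apply: PAx; left.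
Qed.

Lemma subtheory_sat (L : signature) (X Y : theory L) (M : model L) (e : nat -> M) : subtheory X Y ->
  (forall q, axiom Y q -> sat e q) -> forall q, is_theorem X q -> sat e q.
Proof. by move=> HXY HM q Hq; have := HXY _ Hq; rewrite (is_theoremP _ Hq.1); apply. Qed.

Definition extend (L : signature) (X : theory L) (p : form L) (Hp : sentence p) : theory L := theory_union X (single Hp).

Lemma extend_theorem (L : signature) (X : theory L) (p : form L) (Hp : sentence p) q : sentence q ->
  is_theorem (extend X Hp) q <-> is_theorem X (Imp p q).
Proof.
move=> Hq; have Hpq : sentence (Imp p q) by rewrite /sentence /= -/(sentence p) Hp.
rewrite !is_theoremP //; split=> H M e HM.
  by move=> Sp; apply: H => r [/HM|->].
by apply: H => [r Hr|]; apply: HM; [left | right].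
Qed.

Lemma ce_extend (L : signature) (X : theory L) (p : form L) (Hp : sentence p) : ce_theory X -> ce_theory (extend X Hp).
Proof.
move=> HX; rewrite /ce_theory.
apply: (@ce_ext (fun n => exists2 q, is_theorem X q & code q = cImp (code p) n)).
  move=> n; split=> [[q Hq] | [q Hq <-]].
    (* By injectivity of the coding, a theorem with such a code is an implication from [p], and [n]
       is the code of its conclusion. *)
    case: q Hq => [|t u|r a|q1 q2|q] Hq /= /cpair_inj [] // _ /cpair_inj [/code_inj E <-]; subst q1.
    have Hq2 : sentence q2 by have := Hq.1; rewrite /sentence /= => /andP [].
    by exists q2 => //; apply/extend_theorem.
  by exists (Imp p q) => //; apply/(extend_theorem _ Hp Hq.1).
apply: (ce_app (A := fun n => exists2 q, is_theorem X q & code q = n)) => //.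
by do ![exact: comp_const | exact: comp_id | apply: comp_pair].
Qed.

Lemma exists_undecided (L : signature) (tau : translation L_ap L) (S : theory L) (A : form L) (HA : sentence A) :
  ce_theory S ->
  (forall q, axiom (theory_union R0p (id_theory L_ap)) q -> is_theorem S (translate tau q)) ->
  ~ interprets S (single HA) ->
  exists2 s, sentence s & forall H : sentence (Or A s),
    ~ interprets S (single H) /\ ~ interprets (extend S H) (single HA).
Proof.
move=> S_ce S_ap S_A.
have [th Hth] := sdef_ce 0 (ce_selfmaps 0); have [ch Hch] := sdef_ce 0 (ce_selfmaps 1).
have [fs [rs [fs_uniq rs_uniq Hsym]]] := symbols_exist (A :: sigma_pieces tau th ch).
have SA : sym_in (fun f => f \in fs) (fun r => r \in rs) A by apply: Hsym; left.
have Spieces p : List.In p (sigma_pieces tau th ch) -> sym_in (fun f => f \in fs) (fun r => r \in rs) p.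
  by move=> Hp; apply: Hsym; right.
set sg := sigma tau th ch.
have Ssg n : sentence (sg n) by apply: sentence_sigma.
have SOr n : sentence (Or A (sg n)) by rewrite /sentence /= -!/(sentence _) HA Ssg.
(* The event that [S] plus [sg n] interprets [A], brought into [S] by the deduction theorem so that
   one c.e. theory serves all [n]. *)
pose pev n := exists k : translation L L, is_theorem S (Imp (sg n) (wtranslate k (with_ids fs rs A))).
pose qev n := exists k : translation L L, is_theorem S (wtranslate k (with_ids fs rs (Or A (sg n)))).
have pev_ce : ce pev.
  apply: (ce_ex_translation fs_uniq rs_uniq S_ce).
  apply: kcomp_Imp; first exact: (kcomp_arg _ _ _ (comp_code_sigma tau th ch)).
  apply: (kcomp_wtranslate (fam := fun=> with_ids fs rs A)); apply: kfam_const.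
  by apply/sym_in_Ands; split=> // q; apply: sym_in_id_list.
have qev_ce : ce qev.
  apply: (ce_ex_translation fs_uniq rs_uniq S_ce).
  apply: (kcomp_wtranslate (fam := fun n => with_ids fs rs (Or A (sg n)))).
  apply: kfam_Ands; first by move=> q; apply: sym_in_id_list.
  by apply: kfam_Or; [apply: kfam_const | apply: kfam_sigma].
have Hundec : exists n, ~ pev n /\ ~ qev n.
  apply: NNPP => Hn.
  have [c Hc] : exists c, forall n, (reval c n 0 /\ pev n) \/ (reval c n 1 /\ qev n).
    apply: ce_choose => // n; apply: NNPP => Hpq; apply: Hn; exists n; tauto.
  (* Diagonalization: the selector is consulted at its own code, where its answer determines in
     which of the two sets this code lies. *)
  set n := rcode c in Hc; have Eth : ssat th (fun=> rcode c) <-> reval c (rcode c) 0 by rewrite Hth selfmapsP.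
  have Ech : ssat ch (fun=> rcode c) <-> reval c (rcode c) 1 by rewrite Hch selfmapsP.
  case: (Hc (rcode c)) => -[Hr [k Hk]]; apply: S_A.
    apply: (interprets_of_with_ids (k := k) HA SA).
    (* After the answer 0 the code lies in the first set and, programs being single-valued, not in
       the second; the premise [sg] of the implication is then provable in [S]. *)
    have Hsg : is_theorem S (sg (rcode c)).
      apply/is_theoremP => // M e HM; apply: sigma_proved.
      - by apply/bsat_ssat/Eth.
      - move=> j Hj; have /Ech H1 : ssat ch (fun=> rcode c) by apply/bsat_ssat; exists j.
        by have := reval_inj Hr H1.
      - by move=> q /S_ap Hq; move/(is_theoremP _ Hq.1): (Hq); apply.
    have Hs := sentence_wtranslate k (sentence_with_ids fs rs HA).
    apply/is_theoremP => // M e HM.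
    by apply: ((is_theoremP _ Hk.1).1 Hk M e HM); apply: ((is_theoremP _ Hsg.1).1 Hsg M e HM).
  apply: (interprets_of_with_ids (k := k) HA SA).
  have SOrA : sym_in (fun f => f \in fs) (fun r => r \in rs) (Or A (sg (rcode c))).
    exact: (conj (conj SA I) (sym_in_sigma Spieces _)).
  (* After the answer 1 the second disjunct fails in every model of the signature, so interpreting
     the disjunction amounts to interpreting [A]. *)
  apply: (with_ids_absorb HA (SOr _) SA SOrA _ Hk) => M e /sat_Or [//|Hs]; exfalso; move: Hs; apply: sigma_refuted; first by apply/bsat_ssat/Ech.
  move=> j Hj; have /Eth H0 : ssat th (fun=> rcode c) by apply/bsat_ssat; exists j.
  by have := reval_inj Hr H0.
have [n [Hp Hq]] := Hundec; exists (sg n) => // H; split=> Hint.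
  by apply: Hq; apply: interprets_with_ids Hint.
apply: Hp; have [k Hk] := interprets_with_ids fs rs Hint; exists k.
have Hs := sentence_wtranslate k (sentence_with_ids fs rs HA).
apply/is_theoremP; first by apply/andP; split; [exact: Ssg | exact: Hs].
move=> M e HM Hsg; apply: ((is_theoremP _ Hk.1).1 Hk M e) => q [/HM // | ->].
by apply/sat_Or; right.
Qed.

Theorem theorem8p15 (L : signature) (W S T : theory L)
    (W_ce : ce_theory W)
    (W_sourced : exists tau : translation L_ap L, R0p_sourced tau W)
    (S_ce : ce_theory S) (T_ce : ce_theory T)
    (W_sub_S : subtheory W S) (S_sub_T : subtheory S T)
    (S_T : ~ loc_interprets S T) :
  exists U : theory L,
    ce_theory U /\ subtheory S U /\ subtheory U T /\
    ~ loc_interprets S U /\ ~ loc_interprets U T.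
Proof.
have [U0 [[ps Hps] U0_T S_U0]] : exists U0 : theory L,
    [/\ finitely_axiomatized U0, subtheory U0 T & ~ interprets S U0].
  apply: NNPP => Hn; apply: S_T => U0 Hfin Hsub; apply: NNPP => HS; apply: Hn.
  by exists U0.
pose A := Ands ps (Neg Bot).
have HA : sentence A.
  rewrite /sentence bounded_Ands andbT; apply: all_In => p /Hps; exact: axiom_sentence.
have A_U0 (M : model L) (e : nat -> M) : sat e A <-> forall q, axiom U0 q -> sat e q.
  by rewrite sat_Ands; split=> [[H _] q /Hps /H | H] //; split=> // q /Hps /H.
have T_A : is_theorem T A.
  apply/is_theoremP => // M e HM; apply/A_U0 => q Hq.
  exact: subtheory_sat U0_T HM _ (axiom_theorem Hq).
have S_A : ~ interprets S (single HA).
  case=> k Hk; apply: S_U0; exists k => p Hp; apply: Hk; apply/(is_theoremP _ Hp.1) => M e HM.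
  by apply: ((is_theoremP _ Hp.1).1 Hp M e); apply/A_U0; apply: HM.
have [tau [_ W_tau]] := W_sourced.
have S_ap q : axiom (theory_union R0p (id_theory L_ap)) q -> is_theorem S (translate tau q).
  by move=> Hq; apply/W_sub_S/W_tau/axiom_theorem; exists q.
have [s Hs Hind] := exists_undecided S_ce S_ap S_A.
have HOr : sentence (Or A s) by rewrite /sentence /= -!/(sentence _) HA Hs.
have [S_U U_T] := Hind HOr.
exists (extend S HOr); split; first exact: ce_extend.
have S_sub_U : subtheory S (extend S HOr).
  move=> p Hp; apply/is_theoremP => [|M e HM]; first exact: Hp.1.
  by apply: ((is_theoremP _ Hp.1).1 Hp M e) => q Hq; apply: HM; left.
split=> //; split.
  move=> p Hp; apply/is_theoremP => [|M e HM]; first exact: Hp.1.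
  apply: ((is_theoremP _ Hp.1).1 Hp M e) => q [Hq | ->].
    exact: subtheory_sat S_sub_T HM _ (axiom_theorem Hq).
  by apply/sat_Or; left; apply: ((is_theoremP _ HA).1 T_A M e HM).
(* Each failure of local interpretability is witnessed by a theory with one axiom: [A \/ s] as a
   part of the new theory, and [A] as a part of [T]. *)
split=> H.
  by apply: S_U; apply: H; [exact: single_finite | apply/single_subtheory/axiom_theorem; right].
by apply: U_T; apply: H; [exact: single_finite | exact: single_subtheory].
Qed.
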